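(* Let $h_\Gamma\in C^2(\mathbb{R})$ be real-valued with compact support, and let $\Gamma=\{(x_1,x_2): x_2=h_\Gamma(x_1),\ x_1\in\mathbb{R}\}$. For $\ell\in\mathbb{R}$ let $\Gamma^\ell=\{(x_1+\ell,h_\Gamma(x_1)):x_1\in\mathbb{R}\}$ be the surface shifted along the $x_1$ direction. Let $k>0$ be the wave number, and let the incident wave be the superposition of two plane waves $u^i(x;d_1,d_2,k)=\exp(ikd_1\cdot x)+\exp(ikd_2\cdot x)$ with $d_j=(\sin\theta_j,-\cos\theta_j)$, $\theta_j\in(-\pi/2,\pi/2)$, $j=1,2$, and $\theta_1\neq\theta_2$. Let $u^s(x;d_1,d_2,k)$ and $u^s_\ell(x;d_1,d_2,k)$ be the scattering solutions corresponding to $\Gamma$ and to $\Gamma^\ell$, respectively, with far-field patterns $u^\infty(\hat{x};d_1,d_2,k)$ and $u^\infty_\ell(\hat{x};d_1,d_2,k)$. Assume that $\Gamma$ is non-trivial, that is, $h_\Gamma\not\equiv0$. Consider the identity $$|u^\infty(\hat{x};d_1,d_2,k)|=|u^\infty_\ell(\hat{x};d_1,d_2,k)|\quad\text{for all }\hat{x}\in\mathbb{S}^1_+.\qquad( * )$$ Then $( * )$ holds for all $\ell=\ell_n:=\dfrac{2\pi n}{k(\sin\theta_1-\sin\theta_2)}$ with any $n\in\mathbb{Z}$. Further, except for the values $\ell_n$, there may exist at most one real constant $\tau$ with $0<\tau<2\pi$ such that $( * )$ holds for $\ell=\ell_{n\tau}:=\dfrac{2\pi n+\tau}{k(\sin\theta_1-\sin\theta_2)}$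 with any $n\in\mathbb{Z}$.
   Context: Notation: $\mathbb{S}^1_+:=\{x=(x_1,x_2)\in\mathbb{R}^2:|x|=1,\ x_2>0\}$. Scattering problem for a locally rough surface. A locally rough surface is a graph $\Gamma=\{(x_1,x_2):x_2=h_\Gamma(x_1),\ x_1\in\mathbb{R}\}$ with $h_\Gamma\in C^2(\mathbb{R})$ of compact support; $D_+$ is the unbounded domain above $\Gamma$. For the incident field $u^i(x;d_1,d_2,k)=\exp(ikd_1\cdot x)+\exp(ikd_2\cdot x)$ with $d_j=(\sin\theta_j,-\cos\theta_j)$, the reflected wave with respect to the infinite plane $x_2=0$ is $u^r(x;d_1,d_2,k)=-\exp(ikd_1'\cdot x)-\exp(ikd_2'\cdot x)$ with $d_j'=(\sin\theta_j,\cos\theta_j)$, $j=1,2$. The scattering solution (scattered field) $u^s=u^s(\cdot;d_1,d_2,k)$ corresponding to $\Gamma$ is the unique (classical: $C^2$ in $D_+$, continuous up to $\Gamma$) solution of $$\Delta u^s+k^2u^s=0\ \text{ in } D_+,\qquad u^s=-(u^i+u^r)\ \text{ on }\Gamma,\qquad \lim_{r\to\infty}r^{1/2}\Big(\frac{\partial u^s}{\partial r}-ik u^s\Big)=0,\ r=|x|,$$ the last being the Sommerfeld radiation condition. Existence and uniqueness of this solution are known. For $\Gamma^\ell$ the scattering solution $u^s_\ell$ is defined in the same way, with $\Gamma$ replaced by $\Gamma^\ell$ and $D_+$ replaced by the unbounded domain above $\Gamma^\ell$, and with the same $u^i$ and $u^r$. Far-field pattern: $u^s$ has the asymptotic behavior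 $$u^s(x;d_1,d_2,k)=\frac{e^{ik|x|}}{\sqrt{|x|}}\Big(u^\infty(\hat{x};d_1,d_2,k)+O\Big(\frac1{|x|}\Big)\Big),\quad |x|\to\infty,$$ uniformly for all $\hat{x}=x/|x|\in\mathbb{S}^1_+$; $u^\infty$ is called the far-field pattern of $u^s$, and $u^\infty_\ell$ is the far-field pattern of $u^s_\ell$, defined in the same way. *)

(* Defs.v *)
From Stdlib Require Import Reals Lra.
From Coquelicot Require Import Coquelicot.
Open Scope R_scope.

(** Points of the plane are pairs [R * R]; fields are total functions
    [R * R -> C], of which only the values on the relevant closed region
    matter. *)

Definition dot (x y : R * R) : R := fst x * fst y + snd x * snd y.
Definition enorm (x : R * R) : R := sqrt (dot x x).
Definition direction (x : R * R) : R * R := (fst x / enorm x, snd x / enorm x).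

Definition upper_circle (x : R * R) : Prop := enorm x = 1 /\ 0 < snd x.

(** [expi t] is exp(i t) for real [t]. *)
Definition expi (t : R) : C := (cos t, sin t).

(** ** Surfaces *)

(** [Derive] is total, so differentiability is required at each order. *)
Definition C2_profile (h : R -> R) : Prop :=
  (forall t, ex_derive h t) /\
  (forall t, ex_derive (Derive h) t) /\
  (forall t, continuous (Derive (Derive h)) t).

Definition compactly_supported (h : R -> R) : Prop :=
  exists M : R, forall t, M < Rabs t -> h t = 0.

Definition graph (h : R -> R) (x : R * R) : Prop := snd x = h (fst x).
Definition above (h : R -> R) (x : R * R) : Prop := h (fst x) < snd x.
Definition above_or_on (h : R -> R) (x : R * R) : Prop := h (fst x) <= snd x.

(** The surface shifted by [l] along the first axis is again a graph, with
    profile [shift l h]; see [graph_shift]. *)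
Definition shift (l : R) (h : R -> R) : R -> R := fun t => h (t - l).

Lemma graph_shift (l : R) (h : R -> R) (x : R * R) :
  graph (shift l h) x <-> exists t : R, x = (t + l, h t).
Proof.
  unfold graph, shift; destruct x as [x1 x2]; simpl; split.
  - intros ->; exists (x1 - l); f_equal; lra.
  - intros [t Ht]; inversion Ht; f_equal; lra.
Qed.

(** ** Differential calculus for complex-valued functions on the plane *)

Definition pd1 (u : R * R -> C) (x : R * R) : C :=
  (Derive (fun t => Re (u (t, snd x))) (fst x),
   Derive (fun t => Im (u (t, snd x))) (fst x)).
Definition pd2 (u : R * R -> C) (x : R * R) : C :=
  (Derive (fun t => Re (u (fst x, t))) (snd x),
   Derive (fun t => Im (u (fst x, t))) (snd x)).

Definition ex_pd1 (u : R * R -> C) (x : R * R) : Prop :=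
  ex_derive (fun t => Re (u (t, snd x))) (fst x) /\
  ex_derive (fun t => Im (u (t, snd x))) (fst x).
Definition ex_pd2 (u : R * R -> C) (x : R * R) : Prop :=
  ex_derive (fun t => Re (u (fst x, t))) (snd x) /\
  ex_derive (fun t => Im (u (fst x, t))) (snd x).

Definition C1_on (D : R * R -> Prop) (u : R * R -> C) : Prop :=
  forall x, D x ->
    ex_pd1 u x /\ ex_pd2 u x /\ continuous (pd1 u) x /\ continuous (pd2 u) x.
Definition C2_on (D : R * R -> Prop) (u : R * R -> C) : Prop :=
  C1_on D u /\ C1_on D (pd1 u) /\ C1_on D (pd2 u).

Definition continuous_on_set (D : R * R -> Prop) (u : R * R -> C) : Prop :=
  forall x, D x -> filterlim u (within D (locally x)) (locally (u x)).

Definition laplacian (u : R * R -> C) (x : R * R) : C :=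
  (pd1 (pd1 u) x + pd2 (pd2 u) x)%C.

(** The derivative in r = |x|, as the gradient applied to x / |x|. *)
Definition radial_derivative (u : R * R -> C) (x : R * R) : C :=
  (RtoC (fst (direction x)) * pd1 u x + RtoC (snd (direction x)) * pd2 u x)%C.

(** ** The scattering problem *)

Definition inc_dir (th : R) : R * R := (sin th, - cos th).
Definition refl_dir (th : R) : R * R := (sin th, cos th).

Definition incident (th1 th2 k : R) (x : R * R) : C :=
  (expi (k * dot (inc_dir th1) x) + expi (k * dot (inc_dir th2) x))%C.
Definition reflected (th1 th2 k : R) (x : R * R) : C :=
  (- expi (k * dot (refl_dir th1) x) - expi (k * dot (refl_dir th2) x))%C.

(** The limit r -> oo is uniform over all directions in [D]. *)
Definition sommerfeld (D : R * R -> Prop) (k : R) (u : R * R -> C) : Prop :=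
  forall eps : R, 0 < eps ->
  exists r0 : R, forall x, D x -> r0 < enorm x ->
    Cmod (RtoC (sqrt (enorm x)) * (radial_derivative u x - Ci * RtoC k * u x))%C
      < eps.

Definition solves_scattering (h : R -> R) (th1 th2 k : R) (u : R * R -> C)
  : Prop :=
  C2_on (above h) u /\
  continuous_on_set (above_or_on h) u /\
  (forall x, above h x ->
     (laplacian u x + RtoC (k ^ 2) * u x)%C = RtoC 0) /\
  (forall x, graph h x ->
     u x = (- (incident th1 th2 k x + reflected th1 th2 k x))%C) /\
  sommerfeld (above h) k u.

(** [u] is "the" solution: it solves the problem, and every solution agrees
    with it up to the boundary. *)
Definition is_scattering_solution (h : R -> R) (th1 th2 k : R)
  (u : R * R -> C) : Prop :=
  solves_scattering h th1 th2 k u /\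
  (forall v, solves_scattering h th1 th2 k v ->
     forall x, above_or_on h x -> v x = u x).

(** Only the values of [uinf] on [upper_circle] matter.  For a compactly
    supported profile, every [x] with [0 < snd x] and |x| large lies above the
    surface. *)
Definition is_far_field (k : R) (u uinf : R * R -> C) : Prop :=
  exists (rho : R * R -> C) (A r0 : R),
    0 < r0 /\
    forall x, 0 < snd x -> r0 < enorm x ->
      u x = (expi (k * enorm x) / RtoC (sqrt (enorm x))
             * (uinf (direction x) + rho x))%C /\
      Cmod (rho x) <= A / enorm x.

Definition same_modulus (uinf vinf : R * R -> C) : Prop :=
  forall xh, upper_circle xh -> Cmod (uinf xh) = Cmod (vinf xh).

(** The shifts l_{n tau}; [shift_value th1 th2 k n 0] is l_n. *)
Definition shift_value (th1 th2 k : R) (n : Z) (tau : R) : R :=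
  (2 * PI * IZR n + tau) / (k * (sin th1 - sin th2)).

(* Main.v *)
(** Translating the problem for the shifted surface back to [h] multiplies the
    two plane waves by different phases, so with [u1], [u2] the solutions for the
    two waves separately (recovered from the data by linearity and uniqueness),
    the far field for the shift [l] has modulus
    [|u1oo + exp (- i k l (sin th1 - sin th2)) u2oo|].  This gives the first claim;
    two different values of tau would force [u1oo * conj u2oo = 0] everywhere, so by
    continuity one of the two far fields would vanish on an arc.

    That is impossible.  Above a large half disk [u] has sine coefficients [b_n] with
    [b_n'' = ((n^2 - 1/4) / r^2 - k^2) b_n].  The Wronskian [Im (conj b_n b_n')] equals
    [k] times the squared modulus of the [n]-th far-field coefficient, and on a
    bounded interval of radii [b_n] is exponentially small in [n]: the far field is
    analytic in the angle, so it vanishes identically.  Then an increasing energy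
    shows [b_n = 0] (Rellich), and unique continuation carries [u = 0] down to the
    surface, where the boundary values give [sin (k cos th h) = 0], so [h = 0]. *)

From Stdlib Require Import Reals ZArith Lra Lia Psatz Classical.
From Coquelicot Require Import Coquelicot.
Require Import Defs.
Open Scope R_scope.

(** * Second-order ordinary differential equations *)

(** The field is only continuous up to the boundary, so its sine coefficients over a full half
    circle cannot be integrated by parts. Coefficients over slightly shorter arcs, taken against the
    Dirichlet eigenfunctions of those arcs, obey the coefficient equation with a frequency error and
    a boundary term that both vanish as the arc grows; a uniform limit of such equations is the
    exact one. From then on elementary facts about p'' = V p replace Hankel functions: comparison
    with a cosh where V is large, conservation of the Wronskian, a monotone energy, uniqueness for
    initial data. The radiation condition is tied to the origin, and a sideways translation changes
    the radial direction. That error is paid for by an interior gradient bound, which rests on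
    boundedness of the field, which in turn comes from the far field. Continuity of the far field is
    not given either: it is obtained as a uniform limit of rescaled traces on large circles. Unique
    continuation reuses the sine coefficients, on small half disks, through odd reflection in a
    horizontal line. *)

Lemma is_derive_Rmult (f g : R -> R) (x a b : R) :
  is_derive f x a -> is_derive g x b ->
  is_derive (fun t => f t * g t) x (a * g x + f x * b).
Proof.
  intros Hf Hg. apply is_derive_Reals.
  apply derivable_pt_lim_mult; now apply is_derive_Reals.
Qed.

Lemma is_derive_increasing_right (f : R -> R) (x l : R) :
  is_derive f x l -> 0 < l ->
  exists d, 0 < d /\ forall y, x < y < x + d -> f x < f y.
Proof.
  intros Hf Hl. apply is_derive_Reals in Hf.
  destruct (Hf l Hl) as [d Hd]. exists d; split; [apply cond_pos|].
  intros y Hy.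
  assert (Hh : y - x <> 0) by lra.
  specialize (Hd (y - x) Hh). rewrite Rabs_pos_eq in Hd by lra.
  specialize (Hd ltac:(lra)). apply Rabs_def2 in Hd.
  replace (x + (y - x)) with y in Hd by ring.
  assert (0 < (f y - f x) / (y - x)) by lra.
  assert (f y - f x = (f y - f x) / (y - x) * (y - x)) by (field; lra).
  nra.
Qed.

Lemma is_derive_mvt (f f1 : R -> R) (a b : R) :
  a < b -> (forall x, a <= x <= b -> is_derive f x (f1 x)) ->
  exists c, a <= c <= b /\ f b - f a = f1 c * (b - a).
Proof.
  intros Hab Hf. destruct (MVT_gen f a b f1) as [c Hc].
  - rewrite Rmin_left, Rmax_right by lra. intros; apply Hf; lra.
  - rewrite Rmin_left, Rmax_right by lra. intros x Hx.
    apply continuity_pt_filterlim.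
    apply @ex_derive_continuous. eexists; apply Hf; lra.
  - rewrite Rmin_left, Rmax_right in Hc by lra. now exists c.
Qed.

Lemma is_derive_nondecreasing (f f1 : R -> R) (a b : R) :
  a <= b -> (forall x, a <= x <= b -> is_derive f x (f1 x)) ->
  (forall x, a <= x <= b -> 0 <= f1 x) -> f a <= f b.
Proof.
  intros Hab Hf H1. destruct (Req_dec a b) as [->|]; [lra|].
  destruct (is_derive_mvt f f1 a b) as [c [Hc E]]; [lra|assumption|].
  specialize (H1 c Hc). nra.
Qed.

Lemma second_derivative_at_max (f f1 : R -> R) (x l d : R) :
  0 < d -> (forall y, Rabs (y - x) < d -> is_derive f y (f1 y)) ->
  is_derive f1 x l -> (forall y, Rabs (y - x) < d -> f y <= f x) -> l <= 0.
Proof.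
  intros Hd Hf Hl Hmax.
  assert (H0 : f1 x = 0).
  { assert (Hx : is_derive f x (f1 x)).
    { apply Hf. rewrite Rminus_diag, Rabs_R0; lra. }
    assert (pr : derivable_pt f x).
    { exists (f1 x). now apply is_derive_Reals. }
    rewrite <- (is_derive_unique _ _ _ Hx), <- (Derive_Reals f x pr).
    apply (deriv_maximum f (x - d) (x + d)); [lra|lra|].
    intros y Hy Hy2. apply Hmax. apply Rabs_def1; lra. }
  destruct (Rle_or_lt l 0) as [|Hpos]; [assumption|exfalso].
  destruct (is_derive_increasing_right _ _ _ Hl Hpos) as [e [He H1]].
  set (h := Rmin d e).
  assert (Hh : 0 < h) by (apply Rmin_glb_lt; lra).
  assert (Hhd : h <= d) by apply Rmin_l. assert (Hhe : h <= e) by apply Rmin_r.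
  assert (Hnear : forall a b y, x <= a -> b <= x + h / 2 -> a <= y <= b ->
            is_derive f y (f1 y)).
  { intros a b y Ha Hb Hy. apply Hf, Rabs_def1; lra. }
  (* Two steps are needed: the first mean value point may be [x] itself, where [f1] vanishes, so
     only the second step gives a strict increase of [f]. *)
  destruct (is_derive_mvt f f1 x (x + h / 4)) as [c [Hc E]]; [lra| |].
  { intros y Hy. apply (Hnear x (x + h / 4)); lra. }
  destruct (is_derive_mvt f f1 (x + h / 4) (x + h / 2)) as [c' [Hc' E']]; [lra| |].
  { intros y Hy. apply (Hnear (x + h / 4) (x + h / 2)); lra. }
  assert (0 <= f1 c).
  { destruct (Req_dec c x) as [->|]; [lra|]. specialize (H1 c ltac:(lra)). lra. }
  specialize (H1 c' ltac:(lra)).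
  assert (f (x + h / 2) <= f x) by (apply Hmax, Rabs_def1; lra). nra.
Qed.

Lemma is_derive_continuity_pt (f : R -> R) (x l : R) :
  is_derive f x l -> continuity_pt f x.
Proof.
  intros H. apply continuity_pt_filterlim, @ex_derive_continuous.
  now exists l.
Qed.

(** Comparison with [Phi], the multiple of cosh(kappa (r - m)) that equals [M] at both ends. At a
    positive interior maximum of [p - Phi] the second derivative would be positive because [V] is at
    least kappa^2. The gain at the midpoint is 1 / cosh kappa. *)
Lemma ode_decay (p p1 V : R -> R) (m kappa M : R) :
  0 < kappa -> 0 <= M ->
  (forall r, m - 1 <= r <= m + 1 -> is_derive p r (p1 r)) ->
  (forall r, m - 1 <= r <= m + 1 -> is_derive p1 r (V r * p r)) ->
  (forall r, m - 1 <= r <= m + 1 -> kappa ^ 2 <= V r) ->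
  p (m - 1) <= M -> p (m + 1) <= M ->
  p m <= 2 * M * exp (- kappa).
Proof.
  intros Hk HM Hp Hp1 HV Hl Hr.
  set (A := M / (exp kappa + exp (- kappa))).
  pose proof (exp_pos kappa) as He. pose proof (exp_pos (- kappa)) as He'.
  assert (HA : 0 <= A) by (apply Rdiv_le_0_compat; lra).
  assert (HAM : A * (exp kappa + exp (- kappa)) = M) by (unfold A; field; lra).
  set (Phi := fun r => A * (exp (kappa * (r - m)) + exp (- (kappa * (r - m))))).
  set (Phi1 := fun r =>
    A * kappa * (exp (kappa * (r - m)) - exp (- (kappa * (r - m))))).
  assert (HPhi : forall r, is_derive Phi r (Phi1 r)).
  { intros r; unfold Phi, Phi1, Rminus; auto_derive; trivial; ring. }
  assert (HPhi1 : forall r, is_derive Phi1 r (kappa ^ 2 * Phi r)).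
  { intros r; unfold Phi, Phi1, Rminus; auto_derive; trivial; ring. }
  assert (HPnn : forall r, 0 <= Phi r).
  { intros r; unfold Phi. apply Rmult_le_pos; trivial.
    pose proof (exp_pos (kappa * (r - m))).
    pose proof (exp_pos (- (kappa * (r - m)))). lra. }
  assert (HD : forall r, m - 1 <= r <= m + 1 ->
            is_derive (fun r => p r - Phi r) r (p1 r - Phi1 r)).
  { intros r H. apply @is_derive_minus; auto. }
  destruct (continuity_ab_maj (fun r => p r - Phi r) (m - 1) (m + 1))
    as [x [Hmax Hx]]; [lra| |].
  { intros c Hc. eapply is_derive_continuity_pt; eauto. }
  assert (Hend : Phi (m - 1) = M /\ Phi (m + 1) = M).
  { unfold Phi; rewrite <- HAM; split.
    - replace (kappa * (m - 1 - m)) with (- kappa) by ring.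
      rewrite Ropp_involutive; ring.
    - replace (kappa * (m + 1 - m)) with kappa by ring. ring. }
  assert (Hle : p x - Phi x <= 0).
  { destruct (Rle_or_lt (p x - Phi x) 0) as [|Hpos]; trivial. exfalso.
    assert (Hne1 : x <> m - 1) by (intros ->; lra).
    assert (Hne2 : x <> m + 1) by (intros ->; lra).
    set (d := Rmin (x - (m - 1)) (m + 1 - x)).
    assert (d <= x - (m - 1)) by apply Rmin_l.
    assert (d <= m + 1 - x) by apply Rmin_r.
    assert (Hd : 0 < d) by (apply Rmin_glb_lt; lra).
    assert (Hn : V x * p x - kappa ^ 2 * Phi x <= 0).
    { apply (second_derivative_at_max (fun r => p r - Phi r)
               (fun r => p1 r - Phi1 r) x _ d Hd).
      - intros y Hy. apply Rabs_def2 in Hy. apply HD. lra.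
      - apply @is_derive_minus; [apply Hp1; lra|apply HPhi1].
      - intros y Hy. apply Rabs_def2 in Hy. apply Hmax. lra. }
    specialize (HV x Hx). specialize (HPnn x).
    assert (0 < kappa ^ 2) by (apply pow_lt; lra). nra. }
  assert (Hm : p m - Phi m <= 0) by (specialize (Hmax m ltac:(lra)); lra).
  assert (HPm : Phi m = 2 * A).
  { unfold Phi. replace (kappa * (m - m)) with 0 by ring.
    rewrite Ropp_0, exp_0; ring. }
  assert (exp kappa * exp (- kappa) = 1).
  { rewrite <- exp_plus, Rplus_opp_r. apply exp_0. }
  assert (A <= M * exp (- kappa)).
  { rewrite <- HAM.
    replace (A * (exp kappa + exp (- kappa)) * exp (- kappa))
      with (A * (exp kappa * exp (- kappa)) + A * exp (- kappa) * exp (- kappa))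
      by ring.
    assert (0 <= A * exp (- kappa) * exp (- kappa)).
    { apply Rmult_le_pos; [apply Rmult_le_pos|]; lra. } nra. }
  lra.
Qed.

(** Gronwall for p^2 + p1^2, whose derivative is at most 1 + K times itself in absolute value:
    multiplied by a suitable exponential it is monotone, to the right and to the left of [x0]. *)
Lemma ode_unique (p p1 V : R -> R) (a b x0 : R) :
  a < x0 < b ->
  (forall r, a < r < b -> is_derive p r (p1 r)) ->
  (forall r, a < r < b -> is_derive p1 r (V r * p r)) ->
  (forall c d, a < c -> d < b ->
     exists K, forall r, c <= r <= d -> Rabs (V r) <= K) ->
  p x0 = 0 -> p1 x0 = 0 ->
  forall x, a < x < b -> p x = 0.
Proof.
  intros Hx0 Hp Hp1 HV H0 H1 x Hx.
  set (e := fun r => p r ^ 2 + p1 r ^ 2).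
  set (e1 := fun r => 2 * p r * p1 r * (1 + V r)).
  assert (He : forall r, a < r < b -> is_derive e r (e1 r)).
  { intros r Hr. unfold e, e1.
    evar_last.
    - apply @is_derive_plus; apply is_derive_pow; auto.
    - simpl; unfold plus; simpl; ring. }
  assert (Hx0e : e x0 = 0) by (unfold e; rewrite H0, H1; ring).
  assert (Hex : e x <= 0).
  { destruct (HV (Rmin x x0) (Rmax x x0)) as [K HK].
    - apply Rmin_glb_lt; lra.
    - apply Rmax_lub_lt; lra.
    - assert (Hb : forall r, Rmin x x0 <= r <= Rmax x x0 ->
                Rabs (e1 r) <= (1 + K) * e r).
      { intros r Hr. specialize (HK r Hr). unfold e1, e.
        rewrite Rabs_mult.
        assert (Rabs (2 * p r * p1 r) <= p r ^ 2 + p1 r ^ 2).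
        { apply Rabs_le. pose proof (pow2_ge_0 (p r + p1 r)).
          pose proof (pow2_ge_0 (p r - p1 r)). split; nra. }
        assert (Rabs (1 + V r) <= 1 + K).
        { eapply Rle_trans; [apply Rabs_triang|]. rewrite Rabs_R1; lra. }
        rewrite Rmult_comm. apply Rmult_le_compat; trivial; apply Rabs_pos. }
      destruct (Rle_or_lt x0 x) as [Hle|Hlt].
      + rewrite Rmin_right, Rmax_left in Hb by lra.
        assert (Hmon : - (e x0 * exp (- (1 + K) * x0))
                  <= - (e x * exp (- (1 + K) * x))).
        { apply (is_derive_nondecreasing (fun r => - (e r * exp (- (1 + K) * r)))
            (fun r => - (e1 r * exp (- (1 + K) * r)
               + e r * (- (1 + K) * exp (- (1 + K) * r))))); trivial.
          - intros r Hr. apply @is_derive_opp.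
            apply (is_derive_Rmult e (fun r => exp (- (1 + K) * r))); [apply He; lra|].
            auto_derive; trivial; ring.
          - intros r Hr. specialize (Hb r Hr). apply Rabs_le_between in Hb.
            pose proof (exp_pos (- (1 + K) * r)). nra. }
        rewrite Hx0e in Hmon. pose proof (exp_pos (- (1 + K) * x)). nra.
      + rewrite Rmin_left, Rmax_right in Hb by lra.
        assert (Hmon : e x * exp ((1 + K) * x) <= e x0 * exp ((1 + K) * x0)).
        { apply (is_derive_nondecreasing (fun r => e r * exp ((1 + K) * r))
            (fun r => e1 r * exp ((1 + K) * r)
               + e r * ((1 + K) * exp ((1 + K) * r)))); [lra| |].
          - intros r Hr. apply (is_derive_Rmult e (fun r => exp ((1 + K) * r))); [apply He; lra|].
            auto_derive; trivial; ring.
          - intros r Hr. specialize (Hb r Hr). apply Rabs_le_between in Hb.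
            pose proof (exp_pos ((1 + K) * r)). nra. }
        rewrite Hx0e in Hmon. pose proof (exp_pos ((1 + K) * x)). nra. }
  unfold e in Hex. nra.
Qed.

Lemma bessel_potential_bounded (nu k c d : R) :
  0 < c -> exists K, forall r, c <= r <= d -> Rabs (nu / r ^ 2 - k ^ 2) <= K.
Proof.
  intros Hc. exists (Rabs nu / c ^ 2 + k ^ 2). intros r Hr.
  assert (0 < c ^ 2) by (apply pow_lt; lra).
  assert (c ^ 2 <= r ^ 2) by (apply pow_incr; lra).
  unfold Rminus. eapply Rle_trans; [apply Rabs_triang|].
  rewrite Rabs_Ropp, (Rabs_pos_eq (k ^ 2)) by apply pow2_ge_0.
  apply Rplus_le_compat_r. unfold Rdiv. rewrite Rabs_mult.
  apply Rmult_le_compat_l; [apply Rabs_pos|].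
  rewrite Rabs_pos_eq by (left; apply Rinv_0_lt_compat; lra).
  apply Rinv_le_contravar; lra.
Qed.

(* The energy [p'^2 - V p^2] is nondecreasing and tends to 0; it dominates
   [k^2 p^2 / 2] for large [r], so [p] vanishes there. *)
Lemma bessel_rellich (p p1 : R -> R) (nu k a : R) :
  0 < nu -> 0 < k -> 0 <= a ->
  (forall r, a < r -> is_derive p r (p1 r)) ->
  (forall r, a < r -> is_derive p1 r ((nu / r ^ 2 - k ^ 2) * p r)) ->
  (forall eps, 0 < eps -> exists r0, forall r, r0 < r -> Rabs (p r) < eps) ->
  (forall eps, 0 < eps -> exists r0, forall r, r0 < r -> Rabs (p1 r) < eps) ->
  forall r, a < r -> p r = 0.
Proof.
  intros Hnu Hk Ha Hp Hp1 Lp Lp1.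
  set (E := fun r => p1 r ^ 2 + (k ^ 2 - nu / r ^ 2) * p r ^ 2).
  assert (HE : forall r, a < r -> is_derive E r (2 * nu / r ^ 3 * p r ^ 2)).
  { intros r Hr. unfold E. evar_last.
    - apply @is_derive_plus.
      + apply is_derive_pow, Hp1, Hr.
      + apply (is_derive_Rmult (fun r => k ^ 2 - nu / r ^ 2)).
        * instantiate (1 := 2 * nu / r ^ 3). auto_derive; [nra|]. field; lra.
        * apply is_derive_pow, Hp, Hr.
    - simpl; unfold plus; simpl. field; lra. }
  assert (Hmono : forall r s, a < r -> r <= s -> E r <= E s).
  { intros r s Hr Hs.
    apply (is_derive_nondecreasing E (fun r => 2 * nu / r ^ 3 * p r ^ 2)); trivial.
    - intros x Hx; apply HE; lra.
    - intros x Hx. apply Rmult_le_pos; [|apply pow2_ge_0].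
      apply Rdiv_le_0_compat; [lra|apply pow_lt; lra]. }
  assert (HE0 : forall r, a < r -> E r <= 0).
  { intros r Hr. apply Rnot_lt_le; intros Hpos.
    set (eps := Rmin 1 (E r / (2 + 2 * k ^ 2))).
    assert (Hk2 : 0 < k ^ 2) by (apply pow_lt; lra).
    assert (Heps : 0 < eps).
    { apply Rmin_glb_lt; [lra|]. apply Rdiv_lt_0_compat; lra. }
    destruct (Lp eps Heps) as [r1 H1]. destruct (Lp1 eps Heps) as [r2 H2].
    set (s := Rmax r (Rmax r1 r2) + 1).
    assert (r <= Rmax r (Rmax r1 r2)) by apply Rmax_l.
    assert (Rmax r1 r2 <= Rmax r (Rmax r1 r2)) by apply Rmax_r.
    pose proof (Rmax_l r1 r2). pose proof (Rmax_r r1 r2).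
    specialize (Hmono r s Hr ltac:(unfold s; lra)).
    specialize (H1 s ltac:(unfold s; lra)). specialize (H2 s ltac:(unfold s; lra)).
    assert (eps <= 1) by apply Rmin_l.
    assert (He2 : eps <= E r / (2 + 2 * k ^ 2)) by apply Rmin_r.
    assert (Hsq : forall x, Rabs x < eps -> x ^ 2 <= eps).
    { intros x Hx. rewrite <- (pow2_abs x). pose proof (Rabs_pos x). nra. }
    apply Hsq in H1. apply Hsq in H2.
    assert (Hnr : 0 <= nu / s ^ 2).
    { apply Rdiv_le_0_compat; [lra|apply pow_lt; unfold s; lra]. }
    assert (Hle : E s <= eps + k ^ 2 * eps).
    { unfold E. pose proof (pow2_ge_0 (p s)). nra. }
    apply Rmult_le_compat_r with (r := 2 + 2 * k ^ 2) in He2; [|lra].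
    unfold Rdiv in He2. rewrite Rmult_assoc, Rinv_l, Rmult_1_r in He2 by lra.
    nra. }
  assert (Hbig : exists s, a < s /\ forall r, s <= r -> p r = 0 /\ p1 r = 0).
  (* Beyond this radius r^2 >= r > nu / k^2, so both terms of [E] are nonnegative, and [E r <= 0]
     forces [p] and [p1] to vanish. *)
  { exists (a + 1 + 2 * nu / k ^ 2).
    assert (Hk2 : 0 < k ^ 2) by (apply pow_lt; lra).
    assert (Hq : 0 < nu / k ^ 2) by (apply Rdiv_lt_0_compat; lra).
    assert (Hq2 : nu / k ^ 2 * k ^ 2 = nu) by (field; lra).
    set (q := nu / k ^ 2) in *.
    replace (2 * nu / k ^ 2) with (2 * q) by (unfold q; field; lra).
    clearbody q. split; [lra|]. intros r Hr.
    specialize (HE0 r ltac:(lra)). unfold E in HE0.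
    assert (Hr2 : 0 < r ^ 2) by (apply pow_lt; lra).
    assert (Hr1 : r <= r ^ 2) by nra.
    assert (Hnr : nu / r ^ 2 < k ^ 2).
    { apply Rmult_lt_reg_r with (r ^ 2); trivial.
      replace (nu / r ^ 2 * r ^ 2) with nu by (field; lra). nra. }
    pose proof (pow2_ge_0 (p r)). pose proof (pow2_ge_0 (p1 r)).
    assert (p r ^ 2 = 0) by nra. assert (p1 r ^ 2 = 0) by nra.
    split; nra. }
  destruct Hbig as [s [Hs Hz]]. intros r Hr.
  apply (ode_unique p p1 (fun r => nu / r ^ 2 - k ^ 2) a (Rmax r s + 1) s).
  - pose proof (Rmax_r r s); lra.
  - intros; apply Hp; lra.
  - intros; apply Hp1; lra.
  - intros c d Hc _. apply bessel_potential_bounded; lra.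
  - apply Hz; lra.
  - apply Hz; lra.
  - pose proof (Rmax_l r s); lra.
Qed.

(** The distance from the chord is a difference of two mean value slopes times [x - c], and the
    second derivative controls that difference. *)
Lemma near_linear_interpolation (q q1 q2 : R -> R) (c d e x : R) :
  c < d -> c <= x <= d ->
  (forall y, c <= y <= d -> is_derive q y (q1 y)) ->
  (forall y, c <= y <= d -> is_derive q1 y (q2 y)) ->
  (forall y, c <= y <= d -> Rabs (q2 y) <= e) ->
  Rabs (q x - (q c + (q d - q c) / (d - c) * (x - c))) <= e * (d - c) ^ 2.
Proof.
  intros Hcd Hx Hq Hq1 He.
  assert (He0 : 0 <= e).
  { eapply Rle_trans; [apply Rabs_pos|]. apply (He c); lra. }
  destruct (Req_dec x c) as [->|Hne].
  { rewrite Rminus_diag, Rmult_0_r, Rplus_0_r, Rminus_diag, Rabs_R0.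
    apply Rmult_le_pos; [lra|apply pow2_ge_0]. }
  destruct (is_derive_mvt q q1 c x) as [y [Hy Ey]]; [lra| |].
  { intros; apply Hq; lra. }
  destruct (is_derive_mvt q q1 c d) as [z [Hz Ez]]; trivial.
  assert (Hyz : Rabs (q1 y - q1 z) <= e * (d - c)).
  { destruct (MVT_gen q1 z y q2) as [w [Hw Ew]].
    - intros w Hw. apply Hq1. pose proof (Rmin_glb z y c). pose proof (Rmax_lub z y d). lra.
    - intros w Hw. eapply is_derive_continuity_pt. apply Hq1.
      pose proof (Rmin_glb z y c). pose proof (Rmax_lub z y d). lra.
    - rewrite Ew, Rabs_mult. apply Rmult_le_compat; try apply Rabs_pos.
      + apply He. pose proof (Rmin_glb z y c). pose proof (Rmax_lub z y d). lra.
      + apply Rabs_le; lra. }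
  replace (q x - (q c + (q d - q c) / (d - c) * (x - c)))
    with ((q1 y - q1 z) * (x - c)).
  2: { rewrite Ez. replace (q x) with (q c + q1 y * (x - c)) by lra. field; lra. }
  rewrite Rabs_mult. replace (e * (d - c) ^ 2) with (e * (d - c) * (d - c)) by ring.
  apply Rmult_le_compat; try apply Rabs_pos; trivial.
  rewrite Rabs_pos_eq; lra.
Qed.

(** A Landau-type inequality: smallness of a function and of its second derivative passes to the
    first derivative. It is what transfers the radiation condition from [arc] to [coef]. *)
Lemma derivative_interpolation (q q1 q2 : R -> R) (c d e x : R) :
  c < d -> c <= x <= d ->
  (forall y, c <= y <= d -> is_derive q y (q1 y)) ->
  (forall y, c <= y <= d -> is_derive q1 y (q2 y)) ->
  (forall y, c <= y <= d -> Rabs (q y) <= e) ->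
  (forall y, c <= y <= d -> Rabs (q2 y) <= e) ->
  Rabs (q1 x) <= e * (2 / (d - c) + (d - c)).
Proof.
  intros Hcd Hx Hq Hq1 Hq0 He.
  destruct (is_derive_mvt q q1 c d) as [z [Hz Ez]]; trivial.
  assert (Hxz : Rabs (q1 x - q1 z) <= e * (d - c)).
  { destruct (MVT_gen q1 z x q2) as [w [Hw Ew]].
    - intros w Hw. apply Hq1. pose proof (Rmin_glb z x c). pose proof (Rmax_lub z x d). lra.
    - intros w Hw. eapply is_derive_continuity_pt. apply Hq1.
      pose proof (Rmin_glb z x c). pose proof (Rmax_lub z x d). lra.
    - rewrite Ew, Rabs_mult. apply Rmult_le_compat; try apply Rabs_pos.
      + apply He. pose proof (Rmin_glb z x c). pose proof (Rmax_lub z x d). lra.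
      + apply Rabs_le; lra. }
  assert (Hz1 : Rabs (q1 z) <= e * (2 / (d - c))).
  { replace (q1 z) with ((q d - q c) / (d - c)) by (rewrite Ez; field; lra).
    unfold Rdiv. rewrite Rabs_mult, (Rabs_pos_eq (/ (d - c))).
    2: { left; apply Rinv_0_lt_compat; lra. }
    rewrite <- Rmult_assoc. apply Rmult_le_compat_r.
    { left; apply Rinv_0_lt_compat; lra. }
    unfold Rminus. eapply Rle_trans; [apply Rabs_triang|]. rewrite Rabs_Ropp.
    pose proof (Hq0 c ltac:(lra)). pose proof (Hq0 d ltac:(lra)). lra. }
  replace (q1 x) with ((q1 x - q1 z) + q1 z) by ring.
  eapply Rle_trans; [apply Rabs_triang|]. lra.
Qed.

(** Only values and second derivatives of the approximants are controlled. Subtracting a double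
    primitive of [g] leaves a uniform limit of functions whose second derivatives tend to zero, and
    such a limit is affine. *)
Lemma ode_limit (f g : R -> R) (a b : R) :
  (forall x, a < x < b -> continuous g x) ->
  (forall c d e, a < c -> c < d -> d < b -> 0 < e ->
     exists p p1 p2, forall x, c <= x <= d ->
       is_derive p x (p1 x) /\ is_derive p1 x (p2 x) /\
       Rabs (p x - f x) <= e /\ Rabs (p2 x - g x) <= e) ->
  forall x, a < x < b ->
    is_derive f x (Derive f x) /\ is_derive (Derive f) x (g x).
Proof.
  intros Hg Happ x Hx.
  set (c := (a + x) / 2). set (d := (x + b) / 2).
  assert (Hc : a < c) by (unfold c; lra). assert (Hcx : c < x) by (unfold c; lra).
  assert (Hd : d < b) by (unfold d; lra). assert (Hxd : x < d) by (unfold d; lra).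
  clearbody c d.
  set (G1 := fun y => RInt g c y). set (G := fun y => RInt G1 c y).
  assert (HexG : forall y, a < y < b -> ex_RInt g c y).
  { intros y Hy. apply (ex_RInt_continuous (V := R_CompleteNormedModule)).
    intros z Hz. apply Hg. pose proof (Rmin_glb_lt c y a).
    pose proof (Rmax_lub_lt c y b). lra. }
  assert (HG1 : forall y, a < y < b -> is_derive G1 y (g y)).
  { intros y Hy. apply (is_derive_RInt g G1 c y).
    - apply (locally_interval _ y a b); [apply Hy|apply Hy|].
      intros z Hz1 Hz2. apply (RInt_correct g c z), HexG. split; assumption.
    - now apply Hg. }
  assert (HG : forall y, a < y < b -> is_derive G y (G1 y)).
  { intros y Hy. apply (is_derive_RInt G1 G c y).
    - apply (locally_interval _ y a b); [apply Hy|apply Hy|].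
      intros z Hz1 Hz2. apply (RInt_correct G1 c z).
      apply (ex_RInt_continuous (V := R_CompleteNormedModule)).
      intros w Hw. apply @ex_derive_continuous. exists (g w). apply HG1.
      pose proof (Rmin_glb_lt c z a). pose proof (Rmax_lub_lt c z b).
      simpl in Hz1, Hz2. lra.
    - apply @ex_derive_continuous. exists (g y). now apply HG1. }
  set (F := fun y => f y - G y).
  assert (Hlin : forall y, c <= y <= d ->
            F y = F c + (F d - F c) / (d - c) * (y - c)).
  { intros y Hy.
    cut (Rabs (F y - (F c + (F d - F c) / (d - c) * (y - c))) <= 0).
    { intros H. pose proof (Rabs_pos (F y - (F c + (F d - F c) / (d - c) * (y - c)))).
      assert (Habs0 : Rabs (F y - (F c + (F d - F c) / (d - c) * (y - c))) = 0) by lra.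
      apply Rabs_eq_0 in Habs0. lra. }
    apply le_epsilon. intros eps Heps. rewrite Rplus_0_l.
    set (e := eps / ((d - c) ^ 2 + 4)).
    assert (0 < (d - c) ^ 2) by (apply pow_lt; lra).
    assert (He : 0 < e) by (apply Rdiv_lt_0_compat; lra).
    assert (Hee : e * ((d - c) ^ 2 + 4) = eps) by (unfold e; field; lra).
    destruct (Happ c d e) as [p [p1 [p2 Hp]]]; try lra.
    set (q := fun y => p y - G y).
    assert (Hq : Rabs (q y - (q c + (q d - q c) / (d - c) * (y - c)))
                 <= e * (d - c) ^ 2).
    { apply (near_linear_interpolation q (fun y => p1 y - G1 y)
               (fun y => p2 y - g y)); try lra.
      - intros z Hz. apply @is_derive_minus; [apply Hp; lra|apply HG; lra].
      - intros z Hz. apply @is_derive_minus; [apply Hp; lra|apply HG1; lra].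
      - intros z Hz. apply Hp; lra. }
    set (t := (y - c) / (d - c)).
    assert (Ht : 0 <= t <= 1).
    { unfold t; split; [apply Rdiv_le_0_compat; lra|].
      apply Rmult_le_reg_r with (d - c); [lra|].
      replace ((y - c) / (d - c) * (d - c)) with (y - c) by (field; lra). lra. }
    replace (q c + (q d - q c) / (d - c) * (y - c))
      with (q c + (q d - q c) * t) in Hq by (unfold t; field; lra).
    replace (F c + (F d - F c) / (d - c) * (y - c))
      with (F c + (F d - F c) * t) by (unfold t; field; lra).
    destruct (Hp y Hy) as [_ [_ [Hy1 _]]].
    destruct (Hp c ltac:(lra)) as [_ [_ [Hc1 _]]].
    destruct (Hp d ltac:(lra)) as [_ [_ [Hd1 _]]].
    apply Rabs_le_between in Hq. apply Rabs_le_between in Hy1.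
    apply Rabs_le_between in Hc1. apply Rabs_le_between in Hd1.
    unfold q in Hq; unfold F. apply Rabs_le. split; nra. }
  set (s := (F d - F c) / (d - c)) in *.
  assert (Hf : forall y, c < y < d -> is_derive f y (G1 y + s)).
  { intros y Hy. apply (is_derive_ext_loc (fun z => G z + (F c + s * (z - c)))).
    - apply (locally_interval _ y c d); [apply Hy|apply Hy|].
      intros z Hz1 Hz2. simpl in Hz1, Hz2.
      change (G z + (F c + s * (z - c)) = f z). rewrite <- Hlin by lra. unfold F; ring.
    - apply @is_derive_plus; [apply HG; lra|].
      unfold Rminus; auto_derive; trivial; ring. }
  split.
  - apply Derive_correct. exists (G1 x + s). apply Hf; lra.
  - apply (is_derive_ext_loc (fun z => G1 z + s)).
    + apply (locally_interval _ x c d); [assumption|assumption|].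
      intros z Hz1 Hz2. symmetry. apply is_derive_unique, Hf. now split.
    + evar_last.
      * apply @is_derive_plus; [apply HG1; lra|apply @is_derive_const].
      * apply Rplus_0_r.
Qed.

(** * Completeness of the sines *)

(* [ring] and [field] reject equations whose type is a Coquelicot structure over [R]. *)
Ltac Rring :=
  match goal with |- ?a = ?b => change (@eq R a b) end; ring.

Ltac Rfield :=
  match goal with |- ?a = ?b => change (@eq R a b) end; field.

Lemma ex_RInt_continuous_le (f : R -> R) (a b : R) :
  a <= b -> (forall x, a <= x <= b -> continuous f x) -> ex_RInt f a b.
Proof.
  intros Hab Hf. apply (ex_RInt_continuous (V := R_CompleteNormedModule)).
  intros z Hz. rewrite Rmin_left, Rmax_right in Hz by lra. auto.
Qed.

Lemma RInt_Rplus (f g : R -> R) (a b : R) :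
  ex_RInt f a b -> ex_RInt g a b ->
  RInt (fun x => f x + g x) a b = RInt f a b + RInt g a b.
Proof. intros; now apply (RInt_plus (V := R_CompleteNormedModule)). Qed.

Lemma RInt_Rminus (f g : R -> R) (a b : R) :
  ex_RInt f a b -> ex_RInt g a b ->
  RInt (fun x => f x - g x) a b = RInt f a b - RInt g a b.
Proof. intros; now apply (RInt_minus (V := R_CompleteNormedModule)). Qed.

Lemma RInt_Rscal (f : R -> R) (a b l : R) :
  ex_RInt f a b -> RInt (fun x => l * f x) a b = l * RInt f a b.
Proof. intros; now apply (RInt_scal (V := R_CompleteNormedModule)). Qed.

Lemma ex_RInt_Rplus (f g : R -> R) (a b : R) :
  ex_RInt f a b -> ex_RInt g a b -> ex_RInt (fun x => f x + g x) a b.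
Proof. intros; now apply (ex_RInt_plus (V := R_NormedModule)). Qed.

Lemma ex_RInt_Rminus (f g : R -> R) (a b : R) :
  ex_RInt f a b -> ex_RInt g a b -> ex_RInt (fun x => f x - g x) a b.
Proof. intros; now apply (ex_RInt_minus (V := R_NormedModule)). Qed.

Lemma ex_RInt_Rscal (f : R -> R) (a b l : R) :
  ex_RInt f a b -> ex_RInt (fun x => l * f x) a b.
Proof. intros; now apply (ex_RInt_scal (V := R_NormedModule)). Qed.

Lemma RInt_Chasles_R (f : R -> R) (a b c : R) :
  ex_RInt f a b -> ex_RInt f b c ->
  RInt f a b + RInt f b c = RInt f a c.
Proof. intros; now apply (RInt_Chasles (V := R_CompleteNormedModule)). Qed.

Lemma continuous_Rmult (f g : R -> R) (x : R) :
  continuous f x -> continuous g x -> continuous (fun t => f t * g t) x.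
Proof. intros; now apply (continuous_mult (K := R_AbsRing)). Qed.

Lemma continuous_Rplus (f g : R -> R) (x : R) :
  continuous f x -> continuous g x -> continuous (fun t => f t + g t) x.
Proof. intros; now apply (continuous_plus (V := R_NormedModule)). Qed.

Lemma continuous_Rminus (f g : R -> R) (x : R) :
  continuous f x -> continuous g x -> continuous (fun t => f t - g t) x.
Proof. intros; now apply (continuous_minus (V := R_NormedModule)). Qed.

Lemma continuous_sin_scal (w x : R) : continuous (fun t => sin (w * t)) x.
Proof. apply @ex_derive_continuous. auto_derive; trivial. Qed.

Lemma continuous_Rabs_bounded (f : R -> R) (a b : R) :
  a <= b -> (forall x, a <= x <= b -> continuous f x) ->
  exists C, 0 <= C /\ forall x, a <= x <= b -> Rabs (f x) <= C.
Proof.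
  intros Hab Hf.
  destruct (continuity_ab_maj (fun x => Rabs (f x)) a b Hab) as [m [Hm Hm']].
  - intros c Hc. apply (continuity_pt_comp f Rabs).
    + apply continuity_pt_filterlim, Hf, Hc.
    + apply Rcontinuity_abs.
  - exists (Rabs (f m)); split; [apply Rabs_pos|exact Hm].
Qed.

Lemma sin_INR_PI (n : nat) : sin (INR n * PI) = 0.
Proof. apply sin_eq_0_1. exists (Z.of_nat n). now rewrite INR_IZR_INZ. Qed.

(* [1 + (eta - (cos t - c)^2) / 4]: larger than 1 near [acos c], in [0, 1]
   away from it. *)
Definition bump (eta c t : R) : R := 1 + (eta - (cos t - c) ^ 2) / 4.

Lemma continuous_bump_pow (eta c : R) (m : nat) (x : R) :
  continuous (fun t => bump eta c t ^ m) x.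
Proof.
  apply @ex_derive_continuous. apply @ex_derive_pow.
  unfold bump. auto_derive; trivial.
Qed.

(** [bump] is a quadratic polynomial in cos t, and cos t sin(z t) is a combination of sines of
    frequencies z + 1 and z - 1, so the factor keeps the test functions in the span of the sines.
    Frequencies range over Z so that the recursion never leaves the domain; negative ones reduce to
    positive ones by oddness. *)
Lemma sine_moments_bump (g : R -> R) (eta c : R) :
  (forall x, 0 <= x <= PI -> continuous g x) ->
  (forall n : nat, (1 <= n)%nat -> RInt (fun t => g t * sin (INR n * t)) 0 PI = 0) ->
  forall (m : nat) (z : Z),
    RInt (fun t => g t * sin (IZR z * t) * bump eta c t ^ m) 0 PI = 0.
Proof.
  intros Hg Hn m.
  pose proof PI_RGT_0 as HPI.
  assert (Hex : forall m z,
    ex_RInt (fun t => g t * sin (IZR z * t) * bump eta c t ^ m) 0 PI).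
  { intros m' z. apply ex_RInt_continuous_le; [lra|]. intros x Hx.
    apply continuous_Rmult; [apply continuous_Rmult|].
    - now apply Hg.
    - apply continuous_sin_scal.
    - apply continuous_bump_pow. }
  induction m as [|m IH]; intros z.
  - destruct (Z.lt_trichotomy z 0) as [Hz|[->|Hz]].
    + rewrite (RInt_ext _ (fun t => -1 * (g t * sin (INR (Z.to_nat (- z)) * t)))).
      * rewrite RInt_Rscal, Hn; [Rring|lia|].
        apply ex_RInt_continuous_le; [lra|]. intros x Hx.
        apply continuous_Rmult; [now apply Hg|apply continuous_sin_scal].
      * intros t _. rewrite INR_IZR_INZ, Z2Nat.id, opp_IZR by lia.
        replace (- IZR z * t) with (- (IZR z * t)) by ring. rewrite sin_neg.
        Rring.
    + rewrite (RInt_ext _ (fun t => 0 * (g t * sin (INR 1 * t)))).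
      * rewrite RInt_Rscal, Hn; [Rring|lia|].
        apply ex_RInt_continuous_le; [lra|]. intros x Hx.
        apply continuous_Rmult; [now apply Hg|apply continuous_sin_scal].
      * intros t _. rewrite Rmult_0_l, sin_0. Rring.
    + rewrite (RInt_ext _ (fun t => (g t * sin (INR (Z.to_nat z) * t)))).
      * apply Hn; lia.
      * intros t _. rewrite INR_IZR_INZ, Z2Nat.id by lia. Rring.
  - set (J := fun y t => g t * sin (IZR y * t) * bump eta c t ^ m).
    (* One factor [bump] is expanded: cos t sin(z t) averages the frequencies z + 1 and z - 1, and
       cos^2 t sin(z t) is half of frequency z plus a quarter of z + 2 and of z - 2. *)
    rewrite (RInt_ext _ (fun t =>
      (1 + eta / 4 - 1 / 8 - c ^ 2 / 4) * J z t
      + (c / 4 * (J (z + 1)%Z t + J (z - 1)%Z t)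
      + - (1 / 16) * (J (z + 2)%Z t + J (z - 2)%Z t)))).
    + assert (HJ : forall y, ex_RInt (J y) 0 PI) by (intros; apply Hex).
      assert (HJ0 : forall y, RInt (J y) 0 PI = 0) by (intros; apply IH).
      rewrite RInt_Rplus, RInt_Rscal, RInt_Rplus, !RInt_Rscal, !RInt_Rplus, !HJ0;
        auto using ex_RInt_Rplus, ex_RInt_Rscal.
      Rring.
    + intros t _. unfold J. rewrite !plus_IZR, !minus_IZR.
      rewrite !Rmult_plus_distr_r, !Rmult_minus_distr_r.
      rewrite !sin_plus, !sin_minus, Rmult_1_l, sin_2a, cos_2a_cos.
      simpl (bump eta c t ^ S m). unfold bump at 1.
      Rfield.
Qed.

(** Concentration argument: if [g x0 > 0], the integral of g(t) sin t against a high power of [bump]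
    is zero by the moments, yet its part near [x0] grows geometrically with the power while the rest
    stays bounded below. *)
Lemma sine_complete_pos (g : R -> R) :
  (forall x, 0 <= x <= PI -> continuous g x) ->
  (forall n : nat, (1 <= n)%nat -> RInt (fun t => g t * sin (INR n * t)) 0 PI = 0) ->
  forall x, 0 < x < PI -> g x <= 0.
Proof.
  intros Hg Hn x0 Hx0. apply Rnot_lt_le; intros Hpos.
  pose proof PI_RGT_0 as HPI.
  set (w := fun t => g t * sin t).
  assert (Hw : forall x, 0 <= x <= PI -> continuous w x).
  { intros x Hx. apply continuous_Rmult; [now apply Hg|apply continuous_sin]. }
  assert (Hw0 : 0 < w x0) by (apply Rmult_lt_0_compat; [|apply sin_gt_0]; lra).
  assert (Hloc : exists d, 0 < d /\ 0 < x0 - d /\ x0 + d < PI /\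
            forall t, x0 - d <= t <= x0 + d -> w x0 / 2 <= w t).
  { assert (Hc : locally x0 (fun t => ball (w x0) (w x0 / 2) (w t))).
    { apply (Hw x0 ltac:(lra)). now exists (mkposreal (w x0 / 2) ltac:(lra)). }
    destruct Hc as [d Hd].
    set (d' := Rmin (d / 2) (Rmin (x0 / 2) ((PI - x0) / 2))).
    assert (d' <= d / 2) by apply Rmin_l.
    assert (d' <= Rmin (x0 / 2) ((PI - x0) / 2)) by apply Rmin_r.
    pose proof (Rmin_l (x0 / 2) ((PI - x0) / 2)).
    pose proof (Rmin_r (x0 / 2) ((PI - x0) / 2)).
    pose proof (cond_pos d).
    exists d'. repeat split; try lra.
    - repeat apply Rmin_glb_lt; lra.
    - intros t Ht. specialize (Hd t).
      assert (Hb : ball x0 d t).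
      { apply Rabs_lt_between'. split; lra. }
      specialize (Hd Hb). apply Rabs_lt_between' in Hd. lra. }
  destruct Hloc as [d [Hd [Hd1 [Hd2 Hwd]]]].
  destruct (continuous_Rabs_bounded w 0 PI) as [C [HC HwC]]; [lra|assumption|].
  set (c := cos x0).
  assert (Hcl : cos x0 < cos (x0 - d)) by (apply cos_decreasing_1; lra).
  assert (Hcr : cos (x0 + d) < cos x0) by (apply cos_decreasing_1; lra).
  fold c in Hcl, Hcr.
  (* Since cos is monotone on [0, pi], leaving the interval around [x0] forces (cos t - c)^2 >= eta,
     hence [bump] at most 1 there. *)
  set (eta := Rmin ((cos (x0 - d) - c) ^ 2) ((c - cos (x0 + d)) ^ 2)).
  assert (Heta : 0 < eta) by (apply Rmin_glb_lt; apply pow_lt; lra).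
  assert (Hel : eta <= (cos (x0 - d) - c) ^ 2) by apply Rmin_l.
  assert (Her : eta <= (c - cos (x0 + d)) ^ 2) by apply Rmin_r.
  clearbody eta.
  set (K := bump eta c).
  assert (HK0 : forall t, 0 <= K t).
  { intros t. unfold K, bump. pose proof (COS_bound t). pose proof (COS_bound x0) as Hcb.
    fold c in Hcb. assert ((cos t - c) ^ 2 <= 4) by nra. lra. }
  assert (Hout : forall t, 0 <= t <= PI -> ~ (x0 - d <= t <= x0 + d) -> K t <= 1).
  { intros t Ht Hnt. unfold K, bump.
    destruct (Rlt_or_le t (x0 - d)).
    - assert (cos (x0 - d) < cos t) by (apply cos_decreasing_1; lra). nra.
    - assert (cos t < cos (x0 + d)) by (apply cos_decreasing_1; lra). nra. }
  (* On this smaller interval |cos t - c| <= e, and e <= 1 gives e^2 <= eta / 2, so [bump] is at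
     least 1 + eta / 8. *)
  set (e := Rmin d (Rmin 1 (eta / 2))).
  assert (e <= d) by apply Rmin_l.
  assert (e <= Rmin 1 (eta / 2)) by apply Rmin_r.
  pose proof (Rmin_l 1 (eta / 2)). pose proof (Rmin_r 1 (eta / 2)).
  assert (He : 0 < e) by (repeat apply Rmin_glb_lt; lra).
  clearbody e.
  assert (Hin : forall t, x0 - e <= t <= x0 + e -> 1 + eta / 8 <= K t).
  { intros t Ht. unfold K, bump.
    assert (Rabs (cos t - c) <= e).
    { destruct (MVT_gen cos x0 t (fun y => - sin y)) as [y [_ Ey]].
      - intros y _. apply is_derive_Reals, derivable_pt_lim_cos.
      - intros y _. apply continuity_cos.
      - unfold c; rewrite Ey, Rabs_mult, Rabs_Ropp.
        assert (Rabs (sin y) <= 1) by (apply Rabs_le, SIN_bound).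
        assert (Rabs (t - x0) <= e) by (apply Rabs_le; lra).
        pose proof (Rabs_pos (sin y)). pose proof (Rabs_pos (t - x0)). nra. }
    assert ((cos t - c) ^ 2 <= eta / 2).
    { rewrite <- pow2_abs. pose proof (Rabs_pos (cos t - c)). nra. }
    lra. }
  assert (Hlow : forall (m : nat) t, 0 <= t <= PI -> - C <= w t * K t ^ m).
  { intros m t Ht. specialize (HwC t Ht). apply Rabs_le_between in HwC.
    pose proof (pow_le (K t) m (HK0 t)) as HKm.
    destruct (Rlt_or_le t (x0 - d)) as [Ho|Ho];
      [|destruct (Rlt_or_le (x0 + d) t) as [Ho'|Ho']].
    - assert (K t ^ m <= 1) by (rewrite <- (pow1 m); apply pow_incr; split;
        [apply HK0|apply Hout; lra]). nra.
    - assert (K t ^ m <= 1) by (rewrite <- (pow1 m); apply pow_incr; split;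
        [apply HK0|apply Hout; lra]). nra.
    - specialize (Hwd t ltac:(lra)). nra. }
  assert (Hineq : forall m : nat,
            2 * e * (w x0 / 2 * (1 + eta / 8) ^ m) <= C * PI).
  { intros m.
    assert (Hex : forall a b, 0 <= a -> a <= b -> b <= PI ->
              ex_RInt (fun t => w t * K t ^ m) a b).
    { intros a b Ha Hab Hb. apply ex_RInt_continuous_le; [lra|]. intros x Hx.
      apply continuous_Rmult; [apply Hw; lra|apply continuous_bump_pow]. }
    assert (HI : RInt (fun t => w t * K t ^ m) 0 PI = 0).
    { etransitivity; [|apply (sine_moments_bump g eta c Hg Hn m 1)]. apply RInt_ext.
      intros t _. unfold w, K. now rewrite Rmult_1_l. }
    rewrite <- (RInt_Chasles_R _ 0 (x0 - e) PI),
      <- (RInt_Chasles_R _ (x0 - e) (x0 + e) PI) in HI by (apply Hex; lra).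
    assert (Hc : forall a b v, RInt (fun _ : R => v) a b = (b - a) * v).
    { intros a b v. exact (RInt_const a b v). }
    assert (I1 : RInt (fun _ => - C) 0 (x0 - e) <=
                 RInt (fun t => w t * K t ^ m) 0 (x0 - e)).
    { apply RInt_le; [lra|apply ex_RInt_const|apply Hex; lra|].
      intros; apply Hlow; lra. }
    assert (I3 : RInt (fun _ => - C) (x0 + e) PI <=
                 RInt (fun t => w t * K t ^ m) (x0 + e) PI).
    { apply RInt_le; [lra|apply ex_RInt_const|apply Hex; lra|].
      intros; apply Hlow; lra. }
    assert (I2 : RInt (fun _ => w x0 / 2 * (1 + eta / 8) ^ m) (x0 - e) (x0 + e) <=
                 RInt (fun t => w t * K t ^ m) (x0 - e) (x0 + e)).
    { apply RInt_le; [lra|apply ex_RInt_const|apply Hex; lra|].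
      intros t Ht. apply Rmult_le_compat; [lra|apply pow_le; lra| |].
      - apply Hwd; lra.
      - apply pow_incr; split; [lra|apply Hin; lra]. }
    rewrite Hc in I1, I2, I3. nra. }
  assert (Hew : 0 < e * w x0) by nra.
  destruct (INR_unbounded (C * PI / (e * w x0) / (eta / 8))) as [m Hm].
  specialize (Hineq m).
  (* Bernoulli's inequality makes the geometric growth exceed the fixed bound [C * PI]. *)
  pose proof (poly m (eta / 8) ltac:(lra)) as Hb.
  assert (C * PI < INR m * (eta / 8) * (e * w x0)).
  { replace (C * PI) with
      (C * PI / (e * w x0) / (eta / 8) * (eta / 8) * (e * w x0)) by (field; nra).
    apply Rmult_lt_compat_r; [lra|]. apply Rmult_lt_compat_r; lra. }
  apply (Rmult_le_compat_l (e * w x0)) in Hb; [|lra]. lra.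
Qed.

Lemma sine_complete (g : R -> R) :
  (forall x, 0 <= x <= PI -> continuous g x) ->
  (forall n : nat, (1 <= n)%nat -> RInt (fun t => g t * sin (INR n * t)) 0 PI = 0) ->
  forall x, 0 < x < PI -> g x = 0.
Proof.
  intros Hg Hn x Hx. apply Rle_antisym.
  - now apply sine_complete_pos.
  - enough (-1 * g x <= 0) by lra.
    apply (sine_complete_pos (fun t => -1 * g t)); trivial.
    + intros y Hy. apply continuous_Rmult; [apply continuous_const|auto].
    + intros n Hn1.
      rewrite (RInt_ext _ (fun t => -1 * (g t * sin (INR n * t)))).
      * rewrite RInt_Rscal, Hn; [Rring|assumption|].
        apply ex_RInt_continuous_le; [pose proof PI_RGT_0; lra|]. intros y Hy.
        apply continuous_Rmult; [now apply Hg|apply continuous_sin_scal].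
      * intros t _. Rring.
Qed.

(** * Functions with exponentially small sine coefficients *)

Lemma pow_le_fact_exp (x : R) (j : nat) :
  0 <= x -> x ^ j <= INR (Factorial.fact j) * exp x.
Proof.
  intros Hx. pose proof (exp_ge_taylor x j Hx) as H.
  assert (Hf : 0 < INR (Factorial.fact j)) by apply INR_fact_lt_0.
  assert (Hj : x ^ j / INR (Factorial.fact j) <= exp x).
  { eapply Rle_trans; [|exact H]. destruct j as [|j].
    - simpl; lra.
    - rewrite tech5.
      assert (0 <= sum_f_R0 (fun k => x ^ k / INR (Factorial.fact k)) j).
      { apply cond_pos_sum. intros n. apply Rdiv_le_0_compat.
        - now apply pow_le.
        - apply INR_fact_lt_0. }
      lra. }
  apply Rmult_le_reg_l with (/ INR (Factorial.fact j)).
  { now apply Rinv_0_lt_compat. }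
  rewrite <- Rmult_assoc, Rinv_l, Rmult_1_l by lra. unfold Rdiv in Hj. lra.
Qed.

(* The [j]-th derivative of [sum_n f n sin (n t)]. *)
Definition sine_series (f : nat -> R) (j : nat) (t : R) : R :=
  Series (fun n => f n * INR n ^ j * sin (INR n * t + INR j * (PI / 2))).

(** The rate is written with a factor 2 so that one half of it absorbs the powers of n produced by
    differentiation and the other half leaves a geometric series of ratio exp(-s). *)
Definition exp_small (f : nat -> R) (C s : R) : Prop :=
  forall n, Rabs (f n) <= C * exp (- 2 * s * INR n).

(** Half of the decay is spent on n^j exp(-s n) <= j! / s^j. The factor j! / s^j is the Cauchy
    estimate that later yields a Taylor radius of [s]. *)
Lemma exp_small_pow (f : nat -> R) (C s : R) (j n : nat) :
  0 < s -> 0 <= C -> exp_small f C s ->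
  Rabs (f n * INR n ^ j) <=
    C * (INR (Factorial.fact j) / s ^ j) * exp (- s) ^ n.
Proof.
  intros Hs HC Hf. rewrite Rabs_mult.
  assert (Hn : 0 <= INR n) by apply pos_INR.
  rewrite (Rabs_pos_eq (INR n ^ j)) by now apply pow_le.
  pose proof (pow_le_fact_exp (s * INR n) j ltac:(nra)) as Hj.
  rewrite Rpow_mult_distr in Hj.
  assert (Hsj : 0 < s ^ j) by now apply pow_lt.
  assert (HE : exp (- s) ^ n = exp (- s * INR n)).
  { rewrite <- Rpower_pow by apply exp_pos. unfold Rpower. rewrite ln_exp.
    f_equal; ring. }
  rewrite HE.
  replace (C * (INR (Factorial.fact j) / s ^ j) * exp (- s * INR n)) with
    ((C * exp (- 2 * s * INR n)) *
     (/ s ^ j * (INR (Factorial.fact j) * exp (s * INR n)))).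
  2: { replace (- s * INR n) with (- 2 * s * INR n + s * INR n) by ring.
       rewrite exp_plus. field; lra. }
  apply Rmult_le_compat.
  - apply Rabs_pos.
  - now apply pow_le.
  - apply Hf.
  - apply Rmult_le_reg_l with (s ^ j); trivial.
    rewrite <- Rmult_assoc, Rinv_r, Rmult_1_l by lra. exact Hj.
Qed.

Lemma exp_neg_lt_1 (s : R) : 0 < s -> 0 < exp (- s) < 1.
Proof.
  intros Hs. split; [apply exp_pos|]. rewrite <- exp_0. apply exp_increasing. lra.
Qed.

(** Allowing any dominated sequence [a] lets one bound serve for the series and its derivatives, for
    the remainder in the differentiation, and for the tail. *)
Lemma exp_small_geometric (f : nat -> R) (C s : R) (j : nat) (a : nat -> R) :
  0 < s -> 0 <= C -> exp_small f C s ->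
  (forall n, Rabs (a n) <= Rabs (f n * INR n ^ j)) ->
  ex_series (fun n => Rabs (a n)) /\
  Series (fun n => Rabs (a n)) <=
    C / (1 - exp (- s)) * (INR (Factorial.fact j) / s ^ j).
Proof.
  intros Hs HC Hf Ha. destruct (exp_neg_lt_1 s Hs) as [Hq0 Hq1].
  assert (Hq : Rabs (exp (- s)) < 1) by (rewrite Rabs_pos_eq; lra).
  set (D := C * (INR (Factorial.fact j) / s ^ j)).
  assert (Hex : ex_series (fun n => D * exp (- s) ^ n)).
  { apply (ex_series_scal_l (K := R_AbsRing) (V := R_NormedModule) D).
    now apply ex_series_geom. }
  assert (Hb : forall n, Rabs (a n) <= D * exp (- s) ^ n).
  { intros n. eapply Rle_trans; [apply Ha|]. now apply exp_small_pow. }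
  split.
  - apply (ex_series_le (K := R_AbsRing) (V := R_CompleteNormedModule) _
             (fun n => D * exp (- s) ^ n)); trivial.
    intros n. change (Rabs (Rabs (a n)) <= D * exp (- s) ^ n).
    now rewrite Rabs_Rabsolu.
  - eapply Rle_trans.
    + apply (Series_le _ (fun n => D * exp (- s) ^ n)); trivial.
      intros n; split; [apply Rabs_pos|apply Hb].
    + rewrite Series_scal_l, Series_geom by assumption.
      unfold D, Rdiv. right. ring.
Qed.

Lemma Rabs_mult_sin_le (a x : R) : Rabs (a * sin x) <= Rabs a.
Proof.
  rewrite Rabs_mult. assert (Rabs (sin x) <= 1) by (apply Rabs_le, SIN_bound).
  pose proof (Rabs_pos a). nra.
Qed.

Lemma sine_series_bound (f : nat -> R) (C s : R) (j : nat) (t : R) :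
  0 < s -> 0 <= C -> exp_small f C s ->
  Rabs (sine_series f j t) <=
    C / (1 - exp (- s)) * (INR (Factorial.fact j) / s ^ j).
Proof.
  intros Hs HC Hf. unfold sine_series.
  destruct (exp_small_geometric f C s j
    (fun n => f n * INR n ^ j * sin (INR n * t + INR j * (PI / 2)))) as [H1 H2];
    trivial.
  - intros n. apply Rabs_mult_sin_le.
  - eapply Rle_trans; [|exact H2]. now apply Series_Rabs.
Qed.

Lemma ex_sine_series (f : nat -> R) (C s : R) (j : nat) (t : R) :
  0 < s -> 0 <= C -> exp_small f C s ->
  ex_series (fun n => f n * INR n ^ j * sin (INR n * t + INR j * (PI / 2))).
Proof.
  intros Hs HC Hf. apply ex_series_Rabs.
  apply (exp_small_geometric f C s j); trivial.
  intros n. apply Rabs_mult_sin_le.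
Qed.

Lemma sin_taylor2 (a x : R) :
  Rabs (sin (a + x) - sin a - x * sin (a + PI / 2)) <= x ^ 2.
Proof.
  replace (sin (a + PI / 2)) with (cos a) by (rewrite Rplus_comm; apply cos_sin).
  destruct (MVT_gen sin a (a + x) cos) as [y [Hy Ey]].
  - intros y _. apply is_derive_Reals, derivable_pt_lim_sin.
  - intros y _. apply continuity_sin.
  - rewrite Ey. replace (a + x - a) with x by ring.
    replace (cos y * x - x * cos a) with (x * (cos y - cos a)) by ring.
    assert (Hya : Rabs (y - a) <= Rabs x).
    { apply Rabs_le_between'. revert Hy. unfold Rmin, Rmax, Rabs.
      destruct (Rle_dec a (a + x)); destruct (Rcase_abs x); lra. }
    destruct (MVT_gen cos a y (fun y => - sin y)) as [z [_ Ez]].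
    + intros z _. apply is_derive_Reals, derivable_pt_lim_cos.
    + intros z _. apply continuity_cos.
    + rewrite Ez, !Rabs_mult, Rabs_Ropp, <- pow2_abs.
      assert (Rabs (sin z) <= 1) by (apply Rabs_le, SIN_bound).
      pose proof (Rabs_pos (sin z)). pose proof (Rabs_pos (y - a)).
      pose proof (Rabs_pos x).
      replace (Rabs x ^ 2) with (Rabs x * Rabs x) by ring.
      apply Rmult_le_compat_l; [lra|nra].
Qed.

(** Termwise differentiation: each term has a remainder quadratic in the increment at the price of
    two more powers of n, and these remainders are summable. Differentiating a sine advances its
    phase by pi / 2. *)
Lemma is_derive_sine_series (f : nat -> R) (C s : R) (j : nat) (t : R) :
  0 < s -> 0 <= C -> exp_small f C s ->
  is_derive (sine_series f j) t (sine_series f (S j) t).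
Proof.
  intros Hs HC Hf.
  set (B := C / (1 - exp (- s)) * (INR (Factorial.fact (S (S j))) / s ^ (S (S j)))).
  assert (Hquad : forall x, Rabs (sine_series f j (t + x) - sine_series f j t
                     - x * sine_series f (S j) t) <= x ^ 2 * B).
  { intros x. unfold sine_series.
    pose proof (ex_sine_series f C s j (t + x) Hs HC Hf) as E1.
    pose proof (ex_sine_series f C s j t Hs HC Hf) as E2.
    pose proof (ex_series_scal_l (K := R_AbsRing) (V := R_NormedModule) x _
      (ex_sine_series f C s (S j) t Hs HC Hf)) as E3.
    pose proof (ex_series_minus (V := R_NormedModule) _ _ E1 E2) as E4.
    rewrite <- Series_scal_l, <- !Series_minus.
    2, 3, 4, 5: assumption.
    set (a := fun n => f n * INR n ^ j * sin (INR n * (t + x) + INR j * (PI / 2)) -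
         f n * INR n ^ j * sin (INR n * t + INR j * (PI / 2)) -
         x * (f n * INR n ^ S j * sin (INR n * t + INR (S j) * (PI / 2)))).
    assert (Ha : forall n, Rabs (a n) <= Rabs (x ^ 2 * f n * INR n ^ S (S j))).
    { intros n. unfold a.
      pose proof (sin_taylor2 (INR n * t + INR j * (PI / 2)) (INR n * x)) as Hs2.
      set (u := INR n * t + INR j * (PI / 2)) in *.
      replace (INR n * (t + x) + INR j * (PI / 2)) with (u + INR n * x)
        by (unfold u; ring).
      replace (INR n * t + INR (S j) * (PI / 2)) with (u + PI / 2)
        by (unfold u; rewrite S_INR; ring).
      replace (f n * INR n ^ j * sin (u + INR n * x) - f n * INR n ^ j * sin u -
        x * (f n * INR n ^ S j * sin (u + PI / 2))) with
        (f n * INR n ^ j *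
         (sin (u + INR n * x) - sin u - INR n * x * sin (u + PI / 2)))
        by (simpl; ring).
      replace (x ^ 2 * f n * INR n ^ S (S j)) with
        (f n * INR n ^ j * (INR n * x) ^ 2) by (simpl; ring).
      rewrite (Rabs_mult _ ((INR n * x) ^ 2)), (Rabs_mult (f n * INR n ^ j)).
      rewrite (Rabs_pos_eq ((INR n * x) ^ 2)) by apply pow2_ge_0.
      apply Rmult_le_compat_l; [apply Rabs_pos|exact Hs2]. }
    destruct (exp_small_geometric (fun n => x ^ 2 * f n) (x ^ 2 * C) s (S (S j)) a)
      as [H1 H2]; trivial.
    - apply Rmult_le_pos; [apply pow2_ge_0|assumption].
    - intros n. rewrite Rabs_mult, (Rabs_pos_eq (x ^ 2)), Rmult_assoc
        by apply pow2_ge_0.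
      apply Rmult_le_compat_l; [apply pow2_ge_0|apply Hf].
    - eapply Rle_trans; [apply Series_Rabs, H1|].
      eapply Rle_trans; [exact H2|]. unfold B. right.
      unfold Rdiv; ring. }
  assert (HB : 0 <= B).
  { specialize (Hquad 1). eapply Rle_trans in Hquad; [|apply Rabs_pos]. lra. }
  apply is_derive_Reals. intros eps Heps.
  assert (Hd : 0 < eps / (B + 1)) by (apply Rdiv_lt_0_compat; lra).
  exists (mkposreal _ Hd). intros h Hh Hhd. simpl in Hhd.
  replace ((sine_series f j (t + h) - sine_series f j t) / h -
    sine_series f (S j) t) with ((sine_series f j (t + h) - sine_series f j t -
    h * sine_series f (S j) t) / h) by (field; trivial).
  unfold Rdiv. rewrite Rabs_mult, Rabs_inv.
  assert (Hh0 : 0 < Rabs h) by now apply Rabs_pos_lt.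
  apply Rmult_lt_reg_r with (Rabs h); trivial.
  rewrite Rmult_assoc, Rinv_l, Rmult_1_r by lra.
  eapply Rle_lt_trans; [apply Hquad|]. rewrite <- pow2_abs.
  assert (Rabs h * (B + 1) < eps).
  { apply Rmult_lt_compat_r with (r := B + 1) in Hhd; [|lra].
    unfold Rdiv in Hhd. rewrite Rmult_assoc, Rinv_l, Rmult_1_r in Hhd; lra. }
  nra.
Qed.

Lemma Derive_n_sine_series (f : nat -> R) (C s : R) (j : nat) :
  0 < s -> 0 <= C -> exp_small f C s ->
  forall t, Derive_n (sine_series f 0) j t = sine_series f j t.
Proof.
  intros Hs HC Hf. induction j as [|j IH]; intros t; [reflexivity|].
  simpl. rewrite (Derive_ext _ _ t IH).
  apply is_derive_unique. now apply (is_derive_sine_series f C s).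
Qed.

Lemma sine_series_zero_derivs (f : nat -> R) (C s a b : R) (j : nat) :
  0 < s -> 0 <= C -> exp_small f C s ->
  (forall t, a < t < b -> sine_series f 0 t = 0) ->
  forall t, a < t < b -> sine_series f j t = 0.
Proof.
  intros Hs HC Hf H0. induction j as [|j IH]; trivial. intros t Ht.
  rewrite <- (is_derive_unique _ _ _ (is_derive_sine_series f C s j t Hs HC Hf)).
  rewrite (Derive_ext_loc _ (fun _ => 0)).
  - apply Derive_const.
  - apply (locally_interval _ t a b); [apply Ht|apply Ht|].
    intros y Hy1 Hy2. apply IH. now split.
Qed.

(** At a point [x] of the zero interval all derivatives vanish, so the series at [t] equals its
    Lagrange remainder, which is at most a constant times ((t - x) / s)^(n + 1) for every n. *)
Lemma sine_series_zero_step (f : nat -> R) (C s a b t : R) :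
  0 < s -> 0 <= C -> exp_small f C s -> a < b ->
  (forall t, a < t < b -> sine_series f 0 t = 0) ->
  a < t < b + s / 2 -> sine_series f 0 t = 0.
Proof.
  intros Hs HC Hf Hab H0 Ht.
  destruct (Rlt_or_le t b) as [Htb|Htb]; [apply H0; lra|].
  (* This point is inside the interval and within s / 4 of its right end, so t - x < 3 s / 4 stays
     inside the Taylor radius. *)
  set (x := Rmax ((a + b) / 2) (b - s / 4)).
  assert (Hx1 : (a + b) / 2 <= x) by apply Rmax_l.
  assert (Hx2 : b - s / 4 <= x) by apply Rmax_r.
  assert (Hx3 : x < b) by (apply Rmax_lub_lt; lra). clearbody x.
  set (B := C / (1 - exp (- s))).
  assert (HT : forall n : nat,
    Rabs (sine_series f 0 t) <= B * ((t - x) / s) ^ S n).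
  { intros n. destruct (Taylor_Lagrange (sine_series f 0) n x t) as [z [Hz E]].
    - lra.
    - intros y Hy [|k] Hk; [exact I|]. simpl.
      apply (ex_derive_ext (sine_series f k)).
      + intros y'. symmetry. now apply (Derive_n_sine_series f C s).
      + eexists. now apply (is_derive_sine_series f C s).
    - rewrite E. rewrite (sum_eq _ (fun _ => 0)).
      + rewrite sum_cte, Rmult_0_l, Rplus_0_l, (Derive_n_sine_series f C s)
          by trivial.
        pose proof (sine_series_bound f C s (S n) z Hs HC Hf) as Hb. fold B in Hb.
        rewrite Rabs_mult. rewrite (Rabs_pos_eq (_ / _)).
        2: { apply Rdiv_le_0_compat; [apply pow_le; lra|apply INR_fact_lt_0]. }
        eapply Rle_trans.
        * apply Rmult_le_compat_l; [|exact Hb].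
          apply Rdiv_le_0_compat; [apply pow_le; lra|apply INR_fact_lt_0].
        * right. unfold Rdiv. rewrite Rpow_mult_distr, pow_inv. field.
          split; [|apply INR_fact_neq_0]. apply pow_nonzero; lra.
      + intros i _. rewrite (Derive_n_sine_series f C s) by trivial.
        rewrite (sine_series_zero_derivs f C s a b) by (trivial; lra). ring. }
  assert (Hq : 0 <= (t - x) / s < 1).
  { split; [apply Rdiv_le_0_compat; lra|].
    apply Rmult_lt_reg_r with s; trivial.
    replace ((t - x) / s * s) with (t - x) by (field; lra). lra. }
  assert (HB : 0 <= B).
  { destruct (exp_neg_lt_1 s Hs). apply Rdiv_le_0_compat; lra. }
  destruct (Req_dec (sine_series f 0 t) 0) as [|Hne]; trivial. exfalso.
  apply Rabs_pos_lt in Hne.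
  destruct (pow_lt_1_zero ((t - x) / s)) with
    (y := Rabs (sine_series f 0 t) / (B + 1)) as [N HN].
  - rewrite Rabs_pos_eq; lra.
  - apply Rdiv_lt_0_compat; lra.
  - specialize (HN (S N) ltac:(lia)). specialize (HT N).
    rewrite Rabs_pos_eq in HN by (apply pow_le; lra).
    assert (Hpn : 0 <= ((t - x) / s) ^ S N) by (apply pow_le; lra).
    apply Rmult_lt_compat_r with (r := B + 1) in HN; [|lra].
    unfold Rdiv in HN at 2. rewrite Rmult_assoc, Rinv_l, Rmult_1_r in HN by lra.
    nra.
Qed.

(** The zero set grows to the right by s / 2 at each step; points to the left are reached by 2 pi
    periodicity. *)
Lemma sine_series_identity (f : nat -> R) (C s a b : R) :
  0 < s -> 0 <= C -> exp_small f C s -> a < b ->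
  (forall t, a < t < b -> sine_series f 0 t = 0) ->
  forall t, sine_series f 0 t = 0.
Proof.
  intros Hs HC Hf Hab H0.
  assert (Hn : forall (n : nat) t, a < t < b + INR n * (s / 2) ->
            sine_series f 0 t = 0).
  { induction n as [|n IH]; intros t Ht.
    - apply H0. simpl in Ht; lra.
    - rewrite S_INR in Ht.
      apply (sine_series_zero_step f C s a (b + INR n * (s / 2))); trivial.
      + pose proof (pos_INR n). nra.
      + lra. }
  assert (Hr : forall t, a < t -> sine_series f 0 t = 0).
  { intros t Ht. destruct (INR_unbounded ((t - b) / (s / 2))) as [n Hnn].
    apply (Hn n). split; trivial.
    assert ((t - b) / (s / 2) * (s / 2) = t - b) by (field; lra). nra. }
  assert (Hper : forall t (n : nat),
            sine_series f 0 t = sine_series f 0 (t + 2 * INR n * PI)).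
  { intros t n. apply Series_ext. intros m. f_equal.
    rewrite <- (sin_period (INR m * t + INR 0 * (PI / 2)) (m * n)).
    f_equal. rewrite mult_INR. ring. }
  intros t. destruct (INR_unbounded ((a - t) / (2 * PI))) as [n Hnn].
  rewrite (Hper t n). apply Hr. pose proof PI_RGT_0.
  assert ((a - t) / (2 * PI) * (2 * PI) = a - t) by (field; lra). nra.
Qed.

Lemma sine_orthogonal (n m : nat) :
  (1 <= n)%nat -> (1 <= m)%nat ->
  is_RInt (fun t => sin (INR n * t) * sin (INR m * t)) 0 PI
    (if Nat.eq_dec n m then PI / 2 else 0).
Proof.
  intros Hn Hm.
  assert (0 < INR n) by (apply lt_0_INR; lia).
  assert (0 < INR m) by (apply lt_0_INR; lia).
  destruct (Nat.eq_dec n m) as [<-|Hne].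
  - evar_last.
    + apply (is_RInt_derive
        (fun t => t / 2 - sin (2 * (INR n * t)) / (4 * INR n))).
      * intros x _. auto_derive; trivial.
        rewrite cos_2a_sin. field. lra.
      * intros x _. apply continuous_Rmult; apply continuous_sin_scal.
    + unfold minus, plus, opp; simpl.
      replace (2 * (INR n * PI)) with (INR (2 * n) * PI)
        by (rewrite mult_INR; simpl; ring).
      rewrite sin_INR_PI, !Rmult_0_r, sin_0. field; lra.
  - assert (Hd : INR n - INR m <> 0).
    { intros H1. apply Hne, INR_eq. lra. }
    evar_last.
    + apply (is_RInt_derive
        (fun t => sin ((INR n - INR m) * t) / (2 * (INR n - INR m))
                - sin ((INR n + INR m) * t) / (2 * (INR n + INR m)))).
      * intros x _. auto_derive; trivial.
        replace ((INR n - INR m) * x) with (INR n * x - INR m * x) by ring.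
        replace ((INR n + INR m) * x) with (INR n * x + INR m * x) by ring.
        rewrite cos_plus, cos_minus.
        field. lra.
      * intros x _. apply continuous_Rmult; apply continuous_sin_scal.
    + unfold minus, plus, opp; simpl.
      assert (H1 : sin ((INR n - INR m) * PI) = 0).
      { apply sin_eq_0_1. exists (Z.of_nat n - Z.of_nat m)%Z.
        now rewrite minus_IZR, !INR_IZR_INZ. }
      assert (H2 : sin ((INR n + INR m) * PI) = 0).
      { rewrite <- plus_INR. apply sin_INR_PI. }
      rewrite H1, H2, !Rmult_0_r, sin_0. field; lra.
Qed.

Lemma sine_series_tail (f : nat -> R) (C s : R) (N : nat) (t : R) :
  0 < s -> 0 <= C -> exp_small f C s ->
  Rabs (sine_series f 0 t - sum_f_R0 (fun n => f n * sin (INR n * t)) N) <=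
    C / (1 - exp (- s)) * exp (- s) ^ N.
Proof.
  intros Hs HC Hf. destruct (exp_neg_lt_1 s Hs) as [Hq0 Hq1].
  unfold sine_series.
  rewrite (Series_incr_n _ (S N)); [|lia|now apply (ex_sine_series f C s)].
  simpl pred.
  rewrite (sum_eq _ (fun n => f n * sin (INR n * t))).
  2: { intros i _. simpl. rewrite Rmult_0_l, Rplus_0_r. ring. }
  match goal with |- Rabs (?a + ?b - ?a) <= _ =>
    replace (a + b - a) with b by ring end.
  (* The shifted coefficients are again exponentially small with the same rate, and their constant
     carries the factor exp(-s)^N. *)
  destruct (exp_small_geometric (fun k => f (S N + k)%nat)
    (C * exp (- s) ^ N) s 0
    (fun k => f (S N + k)%nat * INR (S N + k) ^ 0 *
              sin (INR (S N + k) * t + INR 0 * (PI / 2)))) as [H1 H2].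
  - assumption.
  - apply Rmult_le_pos; trivial. apply pow_le; lra.
  - intros k. eapply Rle_trans; [apply Hf|].
    rewrite (Rmult_assoc C). apply Rmult_le_compat_l; trivial.
    rewrite <- Rpower_pow by apply exp_pos. unfold Rpower.
    rewrite ln_exp, <- exp_plus.
    rewrite plus_INR, S_INR. pose proof (pos_INR N). pose proof (pos_INR k).
    destruct (Rle_lt_or_eq_dec (- 2 * s * (INR N + 1 + INR k))
      (INR N * - s + - 2 * s * INR k)) as [Hlt|Heq].
    + nra.
    + left; now apply exp_increasing.
    + now rewrite Heq; right.
  - intros k. simpl (_ ^ 0). rewrite Rmult_1_r. apply Rabs_mult_sin_le.
  - eapply Rle_trans; [apply Series_Rabs, H1|].
    eapply Rle_trans; [exact H2|]. right. simpl. field. lra.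
Qed.

Lemma is_RInt_sine_polynomial (f : nat -> R) (m N : nat) :
  f O = 0 -> (1 <= m)%nat ->
  is_RInt (fun t => sum_f_R0 (fun n => f n * sin (INR n * t)) N * sin (INR m * t))
    0 PI (if le_dec m N then f m * (PI / 2) else 0).
Proof.
  intros Hf0 Hm. induction N as [|N IH].
  - destruct (le_dec m 0); [lia|].
    apply (is_RInt_ext (fun _ => 0)).
    + intros x _. simpl. rewrite Hf0. Rring.
    + evar_last; [apply @is_RInt_const|]. apply Rmult_0_r.
  - apply (is_RInt_ext (fun t =>
      plus (sum_f_R0 (fun n => f n * sin (INR n * t)) N * sin (INR m * t))
           (scal (f (S N)) (sin (INR (S N) * t) * sin (INR m * t))))).
    + intros x _. rewrite tech5.
      change (sum_f_R0 (fun n => f n * sin (INR n * x)) N * sin (INR m * x) +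
        f (S N) * (sin (INR (S N) * x) * sin (INR m * x)) =
        (sum_f_R0 (fun n => f n * sin (INR n * x)) N +
         f (S N) * sin (INR (S N) * x)) * sin (INR m * x)). ring.
    + evar_last.
      * apply @is_RInt_plus; [exact IH|].
        apply @is_RInt_scal. apply (sine_orthogonal (S N) m); lia.
      * match goal with |- plus ?a (scal ?b ?c) = ?d =>
          change (a + b * c = d) end.
        destruct (le_dec m N); destruct (le_dec m (S N)); try lia;
          destruct (Nat.eq_dec (S N) m) as [<-|]; try lia; Rring.
Qed.

Lemma continuous_sine_series (f : nat -> R) (C s : R) (j : nat) (t : R) :
  0 < s -> 0 <= C -> exp_small f C s -> continuous (sine_series f j) t.
Proof.
  intros Hs HC Hf. apply @ex_derive_continuous.
  eexists. now apply (is_derive_sine_series f C s).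
Qed.

(** Orthogonality is applied to partial sums only; their uniform distance from the series is
    geometric in N and can be integrated. *)
Lemma RInt_sine_series (f : nat -> R) (C s : R) (m : nat) :
  0 < s -> 0 <= C -> exp_small f C s -> f O = 0 -> (1 <= m)%nat ->
  RInt (fun t => sine_series f 0 t * sin (INR m * t)) 0 PI = f m * (PI / 2).
Proof.
  intros Hs HC Hf Hf0 Hm. destruct (exp_neg_lt_1 s Hs) as [Hq0 Hq1].
  pose proof PI_RGT_0 as HPI.
  set (B := C / (1 - exp (- s))).
  assert (HB : 0 <= B) by (apply Rdiv_le_0_compat; lra).
  set (I := RInt (fun t => sine_series f 0 t * sin (INR m * t)) 0 PI).
  assert (HN : forall N, (m <= N)%nat ->
            Rabs (I - f m * (PI / 2)) <= PI * (B * exp (- s) ^ N)).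
  { intros N HmN. pose proof (is_RInt_sine_polynomial f m N Hf0 Hm) as HP.
    destruct (le_dec m N); [|lia].
    assert (Hex1 : ex_RInt (fun t => sine_series f 0 t * sin (INR m * t)) 0 PI).
    { apply ex_RInt_continuous_le; [lra|]. intros x _. apply continuous_Rmult.
      - now apply (continuous_sine_series f C s).
      - apply continuous_sin_scal. }
    rewrite <- (is_RInt_unique _ _ _ _ HP). unfold I.
    rewrite <- RInt_Rminus; [|exact Hex1|eexists; exact HP].
    replace (PI * (B * exp (- s) ^ N)) with ((PI - 0) * (B * exp (- s) ^ N)) by ring.
    apply abs_RInt_le_const; [lra| |].
    - apply ex_RInt_Rminus; [exact Hex1|eexists; exact HP].
    - intros t _. rewrite <- Rmult_minus_distr_r.
      eapply Rle_trans; [apply Rabs_mult_sin_le|].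
      now apply sine_series_tail. }
  destruct (Req_dec (I - f m * (PI / 2)) 0) as [|Hne]; [lra|exfalso].
  apply Rabs_pos_lt in Hne.
  destruct (pow_lt_1_zero (exp (- s))) with
    (y := Rabs (I - f m * (PI / 2)) / (PI * B + 1)) as [N HN'].
  - rewrite Rabs_pos_eq; lra.
  - apply Rdiv_lt_0_compat; nra.
  - specialize (HN (m + N)%nat ltac:(lia)). specialize (HN' (m + N)%nat ltac:(lia)).
    rewrite Rabs_pos_eq in HN' by (apply pow_le; lra).
    assert (Hp : 0 <= exp (- s) ^ (m + N)) by (apply pow_le; lra).
    apply Rmult_lt_compat_r with (r := PI * B + 1) in HN'; [|nra].
    set (X := Rabs (I - f m * (PI / 2))) in *.
    assert (HX : X / (PI * B + 1) * (PI * B + 1) = X) by (field; nra).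
    rewrite HX in HN'. nra.
Qed.

(* Exponentially decaying sine coefficients make [g] real-analytic. *)
Lemma sine_coefficients_identity (g : R -> R) (C s a b : R) :
  0 < s ->
  (forall x, 0 <= x <= PI -> continuous g x) ->
  (forall n, (1 <= n)%nat ->
     Rabs (RInt (fun t => g t * sin (INR n * t)) 0 PI) <= C * exp (- 2 * s * INR n)) ->
  0 <= a -> a < b -> b <= PI -> (forall x, a < x < b -> g x = 0) ->
  forall x, 0 < x < PI -> g x = 0.
Proof.
  intros Hs Hg HC Ha Hab Hb H0.
  pose proof PI_RGT_0 as HPI.
  assert (HC0 : 0 <= C).
  { specialize (HC 1%nat (le_n 1)). pose proof (exp_pos (- 2 * s * INR 1)).
    pose proof (Rabs_pos (RInt (fun t => g t * sin (INR 1 * t)) 0 PI)). nra. }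
  set (f := fun n => match n with O => 0 | _ =>
    2 / PI * RInt (fun t => g t * sin (INR n * t)) 0 PI end).
  assert (HPI2 : 0 < 2 / PI) by (apply Rdiv_lt_0_compat; lra).
  assert (Hf : exp_small f (2 / PI * C) s).
  { intros [|n].
    - unfold f. rewrite Rabs_R0. pose proof (exp_pos (- 2 * s * INR 0)).
      apply Rmult_le_pos; nra.
    - unfold f. rewrite Rabs_mult, (Rabs_pos_eq (2 / PI)), Rmult_assoc by lra.
      apply Rmult_le_compat_l; [lra|]. apply HC; lia. }
  assert (HC1 : 0 <= 2 / PI * C) by nra.
  (* [g] and the series built from its coefficients have the same sine moments, so completeness
     identifies them, and the identity principle for the series applies to [g]. *)
  assert (Heq : forall x, 0 < x < PI -> g x - sine_series f 0 x = 0).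
  { apply sine_complete.
    - intros x Hx. apply continuous_Rminus; [now apply Hg|].
      now apply (continuous_sine_series f (2 / PI * C) s).
    - intros n Hn.
      rewrite (RInt_ext _ (fun t => g t * sin (INR n * t) -
                                    sine_series f 0 t * sin (INR n * t))).
      2: { intros t _. Rring. }
      rewrite RInt_Rminus.
      + rewrite (RInt_sine_series f (2 / PI * C) s) by trivial.
        unfold f. destruct n; [lia|].
        set (J := RInt _ _ _). change (J - 2 / PI * J * (PI / 2) = 0). field. lra.
      + apply ex_RInt_continuous_le; [lra|]. intros x Hx.
        apply continuous_Rmult; [now apply Hg|apply continuous_sin_scal].
      + apply ex_RInt_continuous_le; [lra|]. intros x Hx.
        apply continuous_Rmult; [|apply continuous_sin_scal].
        now apply (continuous_sine_series f (2 / PI * C) s). }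
  intros x Hx. specialize (Heq x Hx) as Hx0.
  rewrite (sine_series_identity f (2 / PI * C) s a b) in Hx0; trivial; [lra|].
  intros t Ht. specialize (Heq t ltac:(lra)). rewrite (H0 t Ht) in Heq. lra.
Qed.

(** * Separation of variables in half annuli *)

Lemma continuity_2d_comp (f g h : R -> R -> R) (x y : R) :
  continuity_2d_pt f (g x y) (h x y) ->
  continuity_2d_pt g x y -> continuity_2d_pt h x y ->
  continuity_2d_pt (fun u v => f (g u v) (h u v)) x y.
Proof.
  intros Hf Hg Hh. apply continuity_2d_pt_filterlim.
  apply continuity_2d_pt_filterlim in Hf. apply continuity_2d_pt_filterlim in Hg.
  apply continuity_2d_pt_filterlim in Hh.
  exact (continuous_comp_2 (fun z : R * R => g (fst z) (snd z))
    (fun z : R * R => h (fst z) (snd z)) f (x, y) Hg Hh Hf).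
Qed.

Lemma continuity_2d_path (f : R -> R -> R) (g h : R -> R) (x : R) :
  continuity_2d_pt f (g x) (h x) -> continuous g x -> continuous h x ->
  continuous (fun t => f (g t) (h t)) x.
Proof.
  intros Hf Hg Hh. apply continuity_2d_pt_filterlim in Hf.
  exact (continuous_comp_2 g h f x Hg Hh Hf).
Qed.

Lemma continuity_2d_snd (f : R -> R) (x y : R) :
  continuous f y -> continuity_2d_pt (fun _ v => f v) x y.
Proof.
  intros Hf. apply (continuity_1d_2d_pt_comp f (fun _ v => v)).
  - now apply continuity_pt_filterlim.
  - apply continuity_2d_pt_id2.
Qed.

Lemma continuity_2d_fst (f : R -> R) (x y : R) :
  continuous f x -> continuity_2d_pt (fun u _ => f u) x y.
Proof.
  intros Hf. apply (continuity_1d_2d_pt_comp f (fun u _ => u)).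
  - now apply continuity_pt_filterlim.
  - apply continuity_2d_pt_id1.
Qed.

Definition open_2d (D : R -> R -> Prop) : Prop :=
  forall x y, D x y -> locally_2d D x y.

Definition C1_at (f f1 f2 : R -> R -> R) (x y : R) : Prop :=
  is_derive (fun t => f t y) x (f1 x y) /\ is_derive (fun t => f x t) y (f2 x y) /\
  continuity_2d_pt f1 x y /\ continuity_2d_pt f2 x y.

Definition helmholtz_at (k : R) (f f1 f2 f11 f12 f21 f22 : R -> R -> R) (x y : R) :=
  C1_at f f1 f2 x y /\ C1_at f1 f11 f12 x y /\ C1_at f2 f21 f22 x y /\
  f11 x y + f22 x y + k ^ 2 * f x y = 0.

(** Real-valued, since real and imaginary parts solve the equation separately. The first derivatives
    are parameters because the radiation condition speaks about them; the second ones matter only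
    through the equation. *)
Definition helmholtz (k : R) (D : R -> R -> Prop) (f f1 f2 : R -> R -> R) : Prop :=
  exists f11 f12 f21 f22, forall x y, D x y ->
    helmholtz_at k f f1 f2 f11 f12 f21 f22 x y.

(** Continuous partial derivatives on an open set give total differentiability, which the chain rule
    in polar coordinates requires. *)
Lemma C1_differentiable (D : R -> R -> Prop) (f f1 f2 : R -> R -> R) (x y : R) :
  open_2d D -> (forall x y, D x y -> C1_at f f1 f2 x y) -> D x y ->
  differentiable_pt_lim f x y (f1 x y) (f2 x y).
Proof.
  intros HD Hf Hxy. apply filterdiff_differentiable_pt_lim.
  apply (is_derive_filterdiff f x y f1 (f2 x y)).
  - assert (Hl : locally (x, y) (fun z => D (fst z) (snd z))).
    { apply locally_2d_locally, HD, Hxy. }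
    revert Hl. apply filter_imp. intros z Hz. apply Hf, Hz.
  - apply Hf, Hxy.
  - apply continuity_2d_pt_filterlim. apply Hf, Hxy.
Qed.

Lemma C1_continuity (D : R -> R -> Prop) (f f1 f2 : R -> R -> R) (x y : R) :
  open_2d D -> (forall x y, D x y -> C1_at f f1 f2 x y) -> D x y ->
  continuity_2d_pt f x y.
Proof.
  intros HD Hf Hxy. apply differentiable_continuity_pt.
  exists (f1 x y), (f2 x y). now apply (C1_differentiable D).
Qed.

Lemma C1_chain (D : R -> R -> Prop) (f f1 f2 : R -> R -> R) (g h : R -> R)
  (t g' h' : R) :
  open_2d D -> (forall x y, D x y -> C1_at f f1 f2 x y) -> D (g t) (h t) ->
  is_derive g t g' -> is_derive h t h' ->
  is_derive (fun s => f (g s) (h s)) t (f1 (g t) (h t) * g' + f2 (g t) (h t) * h').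
Proof.
  intros HD Hf Hxy Hg Hh. apply is_derive_Reals.
  apply derivable_pt_lim_comp_2d.
  - now apply (C1_differentiable D).
  - now apply is_derive_Reals.
  - now apply is_derive_Reals.
Qed.

Definition polar (f : R -> R -> R) (r t : R) : R := f (r * cos t) (r * sin t).

Lemma polar_continuity (f : R -> R -> R) (r t : R) :
  continuity_2d_pt f (r * cos t) (r * sin t) -> continuity_2d_pt (polar f) r t.
Proof.
  intros Hf. apply (continuity_2d_comp f (fun r t => r * cos t) (fun r t => r * sin t));
    trivial; apply continuity_2d_pt_mult; try apply continuity_2d_pt_id1;
    apply continuity_2d_snd.
  - apply continuous_cos.
  - apply continuous_sin.
Qed.

Lemma polar_derive_r (D : R -> R -> Prop) (f f1 f2 : R -> R -> R) (r t : R) :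
  open_2d D -> (forall x y, D x y -> C1_at f f1 f2 x y) ->
  D (r * cos t) (r * sin t) ->
  is_derive (fun s => polar f s t) r (cos t * polar f1 r t + sin t * polar f2 r t).
Proof.
  intros HD Hf Hrt. unfold polar.
  evar_last.
  - apply (C1_chain D f f1 f2 (fun s => s * cos t) (fun s => s * sin t) r (cos t)
      (sin t)); trivial; auto_derive; trivial; ring.
  - simpl. ring.
Qed.

Lemma polar_derive_t (D : R -> R -> Prop) (f f1 f2 : R -> R -> R) (r t : R) :
  open_2d D -> (forall x y, D x y -> C1_at f f1 f2 x y) ->
  D (r * cos t) (r * sin t) ->
  is_derive (fun s => polar f r s) t
    (r * (cos t * polar f2 r t - sin t * polar f1 r t)).
Proof.
  intros HD Hf Hrt. unfold polar.
  evar_last.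
  - apply (C1_chain D f f1 f2 (fun s => r * cos s) (fun s => r * sin s) t
      (- r * sin t) (r * cos t)); trivial; auto_derive; trivial; ring.
  - simpl. ring.
Qed.

Lemma is_derive_RInt_open (F F1 : R -> R -> R) (r1 r2 a0 b0 a b r : R) :
  a0 < a -> a <= b -> b < b0 -> r1 < r < r2 ->
  (forall u v, r1 < u < r2 -> a0 < v < b0 ->
     is_derive (fun z => F z v) u (F1 u v) /\ continuity_2d_pt F1 u v /\
     continuous (F u) v) ->
  is_derive (fun u => RInt (F u) a b) r (RInt (F1 r) a b).
Proof.
  intros Ha Hab Hb Hr HF.
  assert (Hloc : locally r (fun u => r1 < u < r2)).
  { apply (locally_interval _ r r1 r2); [apply Hr|apply Hr|]. now split. }
  evar_last.
  - apply (is_derive_RInt_param F a b r).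
    + revert Hloc. apply filter_imp. intros u Hu t Ht.
      rewrite Rmin_left, Rmax_right in Ht by lra.
      exists (F1 u t). apply HF; lra.
    + rewrite Rmin_left, Rmax_right by lra. intros t Ht.
      apply (continuity_2d_pt_ext_loc F1); [|apply HF; lra].
      set (d := Rmin (Rmin (r - r1) (r2 - r)) (Rmin (t - a0) (b0 - t))).
      assert (Hd : 0 < d) by (repeat apply Rmin_glb_lt; lra).
      exists (mkposreal d Hd). simpl. intros u v Hu Hv.
      pose proof (Rmin_l (Rmin (r - r1) (r2 - r)) (Rmin (t - a0) (b0 - t))).
      pose proof (Rmin_r (Rmin (r - r1) (r2 - r)) (Rmin (t - a0) (b0 - t))).
      pose proof (Rmin_l (r - r1) (r2 - r)). pose proof (Rmin_r (r - r1) (r2 - r)).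
      pose proof (Rmin_l (t - a0) (b0 - t)). pose proof (Rmin_r (t - a0) (b0 - t)).
      fold d in H, H0. apply Rabs_def2 in Hu. apply Rabs_def2 in Hv.
      symmetry. apply is_derive_unique. apply HF; lra.
    + revert Hloc. apply filter_imp. intros u Hu.
      apply ex_RInt_continuous_le; trivial. intros t Ht. apply HF; lra.
  - apply RInt_ext. rewrite Rmin_left, Rmax_right by lra. intros t Ht.
    apply is_derive_unique. apply HF; lra.
Qed.

(* [chi n e] is the [n]-th Dirichlet eigenfunction of the arc [[e, PI - e]]. *)
Definition arc_freq (n : nat) (e : R) : R := INR n * PI / (PI - 2 * e).
Definition chi (n : nat) (e t : R) : R := sin (arc_freq n e * (t - e)).

(** The factor sqrt r removes the first-order term of the polar Laplacian, so that the equation has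
    the form p'' = V p, and it compensates the decay r^(-1/2) of a radiating field. *)
Definition arc (n : nat) (e : R) (f : R -> R -> R) (r : R) : R :=
  sqrt r * RInt (fun t => polar f r t * chi n e t) e (PI - e).

Definition coef (n : nat) (f : R -> R -> R) (r : R) : R :=
  sqrt r * RInt (fun t => polar f r t * sin (INR n * t)) 0 PI.

Definition half_annulus (r1 r2 : R) (x y : R) : Prop :=
  0 < y /\ r1 ^ 2 < x ^ 2 + y ^ 2 < r2 ^ 2.
Definition annulus (r1 r2 : R) (x y : R) : Prop := r1 ^ 2 < x ^ 2 + y ^ 2 < r2 ^ 2.

Lemma open_2d_continuous (P : R -> R -> Prop) (f : R -> R -> R) :
  (forall x y, continuity_2d_pt f x y) -> (forall x y, P x y <-> 0 < f x y) ->
  open_2d P.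
Proof.
  intros Hf HP x y Hxy. apply HP in Hxy.
  destruct (Hf x y (mkposreal _ Hxy)) as [d Hd]. exists d. intros u v Hu Hv.
  specialize (Hd u v Hu Hv). simpl in Hd. apply Rabs_def2 in Hd. apply HP. lra.
Qed.

Lemma open_2d_and (P Q : R -> R -> Prop) :
  open_2d P -> open_2d Q -> open_2d (fun x y => P x y /\ Q x y).
Proof.
  intros HP HQ x y [H1 H2].
  apply locally_2d_and; [now apply HP|now apply HQ].
Qed.

Lemma open_half_annulus (r1 r2 : R) : open_2d (half_annulus r1 r2).
Proof.
  assert (Hc : forall x y, continuity_2d_pt (fun x y => x ^ 2 + y ^ 2) x y).
  { intros x y. apply continuity_2d_pt_plus.
    - apply (continuity_2d_fst (fun x => x ^ 2)).
      apply @ex_derive_continuous; auto_derive; trivial.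
    - apply (continuity_2d_snd (fun x => x ^ 2)).
      apply @ex_derive_continuous; auto_derive; trivial. }
  apply open_2d_and; [|apply open_2d_and].
  - apply (open_2d_continuous _ (fun x y => y)); [|tauto].
    intros; apply continuity_2d_pt_id2.
  - apply (open_2d_continuous _ (fun x y => x ^ 2 + y ^ 2 - r1 ^ 2)).
    + intros x y. apply continuity_2d_pt_minus; [apply Hc|apply continuity_2d_pt_const].
    + intros; lra.
  - apply (open_2d_continuous _ (fun x y => r2 ^ 2 - (x ^ 2 + y ^ 2))).
    + intros x y. apply continuity_2d_pt_minus; [apply continuity_2d_pt_const|apply Hc].
    + intros; lra.
Qed.

Lemma polar_norm (r t : R) : (r * cos t) ^ 2 + (r * sin t) ^ 2 = r ^ 2.
Proof. pose proof (sin2_cos2 t) as H. unfold Rsqr in H. nra. Qed.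

Lemma polar_annulus (r1 r2 r t : R) :
  0 <= r1 -> r1 < r < r2 -> annulus r1 r2 (r * cos t) (r * sin t).
Proof. intros H1 Hr. unfold annulus. rewrite polar_norm. split; nra. Qed.

Lemma polar_half_annulus (r1 r2 r t : R) :
  0 <= r1 -> r1 < r < r2 -> 0 < t < PI ->
  half_annulus r1 r2 (r * cos t) (r * sin t).
Proof.
  intros H1 Hr Ht. split; [|now apply polar_annulus].
  apply Rmult_lt_0_compat; [lra|now apply sin_gt_0].
Qed.

Lemma continuous_chi (n : nat) (e t : R) : continuous (chi n e) t.
Proof. apply @ex_derive_continuous. unfold chi. auto_derive; trivial. Qed.

Definition radial (f1 f2 : R -> R -> R) (r t : R) : R :=
  cos t * polar f1 r t + sin t * polar f2 r t.

(* The two boundary values enter because [f] need not vanish at the ends of the arc. *)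
Lemma arc_ode (k : R) (n : nat) (e r1 r2 : R) (f f1 f2 : R -> R -> R) :
  0 <= r1 -> 0 < e < PI / 2 -> helmholtz k (half_annulus r1 r2) f f1 f2 ->
  let p1 r := arc n e f r / (2 * r) +
              sqrt r * RInt (fun t => radial f1 f2 r t * chi n e t) e (PI - e) in
  forall r, r1 < r < r2 ->
    is_derive (arc n e f) r (p1 r) /\
    is_derive p1 r
      (((arc_freq n e ^ 2 - 1 / 4) / r ^ 2 - k ^ 2) * arc n e f r +
       sqrt r * arc_freq n e / r ^ 2 *
       (polar f r (PI - e) * cos (INR n * PI) - polar f r e)).
Proof.
  intros Hr1 He [f11 [f12 [f21 [f22 Hf]]]] p1 r Hr.
  set (D := half_annulus r1 r2) in *.
  assert (HD : open_2d D) by apply open_half_annulus.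
  assert (Cf : forall x y, D x y -> C1_at f f1 f2 x y) by (intros; now apply Hf).
  assert (Cf1 : forall x y, D x y -> C1_at f1 f11 f12 x y) by (intros; now apply Hf).
  assert (Cf2 : forall x y, D x y -> C1_at f2 f21 f22 x y) by (intros; now apply Hf).
  assert (HDp : forall r t, r1 < r < r2 -> 0 < t < PI -> D (r * cos t) (r * sin t)).
  { intros; now apply polar_half_annulus. }
  assert (Kf : forall r t, r1 < r < r2 -> 0 < t < PI -> continuity_2d_pt (polar f) r t).
  { intros. apply polar_continuity. apply (C1_continuity D f f1 f2); auto. }
  assert (Kf1 : forall r t, r1 < r < r2 -> 0 < t < PI -> continuity_2d_pt (polar f1) r t).
  { intros. apply polar_continuity. apply Cf; auto. }
  assert (Kf2 : forall r t, r1 < r < r2 -> 0 < t < PI -> continuity_2d_pt (polar f2) r t).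
  { intros. apply polar_continuity. apply Cf; auto. }
  (* The second derivative in r at a fixed angle. *)
  set (rr := fun r t => cos t * radial f11 f12 r t + sin t * radial f21 f22 r t).
  assert (Kc : forall r t, continuity_2d_pt (fun _ t => cos t) r t).
  { intros. apply continuity_2d_snd, continuous_cos. }
  assert (Ks : forall r t, continuity_2d_pt (fun _ t => sin t) r t).
  { intros. apply continuity_2d_snd, continuous_sin. }
  assert (Kchi : forall r t, continuity_2d_pt (fun _ t => chi n e t) r t).
  { intros. apply continuity_2d_snd, continuous_chi. }
  assert (Krad : forall r t, r1 < r < r2 -> 0 < t < PI ->
            continuity_2d_pt (radial f1 f2) r t).
  { intros. apply continuity_2d_pt_plus; apply continuity_2d_pt_mult; auto. }
  assert (Krr : forall r t, r1 < r < r2 -> 0 < t < PI -> continuity_2d_pt rr r t).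
  { intros. apply continuity_2d_pt_plus; apply continuity_2d_pt_mult; auto;
      apply continuity_2d_pt_plus; apply continuity_2d_pt_mult; auto;
      apply polar_continuity; first [apply Cf1|apply Cf2]; auto. }
  assert (K1 : forall F r t, continuity_2d_pt F r t -> continuous (F r) t).
  { intros F u t HF. apply (continuity_2d_path F (fun _ => u) (fun t => t)); trivial.
    - apply continuous_const.
    - apply continuous_id. }
  set (I := fun r => RInt (fun t => polar f r t * chi n e t) e (PI - e)).
  set (I1 := fun r => RInt (fun t => radial f1 f2 r t * chi n e t) e (PI - e)).
  set (I2 := RInt (fun t => rr r t * chi n e t) e (PI - e)).
  assert (HI : forall u, r1 < u < r2 -> is_derive I u (I1 u)).
  { intros u Hu. apply (is_derive_RInt_open (fun r t => polar f r t * chi n e t)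
      (fun r t => radial f1 f2 r t * chi n e t) r1 r2 0 PI); try lra.
    intros v t Hv Ht. split; [|split].
    - evar_last.
      + apply (is_derive_Rmult (fun z => polar f z t) (fun _ => chi n e t)).
        * apply (polar_derive_r D); auto.
        * apply @is_derive_const.
      + unfold radial, zero; simpl. ring.
    - apply continuity_2d_pt_mult; auto.
    - apply (K1 (fun r t => polar f r t * chi n e t)).
      apply continuity_2d_pt_mult; auto. }
  assert (HI1 : is_derive I1 r I2).
  { apply (is_derive_RInt_open (fun r t => radial f1 f2 r t * chi n e t)
      (fun r t => rr r t * chi n e t) r1 r2 0 PI); try lra.
    intros v t Hv Ht. split; [|split].
    - evar_last.
      + apply (is_derive_Rmult (fun z => radial f1 f2 z t) (fun _ => chi n e t)).
        * unfold radial. apply @is_derive_plus; apply is_derive_scal;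
            apply (polar_derive_r D); eauto.
        * apply @is_derive_const.
      + unfold rr, radial, zero, plus; simpl. ring.
    - apply continuity_2d_pt_mult; auto.
    - apply (K1 (fun r t => radial f1 f2 r t * chi n e t)).
      apply continuity_2d_pt_mult; auto. }
  assert (Harc : forall u, arc n e f u = sqrt u * I u) by reflexivity.
  assert (Hp : forall u, r1 < u < r2 -> is_derive (arc n e f) u (p1 u)).
  { intros u Hu. evar_last.
    - apply (is_derive_Rmult sqrt I).
      + apply is_derive_Reals, derivable_pt_lim_sqrt. lra.
      + now apply HI.
    - unfold p1. rewrite Harc. fold (I1 u).
      assert (Hs : 0 < sqrt u) by (apply sqrt_lt_R0; lra).
      assert (Hss : sqrt u * sqrt u = u) by (apply sqrt_sqrt; lra).
      replace (2 * u) with (2 * (sqrt u * sqrt u)) by (rewrite Hss; ring).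
      field. lra. }
  split; [now apply Hp|].
  set (lam := arc_freq n e).
  (* The second angular derivative of the field, expressed through radial quantities by the
     Helmholtz equation in polar coordinates. *)
  set (tt := fun t => - r ^ 2 * (rr r t + radial f1 f2 r t / r + k ^ 2 * polar f r t)).
  (* Green's identity on the arc: the integrand is the derivative of u_t chi - u chi_t. [chi]
     vanishes at both ends, so only the end values of the field survive. *)
  assert (Hparts : is_RInt (fun t => tt t * chi n e t + lam ^ 2 * (polar f r t * chi n e t))
            e (PI - e)
            (- lam * (polar f r (PI - e) * cos (INR n * PI) - polar f r e))).
  { evar_last.
    - apply (is_RInt_derive (fun t =>
        r * (cos t * polar f2 r t - sin t * polar f1 r t) * chi n e t -
        polar f r t * (lam * cos (lam * (t - e))))).
      + rewrite Rmin_left, Rmax_right by lra. intros t Ht. evar_last.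
        * apply @is_derive_minus.
          { apply (is_derive_Rmult
              (fun t => r * (cos t * polar f2 r t - sin t * polar f1 r t)) (chi n e)).
            - apply is_derive_scal. apply @is_derive_minus.
              + apply (is_derive_Rmult cos (polar f2 r)).
                * apply is_derive_Reals, derivable_pt_lim_cos.
                * apply (polar_derive_t D f2 f21 f22); auto. apply HDp; lra.
              + apply (is_derive_Rmult sin (polar f1 r)).
                * apply is_derive_Reals, derivable_pt_lim_sin.
                * apply (polar_derive_t D f1 f11 f12); auto. apply HDp; lra.
            - instantiate (1 := lam * cos (lam * (t - e))).
              unfold chi. fold lam. auto_derive; trivial. unfold Rminus; ring. }
          { apply (is_derive_Rmult (polar f r) (fun t => lam * cos (lam * (t - e)))).
            - apply (polar_derive_t D f f1 f2); auto. apply HDp; lra.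
            - instantiate (1 := - lam ^ 2 * sin (lam * (t - e))).
              auto_derive; trivial. unfold Rminus; ring. }
        * unfold minus, plus, opp; simpl.
          assert (Hh := proj2 (proj2 (proj2 (Hf _ _ (HDp r t Hr ltac:(lra)))))).
          fold (polar f11 r t) in Hh. fold (polar f22 r t) in Hh.
          fold (polar f r t) in Hh.
          assert (Hsc : sin t * sin t = 1 - cos t * cos t).
          { pose proof (sin2_cos2 t) as Hq. unfold Rsqr in Hq. lra. }
          unfold tt, rr, radial. unfold chi; fold lam.
          set (X := sin (lam * (t - e))). set (Y := cos (lam * (t - e))).
          (* With [f22] eliminated, the two sides differ only by a multiple of 1 - cos^2 t - sin^2
             t. *)
          replace (polar f22 r t) with (- polar f11 r t - k ^ 2 * polar f r t) by lra.
          match goal with |- ?a = ?b => apply Rminus_diag_uniq;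
            replace (a - b) with
              ((1 - cos t * cos t - sin t * sin t) * (r ^ 2 * k ^ 2 * polar f r t) * X)
          end.
          { rewrite Hsc. ring. }
          { field. lra. }
      + rewrite Rmin_left, Rmax_right by lra. intros t Ht.
        apply continuous_Rplus.
        * apply continuous_Rmult; [|apply continuous_chi].
          unfold tt. apply continuous_Rmult; [apply continuous_const|].
          apply continuous_Rplus; [apply continuous_Rplus|].
          { apply K1, Krr; lra. }
          { apply continuous_Rmult; [|apply continuous_const].
            apply K1, Krad; lra. }
          { apply continuous_Rmult; [apply continuous_const|].
            apply K1, Kf; lra. }
        * apply continuous_Rmult; [apply continuous_const|].
          apply continuous_Rmult; [|apply continuous_chi]. apply K1, Kf; lra.
    - unfold minus, plus, opp; simpl. unfold chi; fold lam.
      assert (Hl : lam * (PI - e - e) = INR n * PI).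
      { unfold lam, arc_freq. field. lra. }
      rewrite Hl, sin_INR_PI, (Rminus_diag e), (Rmult_0_r lam), sin_0, cos_0. ring. }
  apply (is_RInt_unique (V := R_CompleteNormedModule)) in Hparts.
  assert (Xf : ex_RInt (fun t => polar f r t * chi n e t) e (PI - e)).
  { apply ex_RInt_continuous_le; [lra|]. intros t Ht.
    apply continuous_Rmult; [|apply continuous_chi]. apply K1, Kf; lra. }
  assert (Xr : ex_RInt (fun t => radial f1 f2 r t * chi n e t) e (PI - e)).
  { apply ex_RInt_continuous_le; [lra|]. intros t Ht.
    apply continuous_Rmult; [|apply continuous_chi]. apply K1, Krad; lra. }
  assert (Xrr : ex_RInt (fun t => rr r t * chi n e t) e (PI - e)).
  { apply ex_RInt_continuous_le; [lra|]. intros t Ht.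
    apply continuous_Rmult; [|apply continuous_chi]. apply K1, Krr; lra. }
  assert (Hode : - r ^ 2 * (I2 + I1 r / r) + (lam ^ 2 - r ^ 2 * k ^ 2) * I r =
            - lam * (polar f r (PI - e) * cos (INR n * PI) - polar f r e)).
  { rewrite <- Hparts. unfold I2, I1, I.
    transitivity (RInt (fun t => - r ^ 2 * (rr r t * chi n e t) +
       (- r ^ 2 / r * (radial f1 f2 r t * chi n e t) +
       (lam ^ 2 - r ^ 2 * k ^ 2) * (polar f r t * chi n e t))) e (PI - e)).
    - rewrite RInt_Rplus, RInt_Rplus, !RInt_Rscal;
        auto using ex_RInt_Rplus, ex_RInt_Rscal.
      Rfield. lra.
    - apply RInt_ext. intros t _. unfold tt.
      Rfield. lra. }
  assert (Hs : 0 < sqrt r) by (apply sqrt_lt_R0; lra).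
  assert (Hss : sqrt r * sqrt r = r) by (apply sqrt_sqrt; lra).
  unfold p1. evar_last.
  - apply @is_derive_plus.
    + unfold Rdiv. apply (is_derive_Rmult (arc n e f) (fun r => / (2 * r))).
      * now apply Hp.
      * instantiate (1 := - / (2 * r ^ 2)). auto_derive; [lra|]. field. lra.
    + apply (is_derive_Rmult sqrt I1).
      * apply is_derive_Reals, derivable_pt_lim_sqrt. lra.
      * exact HI1.
  - unfold plus; simpl. unfold p1. rewrite !Harc. fold (I1 r).
    set (bd := polar f r (PI - e) * cos (INR n * PI) - polar f r e) in *.
    assert (HI2 : I2 = lam * bd / r ^ 2 - I1 r / r + (lam ^ 2 / r ^ 2 - k ^ 2) * I r).
    { apply Rmult_eq_reg_l with (- r ^ 2); [|nra].
      apply Rplus_eq_reg_r with (- r ^ 2 * (I1 r / r) + (lam ^ 2 - r ^ 2 * k ^ 2) * I r).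
      transitivity (- lam * bd).
      - rewrite <- Hode. ring.
      - field. lra. }
    rewrite HI2. set (s := sqrt r) in *. clearbody s. rewrite <- Hss.
    field. lra.
Qed.

Lemma sin_lipschitz (a b : R) : Rabs (sin a - sin b) <= Rabs (a - b).
Proof.
  destruct (MVT_gen sin b a cos) as [c [_ E]].
  - intros x _. apply is_derive_Reals, derivable_pt_lim_sin.
  - intros x _. apply continuity_sin.
  - rewrite E, Rabs_mult. assert (Rabs (cos c) <= 1) by (apply Rabs_le, COS_bound).
    pose proof (Rabs_pos (a - b)). nra.
Qed.

Lemma arc_freq_bounds (n : nat) (e : R) :
  0 < e <= PI / 4 -> INR n <= arc_freq n e <= INR n + 2 * INR n * e.
Proof.
  intros He. pose proof PI2_1. pose proof (pos_INR n) as Hn.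
  unfold arc_freq.
  assert (Heq : INR n * PI / (PI - 2 * e) = INR n + 2 * INR n * e / (PI - 2 * e))
    by (field; lra).
  rewrite Heq.
  assert (H0 : 0 <= 2 * INR n * e) by nra.
  assert (Hq : 0 <= 2 * INR n * e / (PI - 2 * e)) by (apply Rdiv_le_0_compat; lra).
  split; [lra|]. apply Rplus_le_compat_l.
  apply Rmult_le_reg_r with (PI - 2 * e); [lra|].
  unfold Rdiv. rewrite (Rmult_assoc _ (/ _)), Rinv_l by lra. nra.
Qed.

(** The phases of the two sines agree at pi / 2; elsewhere on the arc they differ by n e times a
    number in [-1, 1]. *)
Lemma chi_close (n : nat) (e t : R) :
  0 < e <= PI / 4 -> e <= t <= PI - e ->
  Rabs (chi n e t - sin (INR n * t)) <= INR n * e.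
Proof.
  intros He Ht. pose proof PI2_1. pose proof (pos_INR n) as Hn.
  eapply Rle_trans; [apply sin_lipschitz|]. unfold arc_freq.
  replace (INR n * PI / (PI - 2 * e) * (t - e) - INR n * t)
    with (INR n * e * ((2 * t - PI) / (PI - 2 * e))) by (field; lra).
  rewrite Rabs_mult, (Rabs_pos_eq (INR n * e)) by nra.
  assert (Rabs ((2 * t - PI) / (PI - 2 * e)) <= 1).
  { apply Rabs_le. assert (Hi : 0 < / (PI - 2 * e)) by (apply Rinv_0_lt_compat; lra).
    assert (E : (PI - 2 * e) * / (PI - 2 * e) = 1) by (apply Rinv_r; lra).
    unfold Rdiv. split; nra. }
  assert (0 <= INR n * e) by nra. nra.
Qed.

Lemma RInt_arc_close (g : R -> R) (n : nat) (M e : R) :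
  (forall t, 0 <= t <= PI -> continuous g t) ->
  (forall t, 0 <= t <= PI -> Rabs (g t) <= M) -> 0 < e <= PI / 4 ->
  Rabs (RInt (fun t => g t * chi n e t) e (PI - e) -
        RInt (fun t => g t * sin (INR n * t)) 0 PI) <= M * (2 + INR n * PI) * e.
Proof.
  intros Hg HM He. pose proof PI2_1. pose proof (pos_INR n) as Hn.
  assert (HM0 : 0 <= M).
  { eapply Rle_trans; [apply Rabs_pos|apply (HM 0); lra]. }
  assert (Xs : forall a b, 0 <= a -> a <= b -> b <= PI ->
            ex_RInt (fun t => g t * sin (INR n * t)) a b).
  { intros a b Ha Hab Hb. apply ex_RInt_continuous_le; trivial. intros t Ht.
    apply continuous_Rmult; [apply Hg; lra|apply continuous_sin_scal]. }
  assert (Xc : ex_RInt (fun t => g t * chi n e t) e (PI - e)).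
  { apply ex_RInt_continuous_le; [lra|]. intros t Ht.
    apply continuous_Rmult; [apply Hg; lra|apply continuous_chi]. }
  rewrite <- (RInt_Chasles_R _ 0 e PI), <- (RInt_Chasles_R _ e (PI - e) PI)
    by (apply Xs; lra).
  assert (Hend : forall a b, 0 <= a -> a <= b -> b <= PI ->
            Rabs (RInt (fun t => g t * sin (INR n * t)) a b) <= (b - a) * M).
  { intros a b Ha Hab Hb. apply abs_RInt_le_const; trivial.
    - apply Xs; trivial.
    - intros t Ht. eapply Rle_trans; [apply Rabs_mult_sin_le|apply HM; lra]. }
  assert (Hmid : Rabs (RInt (fun t => g t * chi n e t) e (PI - e) -
    RInt (fun t => g t * sin (INR n * t)) e (PI - e)) <= (PI - e - e) * (M * (INR n * e))).
  { rewrite <- RInt_Rminus; [|exact Xc|apply Xs; lra].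
    apply abs_RInt_le_const; [lra| |].
    - apply ex_RInt_Rminus; [exact Xc|apply Xs; lra].
    - intros t Ht. rewrite <- Rmult_minus_distr_l, Rabs_mult.
      apply Rmult_le_compat; try apply Rabs_pos; [apply HM; lra|].
      apply chi_close; lra. }
  pose proof (Hend 0 e ltac:(lra) ltac:(lra) ltac:(lra)) as H1.
  pose proof (Hend (PI - e) PI ltac:(lra) ltac:(lra) ltac:(lra)) as H2.
  assert (H3 : (PI - e - e) * (M * (INR n * e)) <= PI * (M * (INR n * e))).
  { apply Rmult_le_compat_r; [|lra]. apply Rmult_le_pos; nra. }
  apply Rabs_le_between in H1. apply Rabs_le_between in H2.
  apply Rabs_le_between in Hmid. apply Rabs_le. split; nra.
Qed.

(** Uniform continuity: walking from the corner [(a, c)] to [(x, y)] along a segment in N equal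
    steps, each too short to change [f] by 1, changes [f] by at most N. *)
Lemma continuity_2d_bounded (f : R -> R -> R) (a b c d : R) :
  a <= b -> c <= d ->
  (forall x y, a <= x <= b -> c <= y <= d -> continuity_2d_pt f x y) ->
  exists M, 0 <= M /\
    forall x y, a <= x <= b -> c <= y <= d -> Rabs (f x y) <= M.
Proof.
  intros Hab Hcd Hf.
  destruct (uniform_continuity_2d f a b c d Hf (mkposreal 1 Rlt_0_1)) as [del Hdel].
  simpl in Hdel. pose proof (cond_pos del) as Hd.
  destruct (INR_unbounded ((b - a + (d - c)) / del)) as [N HN].
  assert (HN' : b - a + (d - c) < del * INR N).
  { replace (b - a + (d - c)) with (del * ((b - a + (d - c)) / del)) by (field; lra).
    apply Rmult_lt_compat_l; lra. }
  assert (HN0 : 0 < INR N) by nra.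
  exists (Rabs (f a c) + INR N). split.
  { pose proof (Rabs_pos (f a c)). lra. }
  intros x y Hx Hy.
  set (hx := (x - a) / INR N). set (hy := (y - c) / INR N).
  assert (Ex : INR N * hx = x - a) by (unfold hx; field; lra).
  assert (Ey : INR N * hy = y - c) by (unfold hy; field; lra).
  assert (Hhx : 0 <= hx < del).
  { split; [apply Rdiv_le_0_compat; lra|]. apply Rmult_lt_reg_l with (INR N); nra. }
  assert (Hhy : 0 <= hy < del).
  { split; [apply Rdiv_le_0_compat; lra|]. apply Rmult_lt_reg_l with (INR N); nra. }
  assert (Hi : forall i, (i <= N)%nat ->
            Rabs (f (a + INR i * hx) (c + INR i * hy)) <= Rabs (f a c) + INR i).
  { induction i as [|i IH]; intros HiN.
    - simpl. rewrite !Rmult_0_l, !Rplus_0_r. lra.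
    - specialize (IH ltac:(lia)).
      assert (HiR : INR (S i) <= INR N) by now apply le_INR.
      rewrite S_INR in HiR |- *. pose proof (pos_INR i).
      assert (Hstep : Rabs (f (a + (INR i + 1) * hx) (c + (INR i + 1) * hy) -
                            f (a + INR i * hx) (c + INR i * hy)) < 1).
      { apply Hdel.
        - nra.
        - nra.
        - nra.
        - nra.
        - replace (a + (INR i + 1) * hx - (a + INR i * hx)) with hx by ring.
          rewrite Rabs_pos_eq; lra.
        - replace (c + (INR i + 1) * hy - (c + INR i * hy)) with hy by ring.
          rewrite Rabs_pos_eq; lra. }
      set (u := f (a + (INR i + 1) * hx) (c + (INR i + 1) * hy)) in *.
      set (v := f (a + INR i * hx) (c + INR i * hy)) in *.
      pose proof (Rabs_triang (u - v) v) as Ht.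
      replace (u - v + v) with u in Ht by ring. lra. }
  specialize (Hi N (Nat.le_refl N)). rewrite Ex, Ey in Hi.
  replace (a + (x - a)) with x in Hi by ring.
  now replace (c + (y - c)) with y in Hi by ring.
Qed.

(** The Dirichlet condition on the flat boundary, encoded as continuity of the extension by zero
    into the lower half plane; uniform continuity can then be used up to the boundary. *)
Definition dirichlet_half (r1 r2 : R) (f : R -> R -> R) : Prop :=
  forall x y, annulus r1 r2 x y ->
    continuity_2d_pt f x y /\ (y <= 0 -> f x y = 0).

Lemma polar_continuity_annulus (f : R -> R -> R) (r1 r2 r t : R) :
  0 <= r1 -> r1 < r < r2 ->
  (forall x y, annulus r1 r2 x y -> continuity_2d_pt f x y) ->
  continuity_2d_pt (polar f) r t.
Proof. intros H1 Hr Hf. apply polar_continuity, Hf. now apply polar_annulus. Qed.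

Lemma polar_continuous (f : R -> R -> R) (r1 r2 r t : R) :
  0 <= r1 -> r1 < r < r2 ->
  (forall x y, annulus r1 r2 x y -> continuity_2d_pt f x y) ->
  continuous (polar f r) t.
Proof.
  intros H1 Hr Hf.
  apply (continuity_2d_path (polar f) (fun _ => r) (fun t => t)).
  - now apply (polar_continuity_annulus f r1 r2).
  - apply continuous_const.
  - apply continuous_id.
Qed.

Lemma arc_close (n : nat) (r1 r2 c d : R) (f : R -> R -> R) :
  0 <= r1 -> r1 < c -> c <= d -> d < r2 ->
  (forall x y, annulus r1 r2 x y -> continuity_2d_pt f x y) ->
  exists K, 0 <= K /\ forall e r, 0 < e <= PI / 4 -> c <= r <= d ->
    Rabs (arc n e f r - coef n f r) <= K * e.
Proof.
  intros H1 Hc Hcd Hd Hf. pose proof PI2_1. pose proof (pos_INR n) as Hn.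
  destruct (continuity_2d_bounded (polar f) c d 0 PI) as [M [HM0 HM]]; try lra.
  { intros r t Hr _. apply (polar_continuity_annulus f r1 r2); trivial; lra. }
  exists (sqrt d * (M * (2 + INR n * PI))).
  assert (HnP : 0 <= INR n * PI) by (apply Rmult_le_pos; lra).
  assert (HK : 0 <= M * (2 + INR n * PI)) by nra.
  split; [apply Rmult_le_pos; [apply sqrt_pos|trivial]|].
  intros e r He Hr. unfold arc, coef.
  rewrite <- Rmult_minus_distr_l, Rabs_mult, (Rabs_pos_eq (sqrt r)) by apply sqrt_pos.
  rewrite Rmult_assoc. apply Rmult_le_compat; try apply Rabs_pos; try apply sqrt_pos.
  - apply sqrt_le_1; lra.
  - apply RInt_arc_close; trivial.
    + intros t _. apply (polar_continuous f r1 r2); trivial; lra.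
    + intros t Ht. apply HM; lra.
Qed.

Lemma coef_bound (n : nat) (r M : R) (f : R -> R -> R) :
  (forall t, 0 <= t <= PI -> continuous (polar f r) t) ->
  (forall t, 0 <= t <= PI -> Rabs (polar f r t) <= M) ->
  Rabs (coef n f r) <= sqrt r * (PI * M).
Proof.
  intros Hf HM. pose proof PI2_1. unfold coef.
  rewrite Rabs_mult, (Rabs_pos_eq (sqrt r)) by apply sqrt_pos.
  apply Rmult_le_compat_l; [apply sqrt_pos|].
  replace (PI * M) with ((PI - 0) * M) by ring. apply abs_RInt_le_const; [lra| |].
  - apply ex_RInt_continuous_le; [lra|]. intros t Ht.
    apply continuous_Rmult; [now apply Hf|apply continuous_sin_scal].
  - intros t Ht. eapply Rle_trans; [apply Rabs_mult_sin_le|now apply HM].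
Qed.

Definition bessel_potential (k : R) (n : nat) (r : R) : R :=
  (INR n ^ 2 - 1 / 4) / r ^ 2 - k ^ 2.

(** Uniform continuity in polar coordinates, compared with the angles 0 and pi, where the field is
    zero. *)
Lemma dirichlet_half_small (r1 r2 c d : R) (f : R -> R -> R) :
  0 <= r1 -> r1 < c -> c <= d -> d < r2 -> dirichlet_half r1 r2 f ->
  forall w, 0 < w -> exists e0, 0 < e0 /\ forall e r, 0 < e <= e0 -> c <= r <= d ->
    Rabs (polar f r e) <= w /\ Rabs (polar f r (PI - e)) <= w.
Proof.
  intros H1 Hc Hcd Hd Hf w Hw. pose proof PI2_1.
  destruct (uniform_continuity_2d (polar f) c d 0 PI) with (eps := mkposreal w Hw)
    as [del Hdel].
  { intros r t Hr _. apply (polar_continuity_annulus f r1 r2); trivial; [lra|].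
    intros; now apply Hf. }
  simpl in Hdel. pose proof (cond_pos del).
  exists (Rmin 1 (del / 2)). split; [apply Rmin_glb_lt; lra|].
  intros e r He Hr. pose proof (Rmin_l 1 (del / 2)). pose proof (Rmin_r 1 (del / 2)).
  assert (Z0 : polar f r 0 = 0).
  { unfold polar. apply Hf; [apply polar_annulus; lra|]. rewrite sin_0; lra. }
  assert (ZP : polar f r PI = 0).
  { unfold polar. apply Hf; [apply polar_annulus; lra|]. rewrite sin_PI; lra. }
  split.
  - rewrite <- (Rminus_0_r (polar f r e)), <- Z0. left. apply Hdel; try lra.
    + rewrite Rminus_diag, Rabs_R0; lra.
    + rewrite Rminus_0_r, Rabs_pos_eq; lra.
  - rewrite <- (Rminus_0_r (polar f r (PI - e))), <- ZP. left. apply Hdel; try lra.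
    + rewrite Rminus_diag, Rabs_R0; lra.
    + replace (PI - e - PI) with (- e) by ring.
      rewrite Rabs_Ropp, Rabs_pos_eq; lra.
Qed.

(** The equation for [arc] tends to the one for [coef], uniformly on compact ranges of r. Three
    errors occur: replacing [arc] by [coef], replacing the frequency by n, and the boundary term,
    which is small because the field is small near the flat boundary. *)
Lemma arc_ode_close (k : R) (n : nat) (r1 r2 c d : R) (f : R -> R -> R) :
  0 <= r1 -> r1 < c -> c <= d -> d < r2 -> dirichlet_half r1 r2 f ->
  forall w, 0 < w -> exists e0, 0 < e0 <= PI / 4 /\
    forall e r, 0 < e <= e0 -> c <= r <= d ->
    Rabs (arc n e f r - coef n f r) <= w /\
    Rabs (((arc_freq n e ^ 2 - 1 / 4) / r ^ 2 - k ^ 2) * arc n e f r +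
       sqrt r * arc_freq n e / r ^ 2 *
       (polar f r (PI - e) * cos (INR n * PI) - polar f r e) -
       bessel_potential k n r * coef n f r) <= w.
Proof.
  intros H1 Hc Hcd Hd Hf w Hw. pose proof PI2_1. pose proof (pos_INR n) as Hn.
  destruct (arc_close n r1 r2 c d f) as [K [HK HKc]]; trivial.
  { intros; now apply Hf. }
  destruct (continuity_2d_bounded (polar f) c d 0 PI) as [M [HM0 HM]]; try lra.
  { intros r t Hr _. apply (polar_continuity_annulus f r1 r2); trivial; [lra|].
    intros; now apply Hf. }
  destruct (bessel_potential_bounded (INR n ^ 2 - 1 / 4) k c d) as [KV HKV]; [lra|].
  assert (HKV0 : 0 <= KV).
  { eapply Rle_trans; [apply Rabs_pos|apply (HKV c); lra]. }
  set (sd := sqrt d). assert (Hsd : 0 <= sd) by apply sqrt_pos.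
  set (B := sd * (PI * M)).
  assert (HB : 0 <= B).
  { apply Rmult_le_pos; [|apply Rmult_le_pos]; lra. }
  assert (Hc2 : 0 < / c ^ 2) by (apply Rinv_0_lt_compat, pow_lt; lra).
  (* [A] collects the errors linear in [e], and [A2] below is the factor of the boundary values;
     each group is made to contribute at most w / 2. The 6 comes from lam^2 - n^2 <= (2 n e) (3 n)
     for e <= 1 / 2. *)
  set (A := KV * K + 6 * INR n ^ 2 * / c ^ 2 * (B + K)).
  assert (HA : 0 <= A).
  { unfold A. pose proof (pow2_ge_0 (INR n)). apply Rplus_le_le_0_compat; [nra|].
    apply Rmult_le_pos; [apply Rmult_le_pos|]; lra. }
  set (A2 := sd * (3 * INR n) * / c ^ 2).
  assert (HA2 : 0 <= A2) by (unfold A2; apply Rmult_le_pos; [apply Rmult_le_pos|]; lra).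
  assert (Hw2 : 0 < w / (4 * (A2 + 1))) by (apply Rdiv_lt_0_compat; lra).
  destruct (dirichlet_half_small r1 r2 c d f H1 Hc Hcd Hd Hf _ Hw2) as [e1 [He1 Hs]].
  assert (HAK : 0 < w / (2 * (A + K + 1))) by (apply Rdiv_lt_0_compat; lra).
  set (e2 := w / (2 * (A + K + 1))) in *.
  assert (He2 : e2 * (2 * (A + K + 1)) = w) by (unfold e2; field; lra).
  set (w2 := w / (4 * (A2 + 1))) in *.
  assert (Hw2e : w2 * (4 * (A2 + 1)) = w) by (unfold w2; field; lra).
  clearbody e2 w2.
  exists (Rmin (Rmin (1 / 2) (PI / 4)) (Rmin e1 e2)).
  pose proof (Rmin_l (Rmin (1 / 2) (PI / 4)) (Rmin e1 e2)).
  pose proof (Rmin_r (Rmin (1 / 2) (PI / 4)) (Rmin e1 e2)).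
  pose proof (Rmin_l e1 e2). pose proof (Rmin_r e1 e2).
  pose proof (Rmin_l (1 / 2) (PI / 4)). pose proof (Rmin_r (1 / 2) (PI / 4)).
  split; [split; [repeat apply Rmin_glb_lt; lra|lra]|].
  intros e r He Hr.
  specialize (HKc e r ltac:(lra) Hr). specialize (Hs e r ltac:(lra) Hr).
  destruct Hs as [Hs1 Hs2]. specialize (HKV r Hr). fold (bessel_potential k n r) in HKV.
  split; [nra|].
  assert (Hbe : Rabs (coef n f r) <= B).
  { eapply Rle_trans; [apply (coef_bound n r M)|].
    - intros t _. apply (polar_continuous f r1 r2); trivial; [lra|].
      intros; now apply Hf.
    - intros t Ht. now apply HM.
    - unfold B, sd. apply Rmult_le_compat_r; [nra|]. apply sqrt_le_1; lra. }
  assert (HX : Rabs (arc n e f r) <= B + K).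
  { replace (arc n e f r) with ((arc n e f r - coef n f r) + coef n f r) by ring.
    eapply Rle_trans; [apply Rabs_triang|]. nra. }
  pose proof (arc_freq_bounds n e ltac:(lra)) as Hlam.
  set (lam := arc_freq n e) in *. set (X := arc n e f r) in *.
  set (Y := coef n f r) in *.
  set (P1 := polar f r (PI - e)) in *. set (P2 := polar f r e) in *.
  clearbody lam X Y P1 P2.
  assert (Hr2 : 0 < / r ^ 2 <= / c ^ 2).
  { split; [apply Rinv_0_lt_compat, pow_lt; lra|].
    apply Rinv_le_contravar; [apply pow_lt; lra|apply pow_incr; lra]. }
  assert (T1 : Rabs (bessel_potential k n r * (X - Y)) <= KV * (K * e)).
  { rewrite Rabs_mult. apply Rmult_le_compat; trivial; apply Rabs_pos. }
  assert (T2 : Rabs ((lam ^ 2 - INR n ^ 2) * / r ^ 2 * X) <=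
            6 * INR n ^ 2 * e * / c ^ 2 * (B + K)).
  { rewrite !Rabs_mult. apply Rmult_le_compat; try apply Rabs_pos; trivial.
    - apply Rmult_le_pos; apply Rabs_pos.
    - apply Rmult_le_compat; try apply Rabs_pos.
      + rewrite Rabs_pos_eq by nra.
        replace (lam ^ 2 - INR n ^ 2) with ((lam - INR n) * (lam + INR n)) by ring.
        replace (6 * INR n ^ 2 * e) with ((2 * INR n * e) * (3 * INR n + 0)) by ring.
        assert (lam - INR n <= 2 * INR n * e) by lra.
        assert (INR n * e <= INR n * (1 / 2)) by (apply Rmult_le_compat_l; lra).
        apply Rmult_le_compat; lra.
      + rewrite Rabs_pos_eq; lra. }
  assert (T3 : Rabs (sqrt r * lam * / r ^ 2 * (P1 * cos (INR n * PI) - P2)) <=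
            A2 * (2 * w2)).
  { rewrite Rabs_mult. apply Rmult_le_compat; try apply Rabs_pos.
    - unfold A2. rewrite Rabs_pos_eq.
      + apply Rmult_le_compat; try lra.
        * apply Rmult_le_pos; [apply sqrt_pos|lra].
        * apply Rmult_le_compat; [apply sqrt_pos|lra| |nra].
          apply sqrt_le_1; lra.
      + apply Rmult_le_pos; [apply Rmult_le_pos; [apply sqrt_pos|lra]|lra].
    - unfold Rminus. eapply Rle_trans; [apply Rabs_triang|]. rewrite Rabs_Ropp.
      rewrite Rabs_mult.
      assert (Rabs (cos (INR n * PI)) <= 1) by (apply Rabs_le, COS_bound).
      pose proof (Rabs_pos P1). pose proof (Rabs_pos (cos (INR n * PI))). nra. }
  assert (HT : KV * (K * e) + 6 * INR n ^ 2 * e * / c ^ 2 * (B + K) = A * e).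
  { unfold A. ring. }
  assert (HAe : A * e <= w / 2).
  { assert (A * e <= (A + K + 1) * e2); [|lra].
    apply Rmult_le_compat; lra. }
  assert (HA2w : A2 * (2 * w2) <= w / 2) by lra.
  match goal with |- Rabs ?a <= _ =>
    replace a with (bessel_potential k n r * (X - Y) +
      (lam ^ 2 - INR n ^ 2) * / r ^ 2 * X +
      sqrt r * lam * / r ^ 2 * (P1 * cos (INR n * PI) - P2)) end.
  2: { unfold bessel_potential. field. lra. }
  eapply Rle_trans; [apply Rabs_triang|].
  assert (Rabs (bessel_potential k n r * (X - Y) + (lam ^ 2 - INR n ^ 2) * / r ^ 2 * X)
          <= A * e).
  { eapply Rle_trans; [apply Rabs_triang|]. lra. }
  lra.
Qed.

Lemma continuous_uniform_limit (f : R -> R) (c d x : R) :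
  c < x < d ->
  (forall w, 0 < w -> exists p, continuous p x /\
     forall y, c <= y <= d -> Rabs (p y - f y) <= w) ->
  continuous f x.
Proof.
  intros Hx Hf. apply continuity_pt_filterlim. apply continuity_pt_locally.
  intros eps. pose proof (cond_pos eps) as He.
  destruct (Hf (eps / 4) ltac:(lra)) as [p [Hp Hpf]].
  apply continuity_pt_filterlim in Hp. rewrite continuity_pt_locally in Hp.
  specialize (Hp (mkposreal (eps / 4) ltac:(lra))). simpl in Hp.
  assert (Hl : locally x (fun y => c < y < d)).
  { apply (locally_interval _ x c d); [apply Hx|apply Hx|]. now split. }
  generalize (filter_and _ _ Hp Hl). apply filter_imp. intros y [H1 H2].
  pose proof (Hpf y ltac:(lra)) as Hy. pose proof (Hpf x ltac:(lra)) as Hx'.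
  apply Rabs_def2 in H1. apply Rabs_le_between in Hy. apply Rabs_le_between in Hx'.
  apply Rabs_def1; lra.
Qed.

(** [coef] is the locally uniform limit of [arc] as the arc fills the half circle, and [ode_limit]
    carries the equation over, so derivatives on the flat boundary never occur. *)
Lemma coef_ode (k : R) (n : nat) (r1 r2 : R) (f f1 f2 : R -> R -> R) :
  0 <= r1 -> helmholtz k (half_annulus r1 r2) f f1 f2 -> dirichlet_half r1 r2 f ->
  forall r, r1 < r < r2 ->
    is_derive (coef n f) r (Derive (coef n f) r) /\
    is_derive (Derive (coef n f)) r (bessel_potential k n r * coef n f r).
Proof.
  intros H1 Hf Hd. pose proof PI2_1.
  apply ode_limit.
  - intros r Hr. apply continuous_Rmult.
    + apply @ex_derive_continuous. unfold bessel_potential. auto_derive. nra.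
    + apply (continuous_uniform_limit _ ((r1 + r) / 2) ((r + r2) / 2)); [lra|].
      intros w Hw.
      destruct (arc_ode_close k n r1 r2 ((r1 + r) / 2) ((r + r2) / 2) f) with (w := w)
        as [e [He HE]]; trivial; try lra.
      exists (arc n e f). split.
      * apply @ex_derive_continuous. eexists.
        exact (proj1 (arc_ode k n e r1 r2 f f1 f2 H1 ltac:(lra) Hf r Hr)).
      * intros y Hy. apply HE; lra.
  - intros c d w Hc Hcd Hdr Hw.
    destruct (arc_ode_close k n r1 r2 c d f) with (w := w) as [e [He HE]];
      trivial; try lra.
    pose proof (arc_ode k n e r1 r2 f f1 f2 H1 ltac:(lra) Hf) as HO. simpl in HO.
    eexists (arc n e f), _, _. intros x Hx.
    specialize (HO x ltac:(lra)). specialize (HE e x ltac:(lra) Hx).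
    exact (conj (proj1 HO) (conj (proj2 HO) HE)).
Qed.

(** The pointwise bound is integrated over a shorter arc, where differentiation under the integral
    is allowed, and carried to [coef] by [derivative_interpolation]. The term with 2 r comes from
    differentiating sqrt r. The function [z] is k q for the real part of the radiation condition and
    - k p for the imaginary part. *)
Lemma coef_radial_bound (k : R) (n : nat) (r1 r2 r eta : R)
  (f f1 f2 z : R -> R -> R) :
  0 <= r1 -> helmholtz k (half_annulus r1 r2) f f1 f2 -> dirichlet_half r1 r2 f ->
  (forall x y, annulus r1 r2 x y -> continuity_2d_pt z x y) ->
  r1 < r < r2 ->
  (forall t, 0 < t < PI -> Rabs (sqrt r * (radial f1 f2 r t + polar z r t)) <= eta) ->
  Rabs (Derive (coef n f) r - coef n f r / (2 * r) + coef n z r) <= PI * eta.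
Proof.
  intros H1 Hf Hd Hz Hr Heta. pose proof PI2_1 as HPI.
  set (c := (r1 + r) / 2). set (d := (r + r2) / 2).
  assert (Hc : r1 < c) by (unfold c; lra). assert (Hcr : c < r) by (unfold c; lra).
  assert (Hdr : d < r2) by (unfold d; lra). assert (Hrd : r < d) by (unfold d; lra).
  clearbody c d.
  apply le_epsilon. intros w Hw.
  destruct (arc_close n r1 r2 c d z) as [K [HK HKz]]; trivial; try lra.
  set (L := 2 / (d - c) + (d - c)).
  assert (HL : 0 < L).
  { unfold L. apply Rplus_lt_0_compat; [apply Rdiv_lt_0_compat; lra|lra]. }
  assert (Hi : 0 < / (2 * r)) by (apply Rinv_0_lt_compat; lra).
  set (v := w / (L + / (2 * r) + 1)).
  assert (Hv : 0 < v) by (apply Rdiv_lt_0_compat; lra).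
  assert (Hve : v * (L + / (2 * r) + 1) = w) .
  { unfold v, Rdiv. rewrite Rmult_assoc, Rinv_l; lra. }
  clearbody v.
  destruct (arc_ode_close k n r1 r2 c d f) with (w := v) as [e0 [He0 HE]];
    trivial; try lra.
  set (e := Rmin e0 (v / (K + 1))).
  assert (Hvk : 0 < v / (K + 1)) by (apply Rdiv_lt_0_compat; lra).
  assert (He : 0 < e) by (now apply Rmin_glb_lt).
  assert (Hee0 : e <= e0) by apply Rmin_l.
  assert (HeK : e <= v / (K + 1)) by apply Rmin_r.
  assert (HKe : K * e <= v).
  { apply Rmult_le_compat_r with (r := K + 1) in HeK; [|lra].
    replace (v / (K + 1) * (K + 1)) with v in HeK by (field; lra). nra. }
  clearbody e.
  pose proof (arc_ode k n e r1 r2 f f1 f2 H1 ltac:(lra) Hf) as HO. simpl in HO.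
  pose proof (coef_ode k n r1 r2 f f1 f2 H1 Hf Hd) as HC.
  set (S := RInt (fun t => radial f1 f2 r t * chi n e t) e (PI - e)) in *.
  assert (HD : Rabs (arc n e f r / (2 * r) + sqrt r * S - Derive (coef n f) r) <= v * L).
  { apply (derivative_interpolation (fun y => arc n e f y - coef n f y)
      (fun y => arc n e f y / (2 * y) + sqrt y *
         RInt (fun t => radial f1 f2 y t * chi n e t) e (PI - e)
         - Derive (coef n f) y)
      (fun y => ((arc_freq n e ^ 2 - 1 / 4) / y ^ 2 - k ^ 2) * arc n e f y +
       sqrt y * arc_freq n e / y ^ 2 *
       (polar f y (PI - e) * cos (INR n * PI) - polar f y e) -
       bessel_potential k n y * coef n f y)); try lra.
    - intros y Hy. exact (is_derive_minus _ _ _ _ _ (proj1 (HO y ltac:(lra)))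
        (proj1 (HC y ltac:(lra)))).
    - intros y Hy. exact (is_derive_minus _ _ _ _ _ (proj2 (HO y ltac:(lra)))
        (proj2 (HC y ltac:(lra)))).
    - intros y Hy. exact (proj1 (HE e y ltac:(lra) Hy)).
    - intros y Hy. exact (proj2 (HE e y ltac:(lra) Hy)). }
  assert (Xf : ex_RInt (fun t => radial f1 f2 r t * chi n e t) e (PI - e)).
  { apply ex_RInt_continuous_le; [lra|]. intros t Ht.
    apply continuous_Rmult; [|apply continuous_chi].
    destruct Hf as [f11 [f12 [f21 [f22 Hf]]]].
    destruct (Hf (r * cos t) (r * sin t)) as [[_ [_ [C1 C2]]] _].
    { apply polar_half_annulus; lra. }
    apply continuous_Rplus; apply continuous_Rmult.
    - apply continuous_cos.
    - apply (continuity_2d_path (polar f1) (fun _ => r) (fun t => t)).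
      + now apply polar_continuity.
      + apply continuous_const.
      + apply continuous_id.
    - apply continuous_sin.
    - apply (continuity_2d_path (polar f2) (fun _ => r) (fun t => t)).
      + now apply polar_continuity.
      + apply continuous_const.
      + apply continuous_id. }
  assert (Xz : ex_RInt (fun t => polar z r t * chi n e t) e (PI - e)).
  { apply ex_RInt_continuous_le; [lra|]. intros t Ht.
    apply continuous_Rmult; [|apply continuous_chi].
    apply (polar_continuous z r1 r2); trivial; lra. }
  assert (HS : Rabs (sqrt r * S + arc n e z r) <= PI * eta).
  { unfold arc, S. rewrite <- Rmult_plus_distr_l, <- RInt_Rplus by assumption.
    rewrite <- RInt_Rscal by (now apply ex_RInt_Rplus).
    assert (Heta0 : 0 <= eta).
    { eapply Rle_trans; [apply Rabs_pos|apply (Heta 1)]; lra. }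
    apply Rle_trans with ((PI - e - e) * eta); [|nra].
    apply abs_RInt_le_const; [lra| |].
    - apply ex_RInt_Rscal. now apply ex_RInt_Rplus.
    - intros t Ht. rewrite <- Rmult_plus_distr_r, <- Rmult_assoc.
      eapply Rle_trans; [apply Rabs_mult_sin_le|]. apply Heta; lra. }
  pose proof (HKz e r ltac:(lra) ltac:(lra)) as HZ.
  destruct (HE e r ltac:(lra) ltac:(lra)) as [HA _].
  set (X := arc n e f r) in *. set (Y := coef n f r) in *.
  assert (HXY : Rabs ((X - Y) / (2 * r)) <= v * / (2 * r)).
  { unfold Rdiv. rewrite Rabs_mult, (Rabs_pos_eq (/ (2 * r))) by lra.
    apply Rmult_le_compat_r; lra. }
  replace (Derive (coef n f) r - Y / (2 * r) + coef n z r) with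
    (- (X / (2 * r) + sqrt r * S - Derive (coef n f) r) + (X - Y) / (2 * r)
     + (sqrt r * S + arc n e z r) - (arc n e z r - coef n z r)) by (field; lra).
  apply Rabs_le_between in HD. apply Rabs_le_between in HS.
  apply Rabs_le_between in HZ. apply Rabs_le_between in HXY.
  apply Rabs_le. split; nra.
Qed.

(** * Radiating solutions outside a half disk *)

Lemma polar_coordinates (x y : R) :
  0 < y -> exists r t, 0 < r /\ 0 < t < PI /\ x = r * cos t /\ y = r * sin t /\
    r ^ 2 = x ^ 2 + y ^ 2 /\ cos t = x / r.
Proof.
  intros Hy. set (r := sqrt (x ^ 2 + y ^ 2)).
  assert (Hp : 0 < x ^ 2 + y ^ 2) by nra.
  assert (Hr : 0 < r) by now apply sqrt_lt_R0.
  assert (Hr2 : r * r = x ^ 2 + y ^ 2) by (apply sqrt_sqrt; lra).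
  clearbody r.
  assert (E : (x / r) * r = x) by (field; lra).
  set (c := x / r) in *. clearbody c.
  assert (Hc2 : c * c < 1).
  { apply Rmult_lt_reg_r with (r * r); nra. }
  assert (Hc : -1 < c < 1) by (split; nra).
  pose proof (cos_acos c ltac:(lra)) as Hcos.
  pose proof (acos_bound c) as Hb.
  assert (Ht : 0 < acos c < PI).
  { split.
    - destruct (Req_dec (acos c) 0) as [H0|]; [|lra].
      rewrite H0, cos_0 in Hcos. lra.
    - destruct (Req_dec (acos c) PI) as [H0|]; [|lra].
      rewrite H0, cos_PI in Hcos. lra. }
  pose proof (sin_gt_0 (acos c) ltac:(lra) ltac:(lra)) as Hs.
  pose proof (sin2_cos2 (acos c)) as Hsc. unfold Rsqr in Hsc. rewrite Hcos in Hsc.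
  assert (Hy' : y = r * sin (acos c)).
  { set (s := sin (acos c)) in *. clearbody s. clear Hcos Hb Ht.
    assert (H0 : (r * s - y) * (r * s + y) = 0).
    { replace ((r * s - y) * (r * s + y)) with (r * r * (s * s) - y * y) by ring.
      replace (s * s) with (1 - c * c) by lra.
      replace (r * r * (1 - c * c) - y * y) with (r * r - (c * r) * (c * r) - y * y)
        by ring. rewrite E, Hr2. ring. }
    assert (0 < r * s) by now apply Rmult_lt_0_compat.
    apply Rmult_integral in H0. lra. }
  assert (Hcr : c = x / r) by (rewrite <- E; field; lra).
  exists r, (acos c). rewrite Hcos. repeat split; try assumption; nra.
Qed.

Lemma coef_scal (n : nat) (l r : R) (f : R -> R -> R) :
  (forall t, 0 <= t <= PI -> continuous (polar f r) t) ->
  coef n (fun x y => l * f x y) r = l * coef n f r.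
Proof.
  intros Hf. pose proof PI2_1. unfold coef.
  rewrite (RInt_ext _ (fun t => l * (polar f r t * sin (INR n * t)))).
  - rewrite RInt_Rscal; [ring|]. apply ex_RInt_continuous_le; [lra|]. intros t Ht.
    apply continuous_Rmult; [now apply Hf|apply continuous_sin_scal].
  - intros t _. unfold polar. Rring.
Qed.

Lemma coef_close (n : nat) (r w : R) (f : R -> R -> R) (g : R -> R) :
  (forall t, 0 <= t <= PI -> continuous (polar f r) t) ->
  (forall t, 0 <= t <= PI -> continuous g t) ->
  (forall t, 0 <= t <= PI -> Rabs (sqrt r * polar f r t - g t) <= w) ->
  Rabs (coef n f r - RInt (fun t => g t * sin (INR n * t)) 0 PI) <= PI * w.
Proof.
  intros Hf Hg Hw. pose proof PI2_1.
  assert (Xf : ex_RInt (fun t => polar f r t * sin (INR n * t)) 0 PI).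
  { apply ex_RInt_continuous_le; [lra|]. intros t Ht.
    apply continuous_Rmult; [now apply Hf|apply continuous_sin_scal]. }
  assert (Xg : ex_RInt (fun t => g t * sin (INR n * t)) 0 PI).
  { apply ex_RInt_continuous_le; [lra|]. intros t Ht.
    apply continuous_Rmult; [now apply Hg|apply continuous_sin_scal]. }
  unfold coef. rewrite <- RInt_Rscal, <- RInt_Rminus by auto using ex_RInt_Rscal.
  replace (PI * w) with ((PI - 0) * w) by ring.
  apply abs_RInt_le_const; [lra|auto using ex_RInt_Rminus, ex_RInt_Rscal|].
  intros t Ht. rewrite <- Rmult_assoc, <- Rmult_minus_distr_r.
  eapply Rle_trans; [apply Rabs_mult_sin_le|now apply Hw].
Qed.

Definition exterior (R0 x y : R) : Prop := 0 < y /\ R0 ^ 2 < x ^ 2 + y ^ 2.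

(* [p + i q] radiates with far field [a + i b], as a function of the polar angle. *)
Definition radiating (k R0 : R) (p p1 p2 q q1 q2 : R -> R -> R) (a b : R -> R) : Prop :=
  (helmholtz k (exterior R0) p p1 p2 /\ helmholtz k (exterior R0) q q1 q2) /\
  (forall r, dirichlet_half R0 r p /\ dirichlet_half R0 r q) /\
  (forall t, 0 <= t <= PI -> continuous a t /\ continuous b t) /\
  (forall w, 0 < w -> exists rho, forall r t, rho < r -> 0 < t < PI ->
     Rabs (sqrt r * (radial p1 p2 r t + k * polar q r t)) <= w /\
     Rabs (sqrt r * (radial q1 q2 r t - k * polar p r t)) <= w) /\
  (forall w, 0 < w -> exists rho, forall r t, rho < r -> 0 <= t <= PI ->
     Rabs (sqrt r * polar p r t - (a t * cos (k * r) - b t * sin (k * r))) <= w /\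
     Rabs (sqrt r * polar q r t - (a t * sin (k * r) + b t * cos (k * r))) <= w).

Lemma helmholtz_sub (k : R) (D E : R -> R -> Prop) (f f1 f2 : R -> R -> R) :
  (forall x y, E x y -> D x y) -> helmholtz k D f f1 f2 -> helmholtz k E f f1 f2.
Proof.
  intros HDE [f11 [f12 [f21 [f22 H]]]]. exists f11, f12, f21, f22.
  intros x y Hxy. now apply H, HDE.
Qed.

(** Reduction to one angular mode: the equation, the radiation condition and the far-field
    asymptotics are linear and uniform in the angle, so each projects onto sin(n t). *)
Lemma radiating_coef (k R0 : R) (p p1 p2 q q1 q2 : R -> R -> R) (a b : R -> R)
  (n : nat) :
  0 <= R0 -> radiating k R0 p p1 p2 q q1 q2 a b ->
  (forall r, R0 < r ->
     is_derive (coef n p) r (Derive (coef n p) r) /\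
     is_derive (Derive (coef n p)) r (bessel_potential k n r * coef n p r) /\
     is_derive (coef n q) r (Derive (coef n q) r) /\
     is_derive (Derive (coef n q)) r (bessel_potential k n r * coef n q r)) /\
  (forall w, 0 < w -> exists rho, forall r, rho < r ->
     Rabs (Derive (coef n p) r - coef n p r / (2 * r) + k * coef n q r) <= w /\
     Rabs (Derive (coef n q) r - coef n q r / (2 * r) - k * coef n p r) <= w) /\
  (let fa := RInt (fun t => a t * sin (INR n * t)) 0 PI in
   let fb := RInt (fun t => b t * sin (INR n * t)) 0 PI in
   forall w, 0 < w -> exists rho, forall r, rho < r ->
     Rabs (coef n p r - (fa * cos (k * r) - fb * sin (k * r))) <= w /\
     Rabs (coef n q r - (fa * sin (k * r) + fb * cos (k * r))) <= w).
Proof.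
  intros HR [[Hp Hq] [Hd [Hab [Hs Hff]]]]. pose proof PI2_1 as HPI.
  assert (Hsub : forall r x y, half_annulus R0 r x y -> exterior R0 x y).
  { unfold half_annulus, exterior. intros; lra. }
  assert (Hp' : forall r, helmholtz k (half_annulus R0 r) p p1 p2).
  { intros r. eapply helmholtz_sub; [apply Hsub|exact Hp]. }
  assert (Hq' : forall r, helmholtz k (half_annulus R0 r) q q1 q2).
  { intros r. eapply helmholtz_sub; [apply Hsub|exact Hq]. }
  assert (Kp : forall r t, R0 < r -> continuous (polar p r) t).
  { intros r t Hr. apply (polar_continuous p R0 (r + 1)); [lra|lra|].
    intros x y Hxy. now apply (proj1 (Hd (r + 1))). }
  assert (Kq : forall r t, R0 < r -> continuous (polar q r) t).
  { intros r t Hr. apply (polar_continuous q R0 (r + 1)); [lra|lra|].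
    intros x y Hxy. now apply (proj2 (Hd (r + 1))). }
  split; [|split].
  - intros r Hr.
    destruct (coef_ode k n R0 (r + 1) p p1 p2) with (r := r) as [H1 H2];
      trivial; [apply Hd|lra|].
    destruct (coef_ode k n R0 (r + 1) q q1 q2) with (r := r) as [H3 H4];
      trivial; [apply Hd|lra|].
    tauto.
  - intros w Hw. destruct (Hs (w / PI)) as [rho Hrho].
    { apply Rdiv_lt_0_compat; lra. }
    exists (Rmax rho R0). intros r Hr.
    pose proof (Rmax_l rho R0). pose proof (Rmax_r rho R0).
    replace w with (PI * (w / PI)) by (field; lra).
    split.
    + rewrite <- (coef_scal n k) by (intros; apply Kq; lra).
      apply (coef_radial_bound k n R0 (r + 1) r _ p p1 p2); trivial; [apply Hd| |lra|].
      * intros x y Hxy. apply continuity_2d_pt_mult; [apply continuity_2d_pt_const|].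
        now apply (proj2 (Hd (r + 1))).
      * intros t Ht. apply Hrho; lra.
    + unfold Rminus at 1. rewrite Ropp_mult_distr_l.
      rewrite <- (coef_scal n (- k)) by (intros; apply Kp; lra).
      apply (coef_radial_bound k n R0 (r + 1) r _ q q1 q2); trivial; [apply Hd| |lra|].
      * intros x y Hxy. apply continuity_2d_pt_mult; [apply continuity_2d_pt_const|].
        now apply (proj1 (Hd (r + 1))).
      * intros t Ht. replace (radial q1 q2 r t + polar (fun x y => - k * p x y) r t)
          with (radial q1 q2 r t - k * polar p r t) by (unfold polar; ring).
        apply Hrho; lra.
  - intros fa fb w Hw. destruct (Hff (w / PI)) as [rho Hrho].
    { apply Rdiv_lt_0_compat; lra. }
    exists (Rmax rho R0). intros r Hr.
    pose proof (Rmax_l rho R0). pose proof (Rmax_r rho R0).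
    replace w with (PI * (w / PI)) by (field; lra).
    assert (Xa : ex_RInt (fun t => a t * sin (INR n * t)) 0 PI).
    { apply ex_RInt_continuous_le; [lra|]. intros t Ht.
      apply continuous_Rmult; [now apply Hab|apply continuous_sin_scal]. }
    assert (Xb : ex_RInt (fun t => b t * sin (INR n * t)) 0 PI).
    { apply ex_RInt_continuous_le; [lra|]. intros t Ht.
      apply continuous_Rmult; [now apply Hab|apply continuous_sin_scal]. }
    assert (Hlin : forall c s, RInt (fun t => (a t * c + b t * s) * sin (INR n * t)) 0 PI
              = fa * c + fb * s).
    { intros c s. rewrite (RInt_ext _ (fun t =>
        c * (a t * sin (INR n * t)) + s * (b t * sin (INR n * t)))).
      - rewrite RInt_Rplus, !RInt_Rscal; auto using ex_RInt_Rscal.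
        unfold fa, fb. Rring.
      - intros t _. Rring. }
    split.
    + replace (fa * cos (k * r) - fb * sin (k * r))
        with (fa * cos (k * r) + fb * - sin (k * r)) by ring.
      rewrite <- Hlin. apply coef_close.
      * intros; apply Kp; lra.
      * intros t Ht. apply continuous_Rplus; apply continuous_Rmult;
          try apply continuous_const; now apply Hab.
      * intros t Ht. replace (a t * cos (k * r) + b t * - sin (k * r))
          with (a t * cos (k * r) - b t * sin (k * r)) by ring. apply Hrho; lra.
    + rewrite <- Hlin. apply coef_close.
      * intros; apply Kq; lra.
      * intros t Ht. apply continuous_Rplus; apply continuous_Rmult;
          try apply continuous_const; now apply Hab.
      * intros t Ht. apply Hrho; lra.
Qed.

Lemma Rabs_mult_le (x y a b : R) :
  Rabs x <= a -> Rabs y <= b -> Rabs (x * y) <= a * b.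
Proof.
  intros. rewrite Rabs_mult. apply Rmult_le_compat; trivial; apply Rabs_pos.
Qed.

Lemma rotation_norm (fa fb t : R) :
  (fa * cos t - fb * sin t) ^ 2 + (fa * sin t + fb * cos t) ^ 2 = fa ^ 2 + fb ^ 2.
Proof. pose proof (sin2_cos2 t) as H. unfold Rsqr in H. nra. Qed.

(** Both coefficients solve the same equation, so their Wronskian is constant. Its value is read off
    at infinity, where the radiation condition replaces the derivatives of the two coefficients by -
    k times and k times the other one. *)
Lemma radiating_wronskian (k R0 : R) (p p1 p2 q q1 q2 : R -> R -> R) (a b : R -> R)
  (n : nat) (r : R) :
  0 < k -> 0 <= R0 -> radiating k R0 p p1 p2 q q1 q2 a b -> R0 < r ->
  coef n p r * Derive (coef n q) r - coef n q r * Derive (coef n p) r =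
  k * (RInt (fun t => a t * sin (INR n * t)) 0 PI ^ 2 +
       RInt (fun t => b t * sin (INR n * t)) 0 PI ^ 2).
Proof.
  intros Hk HR HU Hr.
  destruct (radiating_coef k R0 p p1 p2 q q1 q2 a b n HR HU) as [Hode [Hs Hff]].
  simpl in Hff.
  set (fa := RInt (fun t => a t * sin (INR n * t)) 0 PI) in *.
  set (fb := RInt (fun t => b t * sin (INR n * t)) 0 PI) in *.
  set (W := fun r => coef n p r * Derive (coef n q) r - coef n q r * Derive (coef n p) r).
  assert (HW : forall s, R0 < s -> is_derive W s 0).
  { intros s Hs'. destruct (Hode s Hs') as [H1 [H2 [H3 H4]]]. unfold W. evar_last.
    - exact (is_derive_minus _ _ _ _ _ (is_derive_Rmult _ _ _ _ _ H1 H4)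
        (is_derive_Rmult _ _ _ _ _ H3 H2)).
    - unfold minus, plus, opp; simpl. ring. }
  assert (Hconst : forall s, r < s -> W s = W r).
  { intros s Hsr. destruct (is_derive_mvt W (fun _ => 0) r s) as [c [_ E]]; trivial.
    - intros x Hx. apply HW. lra.
    - lra. }
  change (W r = k * (fa ^ 2 + fb ^ 2)).
  apply Rminus_diag_uniq.
  cut (Rabs (W r - k * (fa ^ 2 + fb ^ 2)) <= 0).
  { intros H. pose proof (Rabs_pos (W r - k * (fa ^ 2 + fb ^ 2))).
    apply Rabs_eq_0. lra. }
  apply le_epsilon. intros eps Heps. rewrite Rplus_0_l.
  set (B := Rabs fa + Rabs fb + 1).
  assert (HB : 1 <= B).
  { unfold B. pose proof (Rabs_pos fa). pose proof (Rabs_pos fb). lra. }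
  assert (Hw1 : 0 < eps / (8 * (k + 1) * B)) by (apply Rdiv_lt_0_compat; nra).
  (* The errors below add up to at most 2 w B + 4 k w B, which this choice keeps below eps. *)
  set (w := Rmin 1 (eps / (8 * (k + 1) * B))).
  assert (Hw : 0 < w) by (apply Rmin_glb_lt; lra).
  assert (Hw1' : w <= 1) by apply Rmin_l.
  assert (HwB : w * (8 * (k + 1) * B) <= eps).
  { apply Rle_trans with (eps / (8 * (k + 1) * B) * (8 * (k + 1) * B)).
    - apply Rmult_le_compat_r; [nra|apply Rmin_r].
    - right. field. nra. }
  clearbody w.
  destruct (Hs w Hw) as [r1 H1]. destruct (Hff w Hw) as [r2 H2].
  set (s := Rmax (Rmax r1 r2) (Rmax r (B / w)) + 1).
  pose proof (Rmax_l (Rmax r1 r2) (Rmax r (B / w))).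
  pose proof (Rmax_r (Rmax r1 r2) (Rmax r (B / w))).
  pose proof (Rmax_l r1 r2). pose proof (Rmax_r r1 r2).
  pose proof (Rmax_l r (B / w)). pose proof (Rmax_r r (B / w)).
  assert (Hsr : r < s) by (unfold s; lra).
  rewrite <- (Hconst s Hsr). unfold W.
  destruct (H1 s ltac:(unfold s; lra)) as [A1 A2].
  destruct (H2 s ltac:(unfold s; lra)) as [A3 A4].
  rewrite <- (rotation_norm fa fb (k * s)).
  set (x := coef n p s) in *. set (y := coef n q s) in *.
  set (x' := Derive (coef n p) s) in *. set (y' := Derive (coef n q) s) in *.
  set (X := fa * cos (k * s) - fb * sin (k * s)) in *.
  set (Y := fa * sin (k * s) + fb * cos (k * s)) in *.
  assert (HX : Rabs X <= B - 1 /\ Rabs Y <= B - 1).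
  { assert (Rabs (cos (k * s)) <= 1) by (apply Rabs_le, COS_bound).
    assert (Rabs (sin (k * s)) <= 1) by (apply Rabs_le, SIN_bound).
    pose proof (Rabs_pos fa). pose proof (Rabs_pos fb).
    unfold X, Y, B. split.
    - unfold Rminus at 1. eapply Rle_trans; [apply Rabs_triang|].
      rewrite Rabs_Ropp, !Rabs_mult. nra.
    - eapply Rle_trans; [apply Rabs_triang|]. rewrite !Rabs_mult. nra. }
  destruct HX as [HX HY]. clearbody X Y.
  assert (Hx : Rabs x <= B).
  { replace x with ((x - X) + X) by ring. eapply Rle_trans; [apply Rabs_triang|]. lra. }
  assert (Hy : Rabs y <= B).
  { replace y with ((y - Y) + Y) by ring. eapply Rle_trans; [apply Rabs_triang|]. lra. }
  (* The terms with 2 s, left over from the factor sqrt r, cancel between the two products. *)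
  replace (x * y' - y * x' - k * (X ^ 2 + Y ^ 2)) with
    (x * (y' - y / (2 * s) - k * x) - y * (x' - x / (2 * s) + k * y)
     + k * ((x - X) * (x + X) + (y - Y) * (y + Y))).
  2: { field. unfold s. lra. }
  pose proof (Rabs_mult_le x _ B w Hx A2) as E1.
  pose proof (Rabs_mult_le y _ B w Hy A1) as E2.
  assert (HxX : Rabs (x + X) <= 2 * B).
  { eapply Rle_trans; [apply Rabs_triang|]. lra. }
  assert (HyY : Rabs (y + Y) <= 2 * B).
  { eapply Rle_trans; [apply Rabs_triang|]. lra. }
  pose proof (Rabs_mult_le _ _ w (2 * B) A3 HxX) as E3.
  pose proof (Rabs_mult_le _ _ w (2 * B) A4 HyY) as E4.
  set (T1 := x * (y' - y / (2 * s) - k * x)) in *.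
  set (T2 := y * (x' - x / (2 * s) + k * y)) in *.
  set (T3 := (x - X) * (x + X)) in *. set (T4 := (y - Y) * (y + Y)) in *.
  clearbody T1 T2 T3 T4.
  apply Rabs_le_between in E1. apply Rabs_le_between in E2.
  apply Rabs_le_between in E3. apply Rabs_le_between in E4.
  assert (Hk1 : k * (- (w * (2 * B)) - w * (2 * B)) <= k * (T3 + T4)
              <= k * (w * (2 * B) + w * (2 * B))).
  { split; apply Rmult_le_compat_l; lra. }
  assert (0 <= k * (w * B)) by (repeat apply Rmult_le_pos; lra).
  assert (0 <= w * B) by (repeat apply Rmult_le_pos; lra).
  apply Rabs_le. split; nra.
Qed.

(** For n >= 2 k T one has k^2 <= n^2 / (4 T^2), so the centrifugal term dominates and a quarter of
    n^2 / T^2 is left. *)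
Lemma bessel_potential_large (k : R) (n : nat) (T r : R) :
  0 < k -> 0 < r -> r <= T -> 2 * k * T <= INR n -> (1 <= n)%nat ->
  (INR n / (2 * T)) ^ 2 <= bessel_potential k n r.
Proof.
  intros Hk Hr HrT Hn Hn1.
  assert (Hn1' : 1 <= INR n) by (apply (le_INR 1); lia).
  assert (HT : 0 < T) by lra.
  assert (H1 : (INR n ^ 2 - 1 / 4) / T ^ 2 <= (INR n ^ 2 - 1 / 4) / r ^ 2).
  { apply Rmult_le_compat_l; [nra|].
    apply Rinv_le_contravar; [apply pow_lt; lra|apply pow_incr; lra]. }
  unfold bessel_potential. apply Rle_trans with ((INR n ^ 2 - 1 / 4) / T ^ 2 - k ^ 2);
    [|lra].
  assert (HkT : (2 * k * T) ^ 2 <= INR n ^ 2) by (apply pow_incr; nra).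
  apply Rmult_le_reg_r with (4 * T ^ 2); [nra|].
  replace ((INR n / (2 * T)) ^ 2 * (4 * T ^ 2)) with (INR n ^ 2) by (field; lra).
  replace (((INR n ^ 2 - 1 / 4) / T ^ 2 - k ^ 2) * (4 * T ^ 2))
    with (4 * INR n ^ 2 - 1 - (2 * k * T) ^ 2) by (field; lra).
  nra.
Qed.

Lemma ode_decay_abs (p p1 V : R -> R) (m kappa M : R) :
  0 < kappa -> 0 <= M ->
  (forall r, m - 1 <= r <= m + 1 -> is_derive p r (p1 r)) ->
  (forall r, m - 1 <= r <= m + 1 -> is_derive p1 r (V r * p r)) ->
  (forall r, m - 1 <= r <= m + 1 -> kappa ^ 2 <= V r) ->
  (forall r, m - 1 <= r <= m + 1 -> Rabs (p r) <= M) ->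
  Rabs (p m) <= 2 * M * exp (- kappa).
Proof.
  intros Hk HM Hp Hp1 HV Hb.
  pose proof (Hb (m - 1) ltac:(lra)) as Hl. pose proof (Hb (m + 1) ltac:(lra)) as Hr.
  apply Rabs_le_between in Hl. apply Rabs_le_between in Hr.
  apply Rabs_le. split.
  - enough (- p m <= 2 * M * exp (- kappa)) by lra.
    apply (ode_decay (fun r => - p r) (fun r => - p1 r) V); trivial; try lra.
    + intros r Hr'. apply @is_derive_opp. now apply Hp.
    + intros r Hr'. replace (V r * - p r) with (- (V r * p r)) by ring.
      apply @is_derive_opp. now apply Hp1.
  - apply (ode_decay p p1 V); trivial; lra.
Qed.

(* In the barrier region [r < n / k] the coefficient decays from both ends of
   a fixed interval, which makes the conserved Wronskian exponentially small. *)
Lemma radiating_far_decay (k R0 : R) (p p1 p2 q q1 q2 : R -> R -> R) (a b : R -> R) :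
  0 < k -> 0 <= R0 -> radiating k R0 p p1 p2 q q1 q2 a b ->
  exists C s, 0 < s /\ forall n, (1 <= n)%nat ->
    Rabs (RInt (fun t => a t * sin (INR n * t)) 0 PI) <= C * exp (- 2 * s * INR n) /\
    Rabs (RInt (fun t => b t * sin (INR n * t)) 0 PI) <= C * exp (- 2 * s * INR n).
Proof.
  intros Hk HR HU. pose proof PI2_1 as HPI.
  pose proof HU as [_ [Hd [Hab [Hs _]]]].
  destruct (Hs 1 Rlt_0_1) as [rho Hrho].
  (* The radius [m] lies beyond [rho], where the radiation condition holds with tolerance 1, and the
     whole interval from m - 1 to m + 1 lies beyond [R0]. *)
  set (m := Rmax R0 rho + 2).
  assert (Hm1 : R0 + 2 <= m) by (unfold m; pose proof (Rmax_l R0 rho); lra).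
  assert (Hm2 : rho + 2 <= m) by (unfold m; pose proof (Rmax_r R0 rho); lra).
  clearbody m. set (T := m + 1).
  assert (Kp : forall x y, annulus R0 (T + 1) x y -> continuity_2d_pt p x y).
  { intros; now apply (proj1 (Hd (T + 1))). }
  assert (Kq : forall x y, annulus R0 (T + 1) x y -> continuity_2d_pt q x y).
  { intros; now apply (proj2 (Hd (T + 1))). }
  destruct (continuity_2d_bounded (polar p) (m - 1) T 0 PI) as [Mp [HMp0 HMp]];
    [unfold T; lra|lra| |].
  { intros x y Hx _. apply (polar_continuity_annulus p R0 (T + 1)); trivial; lra. }
  destruct (continuity_2d_bounded (polar q) (m - 1) T 0 PI) as [Mq [HMq0 HMq]];
    [unfold T; lra|lra| |].
  { intros x y Hx _. apply (polar_continuity_annulus q R0 (T + 1)); trivial; lra. }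
  set (M := sqrt T * (PI * (Mp + Mq))).
  assert (HM0 : 0 <= M).
  { apply Rmult_le_pos; [apply sqrt_pos|apply Rmult_le_pos; lra]. }
  assert (HcM : forall n r, m - 1 <= r <= T ->
            Rabs (coef n p r) <= M /\ Rabs (coef n q r) <= M).
  { intros n r Hr.
    assert (Hrt : sqrt r <= sqrt T) by (apply sqrt_le_1; lra).
    pose proof (sqrt_pos r).
    split; unfold M.
    - eapply Rle_trans; [apply (coef_bound n r Mp)|].
      + intros t _. apply (polar_continuous p R0 (T + 1)); trivial; lra.
      + intros t Ht. now apply HMp.
      + apply Rmult_le_compat; try lra; [apply Rmult_le_pos; lra|].
        apply Rmult_le_compat_l; lra.
    - eapply Rle_trans; [apply (coef_bound n r Mq)|].
      + intros t _. apply (polar_continuous q R0 (T + 1)); trivial; lra.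
      + intros t Ht. now apply HMq.
      + apply Rmult_le_compat; try lra; [apply Rmult_le_pos; lra|].
        apply Rmult_le_compat_l; lra. }
  set (M' := M + k * M + PI).
  assert (HM' : 0 <= M') by (unfold M'; nra).
  (* The radiation condition bounds these derivatives by the coefficients themselves, uniformly in
     n. *)
  assert (HdM : forall n, Rabs (Derive (coef n p) m) <= M' /\
                          Rabs (Derive (coef n q) m) <= M').
  { intros n. destruct (HcM n m ltac:(unfold T; lra)) as [Hcp Hcq].
    assert (Hsub : forall x y, half_annulus R0 (T + 1) x y -> exterior R0 x y).
    { unfold half_annulus, exterior. intros; lra. }
    destruct HU as [[Hp Hq] _].
    pose proof (helmholtz_sub _ _ _ _ _ _ Hsub Hp) as Hp'.
    pose proof (helmholtz_sub _ _ _ _ _ _ Hsub Hq) as Hq'.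
    assert (B1 : Rabs (Derive (coef n p) m - coef n p m / (2 * m) +
                       coef n (fun x y => k * q x y) m) <= PI * 1).
    { apply (coef_radial_bound k n R0 (T + 1) m 1 p p1 p2); trivial;
        [apply Hd| |unfold T; lra|].
      - intros x y Hxy. apply continuity_2d_pt_mult; [apply continuity_2d_pt_const|].
        now apply Kq.
      - intros t Ht. apply Hrho; lra. }
    assert (B2 : Rabs (Derive (coef n q) m - coef n q m / (2 * m) +
                       coef n (fun x y => - k * p x y) m) <= PI * 1).
    { apply (coef_radial_bound k n R0 (T + 1) m 1 q q1 q2); trivial;
        [apply Hd| |unfold T; lra|].
      - intros x y Hxy. apply continuity_2d_pt_mult; [apply continuity_2d_pt_const|].
        now apply Kp.
      - intros t Ht. replace (radial q1 q2 m t + polar (fun x y => - k * p x y) m t)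
          with (radial q1 q2 m t - k * polar p m t) by (unfold polar; ring).
        apply Hrho; lra. }
    rewrite coef_scal in B1.
    2: { intros t _. apply (polar_continuous q R0 (T + 1)); trivial; unfold T; lra. }
    rewrite coef_scal in B2.
    2: { intros t _. apply (polar_continuous p R0 (T + 1)); trivial; unfold T; lra. }
    set (x := coef n p m) in *. set (y := coef n q m) in *.
    set (x' := Derive (coef n p) m) in *. set (y' := Derive (coef n q) m) in *.
    assert (Hi : Rabs (/ (2 * m)) <= 1).
    { rewrite Rabs_pos_eq by (left; apply Rinv_0_lt_compat; lra).
      rewrite <- Rinv_1. apply Rinv_le_contravar; lra. }
    pose proof (Rabs_mult_le x _ M 1 Hcp Hi) as X1.
    pose proof (Rabs_mult_le y _ M 1 Hcq Hi) as Y1.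
    assert (Hkk : Rabs k <= k) by (rewrite Rabs_pos_eq; lra).
    pose proof (Rabs_mult_le k x k M Hkk Hcp) as X2.
    pose proof (Rabs_mult_le k y k M Hkk Hcq) as Y2.
    unfold Rdiv in B1, B2.
    apply Rabs_le_between in B1. apply Rabs_le_between in B2.
    apply Rabs_le_between in X1. apply Rabs_le_between in Y1.
    apply Rabs_le_between in X2. apply Rabs_le_between in Y2.
    unfold M'. split; apply Rabs_le; lra. }
  destruct (continuous_Rabs_bounded a 0 PI) as [Ca [HCa0 HCa]];
    [lra|intros; now apply Hab|].
  destruct (continuous_Rabs_bounded b 0 PI) as [Cb [HCb0 HCb]];
    [lra|intros; now apply Hab|].
  (* The Wronskian is of size exp(- n / (2 T)). The far-field coefficients are square roots of it,
     of size exp(- n / (4 T)) = exp(- 2 s n). *)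
  set (s := / (8 * T)). assert (HT : 0 < T) by (unfold T; lra).
  assert (Hs0 : 0 < s) by (apply Rinv_0_lt_compat; lra).
  set (Q := sqrt (4 * M * M' / k)).
  (* The second summand covers the finitely many n below 2 k T, for which only the trivial bound of
     the integral is available. *)
  set (C := Q + PI * (Ca + Cb) * exp (2 * s * (2 * k * T))).
  assert (HQ : 0 <= Q) by apply sqrt_pos.
  assert (HE : 0 <= PI * (Ca + Cb) * exp (2 * s * (2 * k * T))).
  { pose proof (exp_pos (2 * s * (2 * k * T))).
    apply Rmult_le_pos; [apply Rmult_le_pos|]; lra. }
  exists C, s. split; trivial. intros n Hn.
  assert (Hn1 : 1 <= INR n) by (apply (le_INR 1); lia).
  set (fa := RInt (fun t => a t * sin (INR n * t)) 0 PI).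
  set (fb := RInt (fun t => b t * sin (INR n * t)) 0 PI).
  pose proof (exp_pos (- 2 * s * INR n)) as Hen.
  destruct (Rle_or_lt (2 * k * T) (INR n)) as [Hbig|Hsmall].
  - pose proof (radiating_wronskian k R0 p p1 p2 q q1 q2 a b n m Hk HR HU
      ltac:(lra)) as HW. fold fa fb in HW.
    destruct (radiating_coef k R0 p p1 p2 q q1 q2 a b n HR HU) as [Hode _].
    assert (Hdec : forall f, (forall r, R0 < r -> is_derive (coef n f) r (Derive (coef n f) r) /\
              is_derive (Derive (coef n f)) r (bessel_potential k n r * coef n f r)) ->
              (forall r, m - 1 <= r <= T -> Rabs (coef n f r) <= M) ->
              Rabs (coef n f m) <= 2 * M * exp (- (INR n / (2 * T)))).
    { intros f Hf1 Hf2. apply (ode_decay_abs _ (Derive (coef n f)) (bessel_potential k n)); trivial.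
      - apply Rdiv_lt_0_compat; lra.
      - intros r Hr. exact (proj1 (Hf1 r ltac:(lra))).
      - intros r Hr. exact (proj2 (Hf1 r ltac:(lra))).
      - intros r Hr. apply bessel_potential_large; trivial; unfold T; lra. }
    pose proof (Hdec p ltac:(intros r Hr; destruct (Hode r Hr) as [? [? [? ?]]]; split; assumption)
      (fun r Hr => proj1 (HcM n r Hr))) as Dp.
    pose proof (Hdec q ltac:(intros r Hr; destruct (Hode r Hr) as [? [? [? ?]]]; split; assumption)
      (fun r Hr => proj2 (HcM n r Hr))) as Dq.
    destruct (HdM n) as [Ep Eq].
    pose proof (Rabs_mult_le _ _ _ _ Dp Eq) as W1.
    pose proof (Rabs_mult_le _ _ _ _ Dq Ep) as W2.
    apply Rabs_le_between in W1. apply Rabs_le_between in W2.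
    assert (Hsum : fa ^ 2 + fb ^ 2 <= (Q * exp (- 2 * s * INR n)) ^ 2).
    { replace ((Q * exp (- 2 * s * INR n)) ^ 2) with
        (Q * Q * (exp (- 2 * s * INR n) * exp (- 2 * s * INR n))) by ring.
      rewrite <- exp_plus.
      replace (- 2 * s * INR n + - 2 * s * INR n) with (- (INR n / (2 * T)))
        by (unfold s; field; lra).
      unfold Q. rewrite sqrt_sqrt.
      2: { apply Rdiv_le_0_compat; [|lra]. apply Rmult_le_pos; lra. }
      apply Rmult_le_reg_l with k; trivial. rewrite <- HW.
      replace (k * (4 * M * M' / k * exp (- (INR n / (2 * T))))) with
        (4 * M * M' * exp (- (INR n / (2 * T)))) by (field; lra).
      lra. }
    assert (HQe : 0 <= Q * exp (- 2 * s * INR n)) by (apply Rmult_le_pos; lra).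
    assert (HQC : Q * exp (- 2 * s * INR n) <= C * exp (- 2 * s * INR n)).
    { apply Rmult_le_compat_r; [lra|]. unfold C. lra. }
    pose proof (pow2_ge_0 fa). pose proof (pow2_ge_0 fb).
    split; (eapply Rle_trans; [|exact HQC]).
    + apply Rsqr_incr_0_var; [|exact HQe]. rewrite <- Rsqr_abs. unfold Rsqr. nra.
    + apply Rsqr_incr_0_var; [|exact HQe]. rewrite <- Rsqr_abs. unfold Rsqr. nra.
  - assert (Hbd : forall g Cg, (forall t, 0 <= t <= PI -> continuous g t) ->
              (forall t, 0 <= t <= PI -> Rabs (g t) <= Cg) ->
              Rabs (RInt (fun t => g t * sin (INR n * t)) 0 PI) <= (PI - 0) * Cg).
    { intros g Cg Hg HCg. apply abs_RInt_le_const; [lra| |].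
      - apply ex_RInt_continuous_le; [lra|]. intros t Ht.
        apply continuous_Rmult; [now apply Hg|apply continuous_sin_scal].
      - intros t Ht. eapply Rle_trans; [apply Rabs_mult_sin_le|now apply HCg]. }
    assert (HCC : PI * (Ca + Cb) <= C * exp (- 2 * s * INR n)).
    { apply Rle_trans with (PI * (Ca + Cb) * exp (2 * s * (2 * k * T)) * exp (- 2 * s * INR n)).
      - rewrite Rmult_assoc, <- exp_plus.
        rewrite <- (Rmult_1_r (PI * (Ca + Cb))) at 1.
        apply Rmult_le_compat_l; [apply Rmult_le_pos; lra|].
        rewrite <- exp_0. left. apply exp_increasing. nra.
      - apply Rmult_le_compat_r; [lra|]. unfold C. lra. }
    assert (0 <= PI * Ca) by (apply Rmult_le_pos; lra).
    assert (0 <= PI * Cb) by (apply Rmult_le_pos; lra).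
    split; (eapply Rle_trans; [|exact HCC]).
    + eapply Rle_trans; [apply (Hbd a Ca); trivial; intros; now apply Hab|]. lra.
    + eapply Rle_trans; [apply (Hbd b Cb); trivial; intros; now apply Hab|]. lra.
Qed.

Lemma coef_zero_polar (f : R -> R -> R) (r : R) :
  0 < r -> (forall t, 0 <= t <= PI -> continuous (polar f r) t) ->
  (forall n, (1 <= n)%nat -> coef n f r = 0) ->
  forall t, 0 < t < PI -> polar f r t = 0.
Proof.
  intros Hr Hf Hc. apply sine_complete; trivial. intros n Hn.
  specialize (Hc n Hn). unfold coef in Hc.
  apply Rmult_integral in Hc. destruct Hc as [Hc|Hc]; trivial.
  pose proof (sqrt_lt_R0 r Hr). lra.
Qed.

(** Each mode then tends to zero, and the radiation condition makes its derivative tend to zero as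
    well. [bessel_rellich] applies because n^2 - 1/4 > 0 for n >= 1, and completeness of the sines
    recovers the field. *)
Lemma radiating_zero (k R0 : R) (p p1 p2 q q1 q2 : R -> R -> R) (a b : R -> R) :
  0 < k -> 0 <= R0 -> radiating k R0 p p1 p2 q q1 q2 a b ->
  (forall n, (1 <= n)%nat ->
     RInt (fun t => a t * sin (INR n * t)) 0 PI = 0 /\
     RInt (fun t => b t * sin (INR n * t)) 0 PI = 0) ->
  forall x y, exterior R0 x y -> p x y = 0 /\ q x y = 0.
Proof.
  intros Hk HR HU Hf. pose proof PI2_1 as HPI.
  assert (Hz : forall n, (1 <= n)%nat -> forall r, R0 < r ->
            coef n p r = 0 /\ coef n q r = 0).
  { intros n Hn. destruct (Hf n Hn) as [Ha Hb].
    destruct (radiating_coef k R0 p p1 p2 q q1 q2 a b n HR HU) as [Hode [Hs Hff]].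
    simpl in Hff. rewrite Ha, Hb in Hff.
    assert (Hn1 : 1 <= INR n) by (apply (le_INR 1); lia).
    assert (Lp : forall eps, 0 < eps -> exists r0, forall r, r0 < r ->
              Rabs (coef n p r) < eps /\ Rabs (coef n q r) < eps).
    { intros eps Heps. destruct (Hff (eps / 2) ltac:(lra)) as [r0 H0].
      exists r0. intros r Hr. destruct (H0 r Hr) as [A B].
      rewrite !Rmult_0_l, Rminus_diag, Rminus_0_r in A.
      rewrite !Rmult_0_l, Rplus_0_r, Rminus_0_r in B. lra. }
    assert (Lp' : forall eps, 0 < eps -> exists r0, forall r, r0 < r ->
              Rabs (Derive (coef n p) r) < eps /\ Rabs (Derive (coef n q) r) < eps).
    { intros eps Heps.
      assert (He : 0 < eps / (2 * (k + 2))) by (apply Rdiv_lt_0_compat; lra).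
      assert (Hee : eps / (2 * (k + 2)) * (2 * (k + 2)) = eps) by (field; lra).
      set (e := eps / (2 * (k + 2))) in *. clearbody e.
      destruct (Lp e He) as [r1 H1]. destruct (Hs e He) as [r2 H2].
      exists (Rmax (Rmax r1 r2) 1). intros r Hr.
      pose proof (Rmax_l (Rmax r1 r2) 1). pose proof (Rmax_r (Rmax r1 r2) 1).
      pose proof (Rmax_l r1 r2). pose proof (Rmax_r r1 r2).
      destruct (H1 r ltac:(lra)) as [A B]. destruct (H2 r ltac:(lra)) as [C D].
      assert (Hi : Rabs (/ (2 * r)) <= 1).
      { rewrite Rabs_pos_eq by (left; apply Rinv_0_lt_compat; lra).
        rewrite <- Rinv_1. apply Rinv_le_contravar; lra. }
      assert (Hkk : Rabs k <= k) by (rewrite Rabs_pos_eq; lra).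
      set (x := coef n p r) in *. set (y := coef n q r) in *.
      pose proof (Rabs_mult_le x _ e 1 ltac:(lra) Hi) as X1.
      pose proof (Rabs_mult_le y _ e 1 ltac:(lra) Hi) as Y1.
      pose proof (Rabs_mult_le k x k e Hkk ltac:(lra)) as X2.
      pose proof (Rabs_mult_le k y k e Hkk ltac:(lra)) as Y2.
      unfold Rdiv in C, D.
      apply Rabs_le_between in C. apply Rabs_le_between in D.
      apply Rabs_le_between in X1. apply Rabs_le_between in Y1.
      apply Rabs_le_between in X2. apply Rabs_le_between in Y2.
      split; apply Rabs_def1; lra. }
    intros r Hr. split.
    - apply (bessel_rellich (coef n p) (Derive (coef n p)) (INR n ^ 2 - 1 / 4) k R0);
        trivial; [nra|intros s Hs'; now destruct (Hode s Hs') as [? [? [? ?]]]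
          |intros s Hs'; now destruct (Hode s Hs') as [? [? [? ?]]]| |].
      + intros eps Heps. destruct (Lp eps Heps) as [r0 H0]. exists r0.
        intros s Hs'. now destruct (H0 s Hs').
      + intros eps Heps. destruct (Lp' eps Heps) as [r0 H0]. exists r0.
        intros s Hs'. now destruct (H0 s Hs').
    - apply (bessel_rellich (coef n q) (Derive (coef n q)) (INR n ^ 2 - 1 / 4) k R0);
        trivial; [nra|intros s Hs'; now destruct (Hode s Hs') as [? [? [? ?]]]
          |intros s Hs'; now destruct (Hode s Hs') as [? [? [? ?]]]| |].
      + intros eps Heps. destruct (Lp eps Heps) as [r0 H0]. exists r0.
        intros s Hs'. now destruct (H0 s Hs').
      + intros eps Heps. destruct (Lp' eps Heps) as [r0 H0]. exists r0.
        intros s Hs'. now destruct (H0 s Hs'). }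
  intros x y [Hy Hxy].
  destruct (polar_coordinates x y Hy) as [r [t [Hr [Ht [-> [-> [Hr2 _]]]]]]].
  assert (HrR : R0 < r) by nra.
  destruct HU as [_ [Hd _]].
  split.
  - apply (coef_zero_polar p r); trivial; [|intros n Hn; now destruct (Hz n Hn r HrR)].
    intros s _. apply (polar_continuous p R0 (r + 1)); [lra|lra|].
    intros; now apply (proj1 (Hd (r + 1))).
  - apply (coef_zero_polar q r); trivial; [|intros n Hn; now destruct (Hz n Hn r HrR)].
    intros s _. apply (polar_continuous q R0 (r + 1)); [lra|lra|].
    intros; now apply (proj2 (Hd (r + 1))).
Qed.

Lemma radiating_arc_zero (k R0 t1 t2 : R) (p p1 p2 q q1 q2 : R -> R -> R)
  (a b : R -> R) :
  0 < k -> 0 <= R0 -> radiating k R0 p p1 p2 q q1 q2 a b ->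
  0 <= t1 -> t1 < t2 -> t2 <= PI ->
  (forall t, t1 < t < t2 -> a t = 0 /\ b t = 0) ->
  forall x y, exterior R0 x y -> p x y = 0 /\ q x y = 0.
Proof.
  intros Hk HR HU Ht1 Ht Ht2 Hz. pose proof PI2_1 as HPI.
  destruct (radiating_far_decay k R0 p p1 p2 q q1 q2 a b Hk HR HU)
    as [C [s [Hs HC]]].
  pose proof HU as [_ [_ [Hab _]]].
  assert (Ha : forall t, 0 < t < PI -> a t = 0).
  { apply (sine_coefficients_identity a C s t1 t2); trivial.
    - intros; now apply Hab.
    - intros n Hn. exact (proj1 (HC n Hn)).
    - intros t Ht'. exact (proj1 (Hz t Ht')). }
  assert (Hb : forall t, 0 < t < PI -> b t = 0).
  { apply (sine_coefficients_identity b C s t1 t2); trivial.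
    - intros; now apply Hab.
    - intros n Hn. exact (proj2 (HC n Hn)).
    - intros t Ht'. exact (proj2 (Hz t Ht')). }
  apply (radiating_zero k R0 p p1 p2 q q1 q2 a b); trivial.
  assert (H0 : forall g n, (forall t, 0 < t < PI -> g t = 0) ->
            RInt (fun t => g t * sin (INR n * t)) 0 PI = 0).
  { intros g n Hg. rewrite (RInt_ext _ (fun _ => 0)).
    - rewrite RInt_const. apply Rmult_0_r.
    - rewrite Rmin_left, Rmax_right by lra. intros t Ht'. rewrite Hg by trivial. Rring. }
  intros n _. split; now apply H0.
Qed.

(** Every sine coefficient solves a linear second-order equation on (0, rho) and vanishes near 0,
    hence vanishes throughout: uniqueness for ordinary differential equations stands in for
    analyticity of solutions. *)
Lemma half_disk_unique_continuation (k rho d : R) (f f1 f2 : R -> R -> R) :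
  0 < d -> helmholtz k (half_annulus 0 rho) f f1 f2 -> dirichlet_half 0 rho f ->
  (forall x y, 0 < x ^ 2 + y ^ 2 < d ^ 2 -> f x y = 0) ->
  forall x y, 0 < y -> x ^ 2 + y ^ 2 < rho ^ 2 -> 0 < rho -> f x y = 0.
Proof.
  intros Hd Hf HD Hz x y Hy Hxy Hrho. pose proof PI2_1 as HPI.
  destruct (polar_coordinates x y Hy) as [r [t [Hr [Ht [-> [-> [Hr2 _]]]]]]].
  assert (Hrr : 0 < r < rho) by nra.
  apply (coef_zero_polar f r); trivial.
  { intros s _. apply (polar_continuous f 0 rho); trivial; [lra|].
    intros; now apply HD. }
  intros n Hn.
  assert (Hc0 : forall s, 0 < s < d -> coef n f s = 0).
  { intros s Hs. unfold coef. rewrite (RInt_ext _ (fun _ => 0)).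
    - rewrite RInt_const. unfold scal; simpl; unfold mult; simpl. ring.
    - intros u _. unfold polar. rewrite Hz; [Rring|].
      rewrite polar_norm. split; nra. }
  set (x0 := Rmin d rho / 2).
  pose proof (Rmin_l d rho). pose proof (Rmin_r d rho).
  assert (Hmin : 0 < Rmin d rho) by now apply Rmin_glb_lt.
  apply (ode_unique (coef n f) (Derive (coef n f)) (bessel_potential k n) 0 rho x0);
    trivial.
  - unfold x0; lra.
  - intros s Hs. exact (proj1 (coef_ode k n 0 rho f f1 f2 (Rle_refl 0) Hf HD s Hs)).
  - intros s Hs. exact (proj2 (coef_ode k n 0 rho f f1 f2 (Rle_refl 0) Hf HD s Hs)).
  - intros c e Hc _. now apply bessel_potential_bounded.
  - apply Hc0. unfold x0; lra.
  - rewrite (Derive_ext_loc _ (fun _ => 0)); [apply Derive_const|].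
    apply (locally_interval _ x0 0 d); [simpl; unfold x0; lra|simpl; unfold x0; lra|].
    intros s Hs1 Hs2. apply Hc0. now split.
Qed.

(** * Interior gradient bound *)

(** If the supremum [S] were not attained, 1 / (S - f) would be continuous, hence bounded, and [S]
    could be lowered. *)
Lemma continuity_2d_attains_max (f : R -> R -> R) (a b c d : R) :
  a <= b -> c <= d ->
  (forall x y, a <= x <= b -> c <= y <= d -> continuity_2d_pt f x y) ->
  exists x0 y0, a <= x0 <= b /\ c <= y0 <= d /\
    forall x y, a <= x <= b -> c <= y <= d -> f x y <= f x0 y0.
Proof.
  intros Hab Hcd Hf.
  destruct (continuity_2d_bounded f a b c d Hab Hcd Hf) as [M [_ HM]].
  destruct (completeness (fun z => exists x y, a <= x <= b /\ c <= y <= d /\ z = f x y))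
    as [S [HS1 HS2]].
  - exists M. intros z [x [y [Hx [Hy ->]]]]. specialize (HM x y Hx Hy).
    apply Rabs_le_between in HM. lra.
  - exists (f a c), a, c. repeat split; lra.
  - assert (HfS : forall x y, a <= x <= b -> c <= y <= d -> f x y <= S).
    { intros x y Hx Hy. apply HS1. now exists x, y. }
    destruct (classic (exists x y, a <= x <= b /\ c <= y <= d /\ f x y = S))
      as [[x0 [y0 [Hx0 [Hy0 E]]]]|Hno].
    + exists x0, y0. repeat split; try lra. intros x y Hx Hy. rewrite E. auto.
    + exfalso.
      assert (Hlt : forall x y, a <= x <= b -> c <= y <= d -> 0 < S - f x y).
      { intros x y Hx Hy. destruct (HfS x y Hx Hy) as [|E]; [lra|].
        exfalso. apply Hno. now exists x, y. }
      destruct (continuity_2d_bounded (fun x y => / (S - f x y)) a b c d Hab Hcd)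
        as [K [HK HKb]].
      { intros x y Hx Hy. apply continuity_2d_pt_inv.
        - apply continuity_2d_pt_minus; [apply continuity_2d_pt_const|auto].
        - specialize (Hlt x y Hx Hy). lra. }
      assert (HSK : S <= S - / (K + 1)).
      { apply HS2. intros z [x [y [Hx [Hy ->]]]].
        specialize (HKb x y Hx Hy). specialize (Hlt x y Hx Hy).
        rewrite Rabs_pos_eq in HKb by (left; now apply Rinv_0_lt_compat).
        assert (/ (K + 1) <= S - f x y); [|lra].
        rewrite <- (Rinv_inv (S - f x y)). apply Rinv_le_contravar; [|lra].
        now apply Rinv_0_lt_compat. }
      assert (0 < / (K + 1)) by (apply Rinv_0_lt_compat; lra). lra.
Qed.

(** At an interior maximum both pure second derivatives would be nonpositive, against the positive
    Laplacian. *)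
Lemma strict_maximum_principle (g gx gy gxx gyy : R -> R -> R) (a b c d : R) :
  a < b -> c < d ->
  (forall x y, a <= x <= b -> c <= y <= d -> continuity_2d_pt g x y) ->
  (forall x y, a < x < b -> c < y < d ->
     is_derive (fun t => g t y) x (gx x y) /\ is_derive (fun t => gx t y) x (gxx x y) /\
     is_derive (fun t => g x t) y (gy x y) /\ is_derive (fun t => gy x t) y (gyy x y) /\
     0 < gxx x y + gyy x y) ->
  (forall x y, a <= x <= b -> c <= y <= d -> (x = a \/ x = b \/ y = c \/ y = d) ->
     g x y <= 0) ->
  forall x y, a <= x <= b -> c <= y <= d -> g x y <= 0.
Proof.
  intros Hab Hcd Hc Hg Hbd x y Hx Hy.
  destruct (continuity_2d_attains_max g a b c d) as [x0 [y0 [Hx0 [Hy0 Hmax]]]];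
    trivial; try lra.
  apply Rle_trans with (g x0 y0); [auto|].
  destruct (Req_dec x0 a) as [|N1]; [apply Hbd; tauto|].
  destruct (Req_dec x0 b) as [|N2]; [apply Hbd; tauto|].
  destruct (Req_dec y0 c) as [|N3]; [apply Hbd; tauto|].
  destruct (Req_dec y0 d) as [|N4]; [apply Hbd; tauto|].
  exfalso.
  assert (Hx1 : gxx x0 y0 <= 0).
  { set (e := Rmin (x0 - a) (b - x0)).
    pose proof (Rmin_l (x0 - a) (b - x0)). pose proof (Rmin_r (x0 - a) (b - x0)).
    apply (second_derivative_at_max (fun t => g t y0) (fun t => gx t y0) x0 _ e).
    - apply Rmin_glb_lt; lra.
    - intros t Ht. apply Rabs_def2 in Ht. apply Hg; unfold e in Ht; lra.
    - apply Hg; lra.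
    - intros t Ht. apply Rabs_def2 in Ht. apply Hmax; unfold e in Ht; lra. }
  assert (Hy1 : gyy x0 y0 <= 0).
  { set (e := Rmin (y0 - c) (d - y0)).
    pose proof (Rmin_l (y0 - c) (d - y0)). pose proof (Rmin_r (y0 - c) (d - y0)).
    apply (second_derivative_at_max (g x0) (gy x0) y0 _ e).
    - apply Rmin_glb_lt; lra.
    - intros t Ht. apply Rabs_def2 in Ht. apply Hg; unfold e in Ht; lra.
    - apply Hg; lra.
    - intros t Ht. apply Rabs_def2 in Ht. apply Hmax; unfold e in Ht; lra. }
  destruct (Hg x0 y0 ltac:(lra) ltac:(lra)) as [_ [_ [_ [_ Hp]]]]. lra.
Qed.

(* Barrier argument for the odd part of [f] in [y] on the upper half of the
   square (Gilbarg-Trudinger, Section 3.4). *)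
Lemma gradient_bound_origin (f fx fy fxx fyy : R -> R -> R) (d M N : R) :
  0 < d ->
  (forall x y, - d <= x <= d -> - d <= y <= d ->
     continuity_2d_pt f x y /\
     is_derive (fun t => f t y) x (fx x y) /\ is_derive (fun t => fx t y) x (fxx x y) /\
     is_derive (fun t => f x t) y (fy x y) /\ is_derive (fun t => fy x t) y (fyy x y) /\
     Rabs (f x y) <= M /\ Rabs (fxx x y + fyy x y) <= N) ->
  fy 0 0 <= 2 * M / d + (N + 1) * d / 2.
Proof.
  intros Hd Hf.
  assert (HM : 0 <= M).
  { eapply Rle_trans; [apply Rabs_pos|apply (Hf 0 0); lra]. }
  set (A := M / d ^ 2). assert (Hd2 : 0 < d ^ 2) by (apply pow_lt; lra).
  assert (HA : 0 <= A) by (apply Rdiv_le_0_compat; lra).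
  assert (HAM : A * d ^ 2 = M) by (unfold A; field; lra).
  assert (HAd : 2 * M / d = 2 * A * d) by (unfold A; field; lra).
  rewrite HAd. clearbody A.
  assert (HN : 0 <= N).
  { eapply Rle_trans; [apply Rabs_pos|apply (Hf 0 0); lra]. }
  (* The first term is harmonic and at least [M] on the sides and the top of the rectangle. The
     second has Laplacian - (N + 1), which makes [g] strictly subharmonic. The slope of the sum at
     the origin in y is the bound to be proved. *)
  set (bar := fun x y : R => A * (x ^ 2 + y * (2 * d - y)) + (N + 1) * (y * (d - y)) / 2).
  set (g := fun x y => (f x y - f x (- y)) / 2 - bar x y).
  assert (Hneg : forall (h h' : R -> R) y, is_derive h (- y) (h' (- y)) ->
            is_derive (fun t => h (- t)) y (- h' (- y))).
  { intros h h' y Hh. evar_last.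
    - apply (is_derive_comp h (fun t => - t)); [exact Hh|].
      instantiate (1 := -1). auto_derive; trivial; ring.
    - unfold scal; simpl; unfold mult; simpl. ring. }
  assert (Hg : forall x y, - d <= x <= d -> 0 <= y <= d -> g x y <= 0).
  { apply (strict_maximum_principle g
      (fun x y => (fx x y - fx x (- y)) / 2 - A * (2 * x))
      (fun x y => (fy x y + fy x (- y)) / 2
                  - (A * (2 * d - 2 * y) + (N + 1) * (d - 2 * y) / 2))
      (fun x y => (fxx x y - fxx x (- y)) / 2 - A * 2)
      (fun x y => (fyy x y - fyy x (- y)) / 2 - (A * - 2 - (N + 1)))); try lra.
    - intros x y Hx Hy. unfold g.
      apply continuity_2d_pt_minus.
      + apply continuity_2d_pt_mult; [|apply continuity_2d_pt_const].
        apply continuity_2d_pt_minus; [apply Hf; lra|].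
        apply (continuity_2d_comp f (fun x y => x) (fun x y => - y)).
        * apply Hf; lra.
        * apply continuity_2d_pt_id1.
        * apply continuity_2d_pt_opp, continuity_2d_pt_id2.
      + unfold bar. apply continuity_2d_pt_plus.
        * apply continuity_2d_pt_mult; [apply continuity_2d_pt_const|].
          apply continuity_2d_pt_plus.
          { apply (continuity_2d_fst (fun x => x ^ 2)).
            apply @ex_derive_continuous; auto_derive; trivial. }
          { apply (continuity_2d_snd (fun y => y * (2 * d - y))).
            apply @ex_derive_continuous; auto_derive; trivial. }
        * apply (continuity_2d_snd (fun y => (N + 1) * (y * (d - y)) / 2)).
          apply @ex_derive_continuous; auto_derive; trivial.
    - intros x y Hx Hy.
      destruct (Hf x y ltac:(lra) ltac:(lra)) as [_ [D1 [D2 [D3 [D4 [_ B1]]]]]].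
      destruct (Hf x (- y) ltac:(lra) ltac:(lra)) as [_ [E1 [E2 [E3 [E4 [_ B2]]]]]].
      assert (Hhalf : forall (u v : R -> R) z u' v', is_derive u z u' -> is_derive v z v' ->
                is_derive (fun t => (u t - v t) / 2) z ((u' - v') / 2)).
      { intros u v z u' v' Hu Hv.
        apply (is_derive_ext (fun t => / 2 * (u t - v t))).
        - intros t. Rfield.
        - replace ((u' - v') / 2) with (/ 2 * (u' - v')) by field.
          apply is_derive_scal. now apply @is_derive_minus. }
      refine (conj _ (conj _ (conj _ (conj _ _)))).
      + unfold g. apply @is_derive_minus; [now apply Hhalf|].
        unfold bar. auto_derive; trivial. ring.
      + apply @is_derive_minus; [now apply Hhalf|]. auto_derive; trivial. ring.
      + unfold g. apply @is_derive_minus.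
        * replace (fy x y + fy x (- y)) with (fy x y - - fy x (- y)) by ring.
          apply (Hhalf (f x) (fun t => f x (- t))); trivial.
          now apply (Hneg (f x) (fy x)).
        * unfold bar. auto_derive; trivial. field.
      + apply @is_derive_minus.
        * apply (is_derive_ext (fun t => (fy x t - - fy x (- t)) / 2)).
          { intros t. Rfield. }
          replace (fyy x y - fyy x (- y)) with (fyy x y - - - fyy x (- y)) by ring.
          apply (Hhalf (fy x) (fun t => - fy x (- t))); trivial.
          apply (is_derive_opp (fun t => fy x (- t)) y (- fyy x (- y))).
          now apply (Hneg (fy x) (fyy x)).
        * auto_derive; trivial. field.
      + apply Rabs_le_between in B1. apply Rabs_le_between in B2. lra.
    - intros x y Hx Hy Hbd. unfold g, bar.
      destruct (Hf x y ltac:(lra) ltac:(lra)) as [_ [_ [_ [_ [_ [B1 _]]]]]].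
      destruct (Hf x (- y) ltac:(lra) ltac:(lra)) as [_ [_ [_ [_ [_ [B2 _]]]]]].
      apply Rabs_le_between in B1. apply Rabs_le_between in B2.
      assert (HNy : 0 <= (N + 1) * (y * (d - y)) / 2).
      { assert (0 <= y * (d - y)) by (apply Rmult_le_pos; lra). nra. }
      assert (Hy2 : 0 <= y * (2 * d - y)) by (apply Rmult_le_pos; lra).
      destruct Hbd as [-> | [-> | [-> | ->]]].
      + assert (A * d ^ 2 <= A * ((- d) ^ 2 + y * (2 * d - y))); [|lra].
        apply Rmult_le_compat_l; [trivial|]. replace ((- d) ^ 2) with (d ^ 2) by ring. lra.
      + assert (A * d ^ 2 <= A * (d ^ 2 + y * (2 * d - y))); [|lra].
        apply Rmult_le_compat_l; [trivial|]. lra.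
      + rewrite Ropp_0. assert (0 <= A * (x ^ 2 + 0 * (2 * d - 0))); [|lra].
        apply Rmult_le_pos; [trivial|]. pose proof (pow2_ge_0 x). lra.
      + assert (A * d ^ 2 <= A * (x ^ 2 + d * (2 * d - d))); [|lra].
        apply Rmult_le_compat_l; [trivial|]. pose proof (pow2_ge_0 x). nra. }
  (* On the axis x = 0 the barrier is at most [L * y], so a larger slope of the odd part at 0 would
     break [g <= 0] for small y. *)
  apply Rnot_lt_le; intros Hlt.
  set (L := 2 * A * d + (N + 1) * d / 2) in *.
  destruct (is_derive_increasing_right (fun y => (f 0 y - f 0 (- y)) / 2 - L * y) 0
    (fy 0 0 - L)) as [e [He Hinc]].
  - apply (is_derive_ext (fun y => / 2 * (f 0 y - f 0 (- y)) - L * y)).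
    { intros t. Rfield. }
    destruct (Hf 0 0 ltac:(lra) ltac:(lra)) as [_ [_ [_ [D3 _]]]].
    apply @is_derive_minus.
    + replace (fy 0 0) with (/ 2 * (fy 0 0 - - fy 0 (- 0))) by (rewrite Ropp_0; field).
      apply is_derive_scal. apply @is_derive_minus; trivial.
      apply (Hneg (f 0) (fy 0)). now rewrite Ropp_0.
    + auto_derive; trivial; ring.
  - lra.
  - set (y := Rmin (e / 2) d).
    assert (Hy0 : 0 < y) by (apply Rmin_glb_lt; lra).
    assert (Hyd : y <= d) by apply Rmin_r.
    assert (Hye : y <= e / 2) by apply Rmin_l. clearbody y.
    specialize (Hinc y ltac:(lra)). rewrite Ropp_0, Rmult_0_r in Hinc.
    specialize (Hg 0 y ltac:(lra) ltac:(lra)). unfold g, bar in Hg.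
    assert (A * (0 ^ 2 + y * (2 * d - y)) <= A * (2 * d * y)).
    { apply Rmult_le_compat_l; nra. }
    assert ((N + 1) * (y * (d - y)) / 2 <= (N + 1) * (y * d) / 2).
    { apply Rmult_le_compat_r; [lra|]. apply Rmult_le_compat_l; nra. }
    unfold L in Hinc. lra.
Qed.

Lemma is_derive_shift (f : R -> R) (c x l : R) :
  is_derive f (c + x) l -> is_derive (fun t => f (c + t)) x l.
Proof.
  intros Hf. evar_last.
  - apply (is_derive_comp f (fun t => c + t)); [exact Hf|].
    instantiate (1 := 1). auto_derive; trivial.
  - unfold scal; simpl; unfold mult; simpl. ring.
Qed.

Lemma continuity_2d_shift (f : R -> R -> R) (a b x y : R) :
  continuity_2d_pt f (a + x) (b + y) ->
  continuity_2d_pt (fun u v => f (a + u) (b + v)) x y.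
Proof.
  intros Hf. apply (continuity_2d_comp f (fun u _ => a + u) (fun _ v => b + v)); trivial.
  - apply continuity_2d_pt_plus; [apply continuity_2d_pt_const|apply continuity_2d_pt_id1].
  - apply continuity_2d_pt_plus; [apply continuity_2d_pt_const|apply continuity_2d_pt_id2].
Qed.

(** The Laplacian is - k^2 f, hence bounded by k^2 M. The one-sided bound at the origin is used for
    [f] and its negative, and with the two coordinates exchanged for [f1]. *)
Lemma helmholtz_gradient_bound (k d M x0 y0 : R) (D : R -> R -> Prop)
  (f f1 f2 : R -> R -> R) :
  0 < d -> open_2d D -> helmholtz k D f f1 f2 ->
  (forall x y, Rabs (x - x0) <= d -> Rabs (y - y0) <= d -> D x y /\ Rabs (f x y) <= M) ->
  Rabs (f1 x0 y0) <= 2 * M / d + (k ^ 2 * M + 1) * d / 2 /\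
  Rabs (f2 x0 y0) <= 2 * M / d + (k ^ 2 * M + 1) * d / 2.
Proof.
  intros Hd HO [f11 [f12 [f21 [f22 Hf]]]] HD.
  assert (HDs : forall x y, - d <= x <= d -> - d <= y <= d ->
            D (x0 + x) (y0 + y) /\ Rabs (f (x0 + x) (y0 + y)) <= M).
  { intros x y Hx Hy. apply HD; apply Rabs_le; lra. }
  assert (Hlap : forall x y, - d <= x <= d -> - d <= y <= d ->
            Rabs (f11 (x0 + x) (y0 + y) + f22 (x0 + x) (y0 + y)) <= k ^ 2 * M).
  { intros x y Hx Hy. destruct (HDs x y Hx Hy) as [HDxy HM].
    destruct (Hf _ _ HDxy) as [_ [_ [_ E]]].
    replace (f11 (x0 + x) (y0 + y) + f22 (x0 + x) (y0 + y))
      with (- (k ^ 2 * f (x0 + x) (y0 + y))) by lra.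
    rewrite Rabs_Ropp, Rabs_mult, (Rabs_pos_eq (k ^ 2)) by apply pow2_ge_0.
    apply Rmult_le_compat_l; [apply pow2_ge_0|exact HM]. }
  assert (Hcf : forall x y, - d <= x <= d -> - d <= y <= d ->
            continuity_2d_pt f (x0 + x) (y0 + y)).
  { intros x y Hx Hy. apply (C1_continuity D f f1 f2); trivial.
    - intros u v Huv. now apply Hf.
    - now apply HDs. }
  assert (Hopp : forall s, s = 1 \/ s = -1 ->
    s * f2 (x0 + 0) (y0 + 0) <= 2 * M / d + (k ^ 2 * M + 1) * d / 2 /\
    s * f1 (x0 + 0) (y0 + 0) <= 2 * M / d + (k ^ 2 * M + 1) * d / 2).
  { intros s Hs.
    assert (Hss : forall z, Rabs (s * z) = Rabs z).
    { intros z. rewrite Rabs_mult.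
      destruct Hs as [->| ->]; rewrite ?Rabs_R1, ?Rabs_m1; ring. }
    split.
    - apply (gradient_bound_origin (fun x y => s * f (x0 + x) (y0 + y))
        (fun x y => s * f1 (x0 + x) (y0 + y)) (fun x y => s * f2 (x0 + x) (y0 + y))
        (fun x y => s * f11 (x0 + x) (y0 + y)) (fun x y => s * f22 (x0 + x) (y0 + y))
        d M (k ^ 2 * M) Hd).
      intros x y Hx Hy.
      destruct (HDs x y Hx Hy) as [HDxy HM].
      destruct (Hf _ _ HDxy) as [[A1 [A2 _]] [[A3 _] [[_ [A4 _]] _]]].
      refine (conj _ (conj _ (conj _ (conj _ (conj _ (conj _ _)))))).
      + apply continuity_2d_pt_mult; [apply continuity_2d_pt_const|].
        now apply (continuity_2d_shift f), Hcf.
      + apply is_derive_scal. now apply (is_derive_shift (fun t => f t (y0 + y))).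
      + apply is_derive_scal. now apply (is_derive_shift (fun t => f1 t (y0 + y))).
      + apply is_derive_scal. now apply (is_derive_shift (fun t => f (x0 + x) t)).
      + apply is_derive_scal. now apply (is_derive_shift (fun t => f2 (x0 + x) t)).
      + now rewrite Hss.
      + rewrite <- Rmult_plus_distr_l, Hss. now apply Hlap.
    - apply (gradient_bound_origin (fun y x => s * f (x0 + x) (y0 + y))
        (fun y x => s * f2 (x0 + x) (y0 + y)) (fun y x => s * f1 (x0 + x) (y0 + y))
        (fun y x => s * f22 (x0 + x) (y0 + y)) (fun y x => s * f11 (x0 + x) (y0 + y))
        d M (k ^ 2 * M) Hd).
      intros y x Hy Hx.
      destruct (HDs x y Hx Hy) as [HDxy HM].
      destruct (Hf _ _ HDxy) as [[A1 [A2 _]] [[A3 _] [[_ [A4 _]] _]]].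
      refine (conj _ (conj _ (conj _ (conj _ (conj _ (conj _ _)))))).
      + apply continuity_2d_pt_mult; [apply continuity_2d_pt_const|].
        apply (continuity_2d_comp f (fun _ v => x0 + v) (fun u _ => y0 + u)).
        * now apply Hcf.
        * apply continuity_2d_pt_plus;
            [apply continuity_2d_pt_const|apply continuity_2d_pt_id2].
        * apply continuity_2d_pt_plus;
            [apply continuity_2d_pt_const|apply continuity_2d_pt_id1].
      + apply is_derive_scal. now apply (is_derive_shift (fun t => f (x0 + x) t)).
      + apply is_derive_scal. now apply (is_derive_shift (fun t => f2 (x0 + x) t)).
      + apply is_derive_scal. now apply (is_derive_shift (fun t => f t (y0 + y))).
      + apply is_derive_scal. now apply (is_derive_shift (fun t => f1 t (y0 + y))).
      + now rewrite Hss.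
      + rewrite <- Rmult_plus_distr_l, Hss, Rplus_comm. now apply Hlap. }
  destruct (Hopp 1 (or_introl eq_refl)) as [P2 P1].
  destruct (Hopp (-1) (or_intror eq_refl)) as [N2 N1].
  rewrite !Rplus_0_r in P1, P2, N1, N2.
  split; apply Rabs_le; lra.
Qed.

(** * Complex-valued solutions *)

Lemma helmholtz_lin (k a b : R) (D : R -> R -> Prop) (f f1 f2 g g1 g2 : R -> R -> R) :
  helmholtz k D f f1 f2 -> helmholtz k D g g1 g2 ->
  helmholtz k D (fun x y => a * f x y + b * g x y)
    (fun x y => a * f1 x y + b * g1 x y) (fun x y => a * f2 x y + b * g2 x y).
Proof.
  intros [f11 [f12 [f21 [f22 Hf]]]] [g11 [g12 [g21 [g22 Hg]]]].
  assert (HC : forall u u1 u2 v v1 v2 x y, C1_at u u1 u2 x y -> C1_at v v1 v2 x y ->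
    C1_at (fun x y => a * u x y + b * v x y) (fun x y => a * u1 x y + b * v1 x y)
      (fun x y => a * u2 x y + b * v2 x y) x y).
  { intros u u1 u2 v v1 v2 x y [A1 [A2 [A3 A4]]] [B1 [B2 [B3 B4]]].
    refine (conj _ (conj _ (conj _ _))).
    - apply @is_derive_plus; now apply is_derive_scal.
    - apply @is_derive_plus; now apply is_derive_scal.
    - apply continuity_2d_pt_plus; apply continuity_2d_pt_mult; trivial;
        apply continuity_2d_pt_const.
    - apply continuity_2d_pt_plus; apply continuity_2d_pt_mult; trivial;
        apply continuity_2d_pt_const. }
  eexists _, _, _, _. intros x y Hxy.
  destruct (Hf x y Hxy) as [A [A1 [A2 A3]]]. destruct (Hg x y Hxy) as [B [B1 [B2 B3]]].
  refine (conj (HC _ _ _ _ _ _ _ _ A B)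
    (conj (HC _ _ _ _ _ _ _ _ A1 B1) (conj (HC _ _ _ _ _ _ _ _ A2 B2) _))).
  cbv beta.
  replace (a * f11 x y + b * g11 x y + (a * f22 x y + b * g22 x y) +
    k ^ 2 * (a * f x y + b * g x y)) with
    (a * (f11 x y + f22 x y + k ^ 2 * f x y) + b * (g11 x y + g22 x y + k ^ 2 * g x y))
    by ring.
  rewrite A3, B3. ring.
Qed.

Lemma helmholtz_shift (k a b : R) (D : R -> R -> Prop) (f f1 f2 : R -> R -> R) :
  helmholtz k D f f1 f2 ->
  helmholtz k (fun x y => D (a + x) (b + y)) (fun x y => f (a + x) (b + y))
    (fun x y => f1 (a + x) (b + y)) (fun x y => f2 (a + x) (b + y)).
Proof.
  intros [f11 [f12 [f21 [f22 Hf]]]].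
  assert (HC : forall u u1 u2 x y, C1_at u u1 u2 (a + x) (b + y) ->
    C1_at (fun x y => u (a + x) (b + y)) (fun x y => u1 (a + x) (b + y))
      (fun x y => u2 (a + x) (b + y)) x y).
  { intros u u1 u2 x y [A1 [A2 [A3 A4]]]. refine (conj _ (conj _ (conj _ _))).
    - now apply (is_derive_shift (fun t => u t (b + y))).
    - now apply (is_derive_shift (fun t => u (a + x) t)).
    - now apply (continuity_2d_shift u1).
    - now apply (continuity_2d_shift u2). }
  exists (fun x y => f11 (a + x) (b + y)), (fun x y => f12 (a + x) (b + y)),
    (fun x y => f21 (a + x) (b + y)), (fun x y => f22 (a + x) (b + y)).
  intros x y Hxy. destruct (Hf _ _ Hxy) as [A [A1 [A2 A3]]].
  exact (conj (HC _ _ _ _ _ A) (conj (HC _ _ _ _ _ A1) (conj (HC _ _ _ _ _ A2) A3))).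
Qed.

Lemma helmholtz_reflect (k : R) (D : R -> R -> Prop) (f f1 f2 : R -> R -> R) :
  helmholtz k D f f1 f2 ->
  helmholtz k (fun x y => D x (- y)) (fun x y => f x (- y))
    (fun x y => f1 x (- y)) (fun x y => - f2 x (- y)).
Proof.
  intros [f11 [f12 [f21 [f22 Hf]]]].
  assert (Hn : forall (h : R -> R) y l, is_derive h (- y) l ->
            is_derive (fun t => h (- t)) y (- l)).
  { intros h y l Hh. evar_last.
    - apply (is_derive_comp h (fun t => - t)); [exact Hh|].
      instantiate (1 := -1). auto_derive; trivial; ring.
    - unfold scal; simpl; unfold mult; simpl. ring. }
  assert (Hc : forall h x y, continuity_2d_pt h x (- y) ->
            continuity_2d_pt (fun u v => h u (- v)) x y).
  { intros h x y Hh. apply (continuity_2d_comp h (fun u _ => u) (fun _ v => - v)); trivial.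
    - apply continuity_2d_pt_id1.
    - apply continuity_2d_pt_opp, continuity_2d_pt_id2. }
  exists (fun x y => f11 x (- y)), (fun x y => - f12 x (- y)),
    (fun x y => - f21 x (- y)), (fun x y => f22 x (- y)).
  intros x y Hxy.
  destruct (Hf _ _ Hxy) as [[A1 [A2 [A3 A4]]] [[B1 [B2 [B3 B4]]] [[C1 [C2 [C3 C4]]] E]]].
  refine (conj _ (conj _ (conj _ E))); refine (conj _ (conj _ (conj _ _)));
    trivial; try (now apply Hc); try (now apply continuity_2d_pt_opp, Hc).
  - now apply Hn.
  - now apply Hn.
  - apply (is_derive_opp (fun t => f2 t (- y))). exact C1.
  - rewrite <- (Ropp_involutive (f22 x (- y))).
    apply (is_derive_opp (fun t => f2 x (- t))). now apply Hn.
Qed.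

Lemma C1_at_ext (D : R -> R -> Prop) (f g f1 f2 : R -> R -> R) (x y : R) :
  open_2d D -> (forall u v, D u v -> f u v = g u v) -> D x y ->
  C1_at f f1 f2 x y -> C1_at g f1 f2 x y.
Proof.
  intros HD Hfg Hxy [A1 [A2 [A3 A4]]]. pose proof (HD x y Hxy) as HL.
  refine (conj _ (conj _ (conj A3 A4))).
  - apply (is_derive_ext_loc (fun t => f t y)); [|exact A1].
    apply locally_2d_1d_const_y in HL. revert HL. apply filter_imp.
    intros t Ht. now apply Hfg.
  - apply (is_derive_ext_loc (fun t => f x t)); [|exact A2].
    apply locally_2d_1d_const_x in HL. revert HL. apply filter_imp.
    intros t Ht. now apply Hfg.
Qed.

Lemma helmholtz_ext (k : R) (D : R -> R -> Prop) (f g f1 f2 : R -> R -> R) :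
  open_2d D -> (forall x y, D x y -> f x y = g x y) ->
  helmholtz k D f f1 f2 -> helmholtz k D g f1 f2.
Proof.
  intros HD Hfg [f11 [f12 [f21 [f22 Hf]]]]. exists f11, f12, f21, f22.
  intros x y Hxy. destruct (Hf x y Hxy) as [A [B [C E]]].
  refine (conj (C1_at_ext D f g f1 f2 x y HD Hfg Hxy A) (conj B (conj C _))).
  rewrite <- Hfg by exact Hxy. exact E.
Qed.

Definition re_part (u : R * R -> C) (x y : R) : R := Re (u (x, y)).
Definition im_part (u : R * R -> C) (x y : R) : R := Im (u (x, y)).
Definition uncurried (D : R * R -> Prop) (x y : R) : Prop := D (x, y).

Lemma continuous_re_im (u : R * R -> C) (x y : R) :
  continuous u (x, y) <->
  continuity_2d_pt (re_part u) x y /\ continuity_2d_pt (im_part u) x y.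
Proof.
  split.
  - intros Hu. split; apply continuity_2d_pt_filterlim.
    + apply (filterlim_ext (fun z => fst (u z))); [now intros [z1 z2]|].
      apply (continuous_comp u fst (x, y) Hu). apply continuous_fst.
    + apply (filterlim_ext (fun z => snd (u z))); [now intros [z1 z2]|].
      apply (continuous_comp u snd (x, y) Hu). apply continuous_snd.
  - intros [H1 H2]. apply continuity_2d_pt_filterlim in H1.
    apply continuity_2d_pt_filterlim in H2.
    assert (Hp : continuous (fun z : R * R =>
              (re_part u (fst z) (snd z), im_part u (fst z) (snd z))) (x, y)).
    { apply (continuous_comp_2 (fun z => re_part u (fst z) (snd z))
        (fun z => im_part u (fst z) (snd z)) (fun a b => (a, b)) (x, y)); trivial.
      apply (continuous_ext (fun z : R * R => z)); [now intros [z1 z2]|].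
      apply continuous_id. }
    revert Hp. apply continuous_ext. intros [z1 z2]. unfold re_part, im_part. simpl.
    symmetry. apply surjective_pairing.
Qed.

Lemma C1_on_parts (D : R * R -> Prop) (u : R * R -> C) :
  C1_on D u -> forall x y, D (x, y) ->
    C1_at (re_part u) (re_part (pd1 u)) (re_part (pd2 u)) x y /\
    C1_at (im_part u) (im_part (pd1 u)) (im_part (pd2 u)) x y.
Proof.
  intros Hu x y Hxy.
  destruct (Hu (x, y) Hxy) as [[A1 A2] [[B1 B2] [C1 C2]]].
  apply continuous_re_im in C1. apply continuous_re_im in C2.
  split; refine (conj _ (conj _ (conj _ _))); try tauto.
  - exact (Derive_correct _ _ A1).
  - exact (Derive_correct _ _ B1).
  - exact (Derive_correct _ _ A2).
  - exact (Derive_correct _ _ B2).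
Qed.

Definition wave_on (k : R) (D : R * R -> Prop) (u : R * R -> C) : Prop :=
  C2_on D u /\ forall x, D x -> (laplacian u x + RtoC (k ^ 2) * u x)%C = RtoC 0.

Lemma wave_helmholtz (k : R) (D : R * R -> Prop) (u : R * R -> C) :
  wave_on k D u ->
  helmholtz k (uncurried D) (re_part u) (re_part (pd1 u)) (re_part (pd2 u)) /\
  helmholtz k (uncurried D) (im_part u) (im_part (pd1 u)) (im_part (pd2 u)).
Proof.
  intros [[H0 [H1 H2]] HE].
  assert (HE' : forall x y, D (x, y) ->
    re_part (pd1 (pd1 u)) x y + re_part (pd2 (pd2 u)) x y + k ^ 2 * re_part u x y = 0 /\
    im_part (pd1 (pd1 u)) x y + im_part (pd2 (pd2 u)) x y + k ^ 2 * im_part u x y = 0).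
  { intros x y Hxy. specialize (HE _ Hxy). unfold laplacian in HE.
    split.
    - apply (f_equal Re) in HE. unfold re_part. simpl in HE |- *.
      unfold Re in *. rewrite <- HE. ring.
    - apply (f_equal Im) in HE. unfold im_part. simpl in HE |- *.
      unfold Im in *. rewrite <- HE. ring. }
  split.
  - exists (re_part (pd1 (pd1 u))), (re_part (pd2 (pd1 u))),
      (re_part (pd1 (pd2 u))), (re_part (pd2 (pd2 u))).
    intros x y Hxy. refine (conj _ (conj _ (conj _ _))).
    + exact (proj1 (C1_on_parts D u H0 x y Hxy)).
    + exact (proj1 (C1_on_parts D (pd1 u) H1 x y Hxy)).
    + exact (proj1 (C1_on_parts D (pd2 u) H2 x y Hxy)).
    + exact (proj1 (HE' x y Hxy)).
  - exists (im_part (pd1 (pd1 u))), (im_part (pd2 (pd1 u))),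
      (im_part (pd1 (pd2 u))), (im_part (pd2 (pd2 u))).
    intros x y Hxy. refine (conj _ (conj _ (conj _ _))).
    + exact (proj2 (C1_on_parts D u H0 x y Hxy)).
    + exact (proj2 (C1_on_parts D (pd1 u) H1 x y Hxy)).
    + exact (proj2 (C1_on_parts D (pd2 u) H2 x y Hxy)).
    + exact (proj2 (HE' x y Hxy)).
Qed.

Lemma C1_at_pd (u : R * R -> C) (p1 p2 q1 q2 : R -> R -> R) (x y : R) :
  C1_at (re_part u) p1 p2 x y -> C1_at (im_part u) q1 q2 x y ->
  ex_pd1 u (x, y) /\ ex_pd2 u (x, y) /\
  pd1 u (x, y) = (p1 x y, q1 x y) /\ pd2 u (x, y) = (p2 x y, q2 x y).
Proof.
  intros [A1 [A2 _]] [B1 [B2 _]]. refine (conj _ (conj _ (conj _ _))).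
  - split; eexists; eassumption.
  - split; eexists; eassumption.
  - apply injective_projections; simpl; now apply is_derive_unique.
  - apply injective_projections; simpl; now apply is_derive_unique.
Qed.

Lemma continuity_2d_ext_on (D : R -> R -> Prop) (f g : R -> R -> R) (x y : R) :
  open_2d D -> (forall u v, D u v -> f u v = g u v) -> D x y ->
  continuity_2d_pt f x y -> continuity_2d_pt g x y.
Proof.
  intros HD Hfg Hxy. apply continuity_2d_pt_ext_loc.
  generalize (HD x y Hxy). apply locally_2d_impl. apply locally_2d_forall.
  exact Hfg.
Qed.

Lemma C1_on_of_parts (D : R * R -> Prop) (u : R * R -> C) (p1 p2 q1 q2 : R -> R -> R) :
  open_2d (uncurried D) ->
  (forall x y, D (x, y) ->
     C1_at (re_part u) p1 p2 x y /\ C1_at (im_part u) q1 q2 x y) ->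
  C1_on D u /\ forall x y, D (x, y) ->
    pd1 u (x, y) = (p1 x y, q1 x y) /\ pd2 u (x, y) = (p2 x y, q2 x y).
Proof.
  intros HD Hu.
  assert (Hpd : forall x y, D (x, y) ->
    ex_pd1 u (x, y) /\ ex_pd2 u (x, y) /\
    pd1 u (x, y) = (p1 x y, q1 x y) /\ pd2 u (x, y) = (p2 x y, q2 x y)).
  { intros x y Hxy. destruct (Hu x y Hxy) as [A B].
    now apply (C1_at_pd u p1 p2 q1 q2 x y). }
  split.
  - intros [x y] Hxy. destruct (Hpd x y Hxy) as [E1 [E2 _]].
    destruct (Hu x y Hxy) as [[_ [_ [A1 A2]]] [_ [_ [B1 B2]]]].
    refine (conj E1 (conj E2 (conj _ _))); apply continuous_re_im; split.
    + apply (continuity_2d_ext_on (uncurried D) p1); trivial.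
      intros a b Hab. unfold re_part.
      now rewrite (proj1 (proj2 (proj2 (Hpd a b Hab)))).
    + apply (continuity_2d_ext_on (uncurried D) q1); trivial.
      intros a b Hab. unfold im_part.
      now rewrite (proj1 (proj2 (proj2 (Hpd a b Hab)))).
    + apply (continuity_2d_ext_on (uncurried D) p2); trivial.
      intros a b Hab. unfold re_part.
      now rewrite (proj2 (proj2 (proj2 (Hpd a b Hab)))).
    + apply (continuity_2d_ext_on (uncurried D) q2); trivial.
      intros a b Hab. unfold im_part.
      now rewrite (proj2 (proj2 (proj2 (Hpd a b Hab)))).
  - intros x y Hxy. now destruct (Hpd x y Hxy) as [_ [_ H]].
Qed.

(** Converse of [wave_helmholtz]. [pd1] and [pd2] are total functions defined through [Derive], so
    they are first identified with the given derivatives on the open set [D], and only then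
    differentiated again. *)
Lemma helmholtz_wave (k : R) (D : R * R -> Prop) (u : R * R -> C)
  (p1 p2 q1 q2 : R -> R -> R) :
  open_2d (uncurried D) ->
  helmholtz k (uncurried D) (re_part u) p1 p2 ->
  helmholtz k (uncurried D) (im_part u) q1 q2 ->
  wave_on k D u /\ forall x y, D (x, y) ->
    pd1 u (x, y) = (p1 x y, q1 x y) /\ pd2 u (x, y) = (p2 x y, q2 x y).
Proof.
  intros HD [p11 [p12 [p21 [p22 Hp]]]] [q11 [q12 [q21 [q22 Hq]]]].
  destruct (C1_on_of_parts D u p1 p2 q1 q2 HD) as [K0 E0].
  { intros x y Hxy. split; [now apply Hp|now apply Hq]. }
  destruct (C1_on_of_parts D (pd1 u) p11 p12 q11 q12 HD) as [K1 E1].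
  { intros x y Hxy. split.
    - apply (C1_at_ext (uncurried D) p1); trivial; [|now apply Hp].
      intros a b Hab. unfold re_part. now rewrite (proj1 (E0 a b Hab)).
    - apply (C1_at_ext (uncurried D) q1); trivial; [|now apply Hq].
      intros a b Hab. unfold im_part. now rewrite (proj1 (E0 a b Hab)). }
  destruct (C1_on_of_parts D (pd2 u) p21 p22 q21 q22 HD) as [K2 E2].
  { intros x y Hxy. split.
    - apply (C1_at_ext (uncurried D) p2); trivial; [|now apply Hp].
      intros a b Hab. unfold re_part. now rewrite (proj2 (E0 a b Hab)).
    - apply (C1_at_ext (uncurried D) q2); trivial; [|now apply Hq].
      intros a b Hab. unfold im_part. now rewrite (proj2 (E0 a b Hab)). }
  split; [split|]; trivial.
  - now split.
  - intros [x y] Hxy. unfold laplacian.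
    rewrite (proj1 (E1 x y Hxy)), (proj2 (E2 x y Hxy)).
    destruct (Hp x y Hxy) as [_ [_ [_ A]]]. destruct (Hq x y Hxy) as [_ [_ [_ B]]].
    unfold re_part in A. unfold im_part in B.
    apply injective_projections; simpl; unfold Re, Im in A, B.
    + etransitivity; [|exact A]. ring.
    + etransitivity; [|exact B]. ring.
Qed.

Lemma Rabs_Re_le (z : C) : Rabs (Re z) <= Cmod z.
Proof. eapply Rle_trans; [apply Rmax_l|apply Rmax_Cmod]. Qed.

Lemma Rabs_Im_le (z : C) : Rabs (Im z) <= Cmod z.
Proof. eapply Rle_trans; [apply Rmax_r|apply Rmax_Cmod]. Qed.

Lemma Cmod_le_abs (z : C) : Cmod z <= Rabs (Re z) + Rabs (Im z).
Proof.
  pose proof (Rabs_pos (Re z)). pose proof (Rabs_pos (Im z)).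
  apply Rsqr_incr_0_var; [|lra].
  pose proof (Cmod2_alt z) as E. unfold Rsqr.
  replace (Cmod z * Cmod z) with (Cmod z ^ 2) by ring. rewrite E.
  rewrite <- (pow2_abs (Re z)), <- (pow2_abs (Im z)). nra.
Qed.

Lemma continuous_on_set_eps (D : R * R -> Prop) (u : R * R -> C) :
  continuous_on_set D u <->
  forall x, D x -> forall eps, 0 < eps -> exists d, 0 < d /\
    forall y, D y -> Rabs (fst y - fst x) < d -> Rabs (snd y - snd x) < d ->
      Cmod (u y - u x)%C < eps.
Proof.
  split.
  - intros Hu x Hx eps Heps.
    specialize (Hu x Hx).
    pose proof (proj1 (filterlim_locally (F := within D (locally x)) u (u x)) Hu) as Hu'.
    destruct (Hu' (mkposreal (eps / 4) ltac:(lra))) as [d Hd].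
    exists d. split; [apply cond_pos|]. intros y Hy H1 H2.
    destruct (Hd y (conj H1 H2) Hy) as [A B].
    eapply Rle_lt_trans; [apply Cmod_le_abs|].
    change (Rabs (Re (u y) - Re (u x)) < eps / 4) in A.
    change (Rabs (Im (u y) - Im (u x)) < eps / 4) in B.
    change (Rabs (Re (u y) - Re (u x)) + Rabs (Im (u y) - Im (u x)) < eps).
    lra.
  - intros Hu x Hx.
    apply (filterlim_locally (F := within D (locally x)) u (u x)).
    intros eps. destruct (Hu x Hx eps (cond_pos eps)) as [d [Hd H]].
    exists (mkposreal d Hd). intros y [H1 H2] Hy. specialize (H y Hy H1 H2).
    split.
    + eapply Rle_lt_trans; [|exact H]. apply (Rabs_Re_le (u y - u x)%C).
    + eapply Rle_lt_trans; [|exact H]. apply (Rabs_Im_le (u y - u x)%C).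
Qed.

(** * Radiating solutions above a surface and their translates *)

Definition admissible (h : R -> R) : Prop :=
  (forall t, continuous h t) /\ compactly_supported h.

Lemma C2_profile_admissible (h : R -> R) :
  C2_profile h -> compactly_supported h -> admissible h.
Proof.
  intros [H1 _] Hc. split; trivial. intros t. now apply @ex_derive_continuous.
Qed.

Lemma shift_admissible (l : R) (h : R -> R) : admissible h -> admissible (shift l h).
Proof.
  intros [Hc [M HM]]. split.
  - intros t. apply (continuous_comp (fun t => t - l) h).
    + apply continuous_Rminus; [apply continuous_id|apply continuous_const].
    + apply Hc.
  - exists (M + Rabs l). intros t Ht. apply HM.
    pose proof (Rabs_triang (t - l) l) as Htr. replace (t - l + l) with t in Htr by ring.
    lra.
Qed.

Lemma open_above (h : R -> R) :
  (forall t, continuous h t) -> open_2d (uncurried (above h)).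
Proof.
  intros Hh. apply (open_2d_continuous _ (fun x y => y - h x)).
  - intros x y. apply continuity_2d_pt_minus; [apply continuity_2d_pt_id2|].
    now apply continuity_2d_fst.
  - unfold uncurried, above; simpl. intros; lra.
Qed.

(** A distant point is either over a place off the support of [h], where the surface is flat, or has
    a height that exceeds every value of |h|. *)
Lemma far_above (h : R -> R) :
  admissible h -> exists R0, 1 < R0 /\ forall x y, R0 ^ 2 < x ^ 2 + y ^ 2 ->
    (0 < y <-> h x < y) /\ (y = 0 -> exists d, 0 < d /\
       forall t, Rabs (t - x) < d -> h t = 0).
Proof.
  intros [Hc [M HM]].
  set (M' := Rabs M + 1).
  assert (HM'1 : 1 <= M') by (unfold M'; pose proof (Rabs_pos M); lra).
  assert (HMM : M < M') by (unfold M'; pose proof (Rle_abs M); lra).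
  destruct (continuous_Rabs_bounded h (- M') M') as [H [HH HhH]];
    [lra|intros; apply Hc|].
  exists (M' + H + 1). split; [lra|]. intros x y Hxy.
  destruct (Rlt_or_le M' (Rabs x)) as [Hx|Hx].
  - rewrite HM by lra. split; [lra|]. intros _. exists (Rabs x - M').
    split; [lra|]. intros t Ht. apply HM.
    pose proof (Rabs_triang_inv x t). rewrite Rabs_minus_sym in Ht. lra.
  - assert (Hy2 : H ^ 2 < y ^ 2).
    { rewrite <- (pow2_abs x) in Hxy. pose proof (Rabs_pos x). nra. }
    apply Rabs_le_between in Hx. specialize (HhH x Hx).
    apply Rabs_le_between in HhH. split.
    + split; intros; nra.
    + intros ->. nra.
Qed.

(** The boundary condition is left out: the remaining conditions are linear and homogeneous, so
    fields with different boundary data can be combined. *)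
Definition csol (h : R -> R) (k : R) (u : R * R -> C) : Prop :=
  wave_on k (above h) u /\ continuous_on_set (above_or_on h) u /\
  sommerfeld (above h) k u.

Lemma Cmod_lin_lt (a b u v : C) (eps e : R) :
  0 < e -> Cmod u < e -> Cmod v < e -> e * (Cmod a + Cmod b + 1) <= eps ->
  Cmod (a * u + b * v)%C < eps.
Proof.
  intros He Hu Hv Hle. eapply Rle_lt_trans; [apply Cmod_triangle|].
  rewrite !Cmod_mult. pose proof (Cmod_ge_0 a). pose proof (Cmod_ge_0 b).
  pose proof (Cmod_ge_0 u). pose proof (Cmod_ge_0 v). nra.
Qed.

Lemma lin_eps (a b : C) (eps : R) :
  0 < eps -> exists e, 0 < e /\ e * (Cmod a + Cmod b + 1) <= eps.
Proof.
  intros Heps. pose proof (Cmod_ge_0 a). pose proof (Cmod_ge_0 b).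
  exists (eps / (Cmod a + Cmod b + 1)). split.
  - apply Rdiv_lt_0_compat; lra.
  - right. field. lra.
Qed.

Lemma csol_lin (h : R -> R) (k : R) (a b : C) (u v : R * R -> C) :
  admissible h -> csol h k u -> csol h k v ->
  csol h k (fun x => (a * u x + b * v x)%C).
Proof.
  intros [Hh _] [Hu1 [Hu2 Hu3]] [Hv1 [Hv2 Hv3]].
  pose proof (open_above h Hh) as HO.
  set (w := fun x => (a * u x + b * v x)%C).
  destruct (wave_helmholtz _ _ _ Hu1) as [Up Uq].
  destruct (wave_helmholtz _ _ _ Hv1) as [Vp Vq].
  pose proof (helmholtz_lin k 1 1 _ _ _ _ _ _ _
    (helmholtz_lin k (Re a) (- Im a) _ _ _ _ _ _ _ Up Uq)
    (helmholtz_lin k (Re b) (- Im b) _ _ _ _ _ _ _ Vp Vq)) as Wp.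
  pose proof (helmholtz_lin k 1 1 _ _ _ _ _ _ _
    (helmholtz_lin k (Im a) (Re a) _ _ _ _ _ _ _ Up Uq)
    (helmholtz_lin k (Im b) (Re b) _ _ _ _ _ _ _ Vp Vq)) as Wq.
  apply (helmholtz_ext k _ _ (re_part w)) in Wp; trivial.
  2: { intros x y _. unfold w, re_part, im_part. simpl. unfold Re, Im. ring. }
  apply (helmholtz_ext k _ _ (im_part w)) in Wq; trivial.
  2: { intros x y _. unfold w, re_part, im_part. simpl. unfold Re, Im. ring. }
  destruct (helmholtz_wave k (above h) w _ _ _ _ HO Wp Wq) as [W1 Wpd].
  split; [exact W1|split].
  - apply continuous_on_set_eps. intros x Hx eps Heps.
    destruct (lin_eps a b eps Heps) as [e [He Hee]].
    destruct (proj1 (continuous_on_set_eps _ _) Hu2 x Hx e He) as [d1 [Hd1 H1]].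
    destruct (proj1 (continuous_on_set_eps _ _) Hv2 x Hx e He) as [d2 [Hd2 H2]].
    exists (Rmin d1 d2). split; [now apply Rmin_glb_lt|]. intros y Hy A B.
    pose proof (Rmin_l d1 d2). pose proof (Rmin_r d1 d2).
    unfold w.
    replace (a * u y + b * v y - (a * u x + b * v x))%C
      with (a * (u y - u x) + b * (v y - v x))%C by ring.
    apply (Cmod_lin_lt a b _ _ eps e); trivial; [apply H1|apply H2]; trivial; lra.
  - intros eps Heps. destruct (lin_eps a b eps Heps) as [e [He Hee]].
    destruct (Hu3 e He) as [r1 H1]. destruct (Hv3 e He) as [r2 H2].
    exists (Rmax r1 r2). intros [x y] Hxy Hr.
    pose proof (Rmax_l r1 r2). pose proof (Rmax_r r1 r2).
    specialize (H1 (x, y) Hxy ltac:(lra)). specialize (H2 (x, y) Hxy ltac:(lra)).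
    unfold radial_derivative in *. destruct (Wpd x y Hxy) as [-> ->].
    match goal with |- Cmod ?z < _ => replace z with
      (a * (RtoC (sqrt (enorm (x, y))) *
       (RtoC (fst (direction (x, y))) * pd1 u (x, y) +
        RtoC (snd (direction (x, y))) * pd2 u (x, y) - Ci * RtoC k * u (x, y))) +
       b * (RtoC (sqrt (enorm (x, y))) *
       (RtoC (fst (direction (x, y))) * pd1 v (x, y) +
        RtoC (snd (direction (x, y))) * pd2 v (x, y) - Ci * RtoC k * v (x, y))))%C end.
    + now apply (Cmod_lin_lt a b _ _ eps e).
    + set (s := sqrt (enorm (x, y))). set (d1 := fst (direction (x, y))).
      set (d2 := snd (direction (x, y))). unfold w, re_part, im_part.
      destruct (u (x, y)) as [u1 u2]. destruct (v (x, y)) as [v1 v2].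
      destruct (pd1 u (x, y)) as [u3 u4]. destruct (pd1 v (x, y)) as [v3 v4].
      destruct (pd2 u (x, y)) as [u5 u6]. destruct (pd2 v (x, y)) as [v5 v6].
      destruct a as [a1 a2]. destruct b as [b1 b2].
      apply injective_projections; simpl; ring.
Qed.

Lemma enorm_pos (x y : R) : 0 < y -> 0 < enorm (x, y).
Proof. intros Hy. apply sqrt_lt_R0. unfold dot; simpl. nra. Qed.

Lemma enorm_sqr (x y : R) : enorm (x, y) ^ 2 = x ^ 2 + y ^ 2.
Proof.
  unfold enorm, dot; simpl fst; simpl snd.
  replace (sqrt (x * x + y * y) ^ 2) with (sqrt (x * x + y * y) * sqrt (x * x + y * y))
    by ring.
  rewrite sqrt_sqrt by nra. ring.
Qed.

Lemma enorm_nonneg (x : R * R) : 0 <= enorm x.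
Proof. apply sqrt_pos. Qed.

Lemma enorm_triangle_fst (x y l : R) :
  Rabs (enorm (l + x, y) - enorm (x, y)) <= Rabs l.
Proof.
  assert (H : forall a b, enorm (a + b, y) <= enorm (b, y) + Rabs a).
  { intros a b. apply Rsqr_incr_0_var.
    2: { pose proof (enorm_nonneg (b, y)). pose proof (Rabs_pos a). lra. }
    unfold Rsqr. pose proof (enorm_sqr (a + b) y) as E1.
    pose proof (enorm_sqr b y) as E2.
    pose proof (enorm_nonneg (b, y)) as Hn. pose proof (Rabs_pos a).
    assert (Hb : Rabs b <= enorm (b, y)).
    { apply Rsqr_incr_0_var; [|trivial]. rewrite <- Rsqr_abs. unfold Rsqr. nra. }
    assert (Hab : a * b <= Rabs a * Rabs b).
    { rewrite <- Rabs_mult. apply Rle_abs. }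
    pose proof (pow2_abs a). pose proof (Rabs_pos b). nra. }
  apply Rabs_le. split.
  - specialize (H (- l) (l + x)). rewrite Rabs_Ropp in H.
    replace (- l + (l + x)) with x in H by ring. lra.
  - specialize (H l x). lra.
Qed.

(* Both unit vectors point upwards, so a change of direction is controlled by
   the height [y]; this factor compensates the blow-up of the gradient bound
   near the boundary. *)
Lemma direction_shift (x y l : R) :
  0 < y -> 8 * Rabs l + 1 <= enorm (x, y) ->
  Rabs (fst (direction (x, y)) - fst (direction (l + x, y))) <=
    8 * Rabs l * y / enorm (x, y) ^ 2 /\
  Rabs (snd (direction (x, y)) - snd (direction (l + x, y))) <=
    8 * Rabs l * y / enorm (x, y) ^ 2.
Proof.
  intros Hy Hr. unfold direction; simpl fst; simpl snd.
  pose proof (enorm_triangle_fst x y l) as Ht.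
  pose proof (enorm_sqr x y) as Er. pose proof (enorm_sqr (l + x) y) as Es.
  set (r := enorm (x, y)) in *. set (s := enorm (l + x, y)) in *. clearbody r s.
  pose proof (Rabs_pos l) as Hl.
  apply Rabs_le_between in Ht.
  assert (Hr0 : 0 < r) by lra. assert (Hs0 : 7 / 8 * r <= s) by lra.
  assert (Hs1 : 0 < s) by lra.
  assert (Hr2 : 0 < r ^ 2) by (apply pow_lt; lra).
  set (e1 := x / r). set (e2 := y / r). set (f1 := (l + x) / s). set (f2 := y / s).
  assert (Ee : e1 ^ 2 + e2 ^ 2 = 1).
  { unfold e1, e2. replace ((x / r) ^ 2 + (y / r) ^ 2) with ((x ^ 2 + y ^ 2) / r ^ 2)
      by (field; lra). rewrite <- Er. field. lra. }
  assert (Ef : f1 ^ 2 + f2 ^ 2 = 1).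
  { unfold f1, f2. replace (((l + x) / s) ^ 2 + (y / s) ^ 2)
      with (((l + x) ^ 2 + y ^ 2) / s ^ 2) by (field; lra).
    rewrite <- Es. field. lra. }
  assert (He2 : 0 < e2) by (now apply Rdiv_lt_0_compat).
  assert (Hf2 : 0 < f2) by (now apply Rdiv_lt_0_compat).
  assert (Hrs : / (r * s) <= 2 * / r ^ 2).
  { apply Rmult_le_reg_l with (r ^ 2 * s); [apply Rmult_lt_0_compat; lra|].
    replace (r ^ 2 * s * / (r * s)) with r by (field; lra).
    replace (r ^ 2 * s * (2 * / r ^ 2)) with (2 * s) by (field; lra). lra. }
  assert (Hirs : 0 < / (r * s)) by (apply Rinv_0_lt_compat; nra).
  set (T := Rabs l * y / r ^ 2).
  assert (HT : 0 <= T).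
  { apply Rdiv_le_0_compat; [apply Rmult_le_pos|]; lra. }
  assert (D2 : Rabs (e2 - f2) <= 2 * T).
  { replace (e2 - f2) with ((s - r) * (y * / (r * s))) by (unfold e2, f2; field; lra).
    replace (2 * T) with (Rabs l * (y * (2 * / r ^ 2))) by (unfold T; field; lra).
    apply Rabs_mult_le; [apply Rabs_le; lra|].
    rewrite Rabs_pos_eq by (apply Rmult_le_pos; lra).
    apply Rmult_le_compat_l; lra. }
  replace (8 * Rabs l * y / r ^ 2) with (8 * T) by (unfold T; field; lra).
  split; [|lra].
  assert (Hprod : (e1 - f1) * (e1 + f1) = (f2 - e2) * (f2 + e2)) by nra.
  assert (He2' : e2 <= 1) by nra. assert (Hf2' : f2 <= 1) by nra.
  (* If [e1 + f1] is not small, the unit-length identity transfers the bound from the second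
     components to the first. Otherwise both directions are steep, [y] is comparable to [r], and the
     crude bound of order |l| / r already contains the factor y / r. *)
  destruct (Rle_or_lt (1 / 2) (Rabs (e1 + f1))) as [Hbig|Hsmall].
  - assert (Habs : Rabs (e1 - f1) * Rabs (e1 + f1) <= 2 * T * 2).
    { rewrite <- Rabs_mult, Hprod. apply Rabs_mult_le.
      - now rewrite Rabs_minus_sym.
      - apply Rabs_le; lra. }
    pose proof (Rabs_pos (e1 - f1)). nra.
  - assert (D1 : Rabs (e1 - f1) <= 2 * Rabs l / r * (8 / 7)).
    { replace (e1 - f1) with ((x / r * (s - r) - l) * / s)
        by (unfold e1, f1; field; lra).
      replace (2 * Rabs l / r * (8 / 7)) with ((1 * Rabs l + Rabs l) * (/ (7 / 8 * r)))
        by (field; lra).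
      apply Rabs_mult_le.
      - unfold Rminus at 1. eapply Rle_trans; [apply Rabs_triang|].
        rewrite Rabs_Ropp. apply Rplus_le_compat_r. apply Rabs_mult_le.
        + fold e1. apply Rabs_le. split; nra.
        + apply Rabs_le; lra.
      - rewrite Rabs_pos_eq by (left; now apply Rinv_0_lt_compat).
        apply Rinv_le_contravar; lra. }
    assert (Hlr : Rabs l / r <= 1 / 8).
    { apply Rmult_le_reg_r with r; trivial.
      replace (Rabs l / r * r) with (Rabs l) by (field; lra). lra. }
    assert (H2e : Rabs (2 * e1) <= 1).
    { replace (2 * e1) with ((e1 + f1) + (e1 - f1)) by ring.
      eapply Rle_trans; [apply Rabs_triang|]. unfold Rdiv in D1, Hlr. lra. }
    apply Rabs_le_between in H2e.
    assert (He2b : 1 / 2 <= e2) by nra.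
    assert (HTe : T = Rabs l / r * e2) by (unfold T, e2; field; lra).
    assert (0 <= Rabs l / r) by (apply Rdiv_le_0_compat; lra).
    rewrite HTe. unfold Rdiv in *. nra.
Qed.

Lemma enorm_bounds (x y : R) :
  Rabs x <= enorm (x, y) /\ Rabs y <= enorm (x, y) /\ enorm (x, y) <= Rabs x + Rabs y.
Proof.
  pose proof (enorm_sqr x y) as E. pose proof (enorm_nonneg (x, y)) as H.
  pose proof (Rabs_pos x). pose proof (Rabs_pos y).
  pose proof (pow2_abs x) as Ex. pose proof (pow2_abs y) as Ey.
  repeat split; apply Rsqr_incr_0_var; try lra; unfold Rsqr; nra.
Qed.

Definition translate (l : R) (u : R * R -> C) (x : R * R) : C := u (l + fst x, snd x).

Definition bounded_at_infinity (u : R * R -> C) : Prop :=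
  exists B rho, 0 <= B /\ forall x y, 0 < y -> rho < enorm (x, y) -> Cmod (u (x, y)) <= B.

(** A square of half side min(1, y / 2) about the point stays in the upper half plane, where the
    field is bounded. Dividing by its size costs a factor of order 1 + 1 / y, whence the weight
    [y]. *)
Lemma csol_gradient_bound (h : R -> R) (k : R) (u : R * R -> C) :
  admissible h -> csol h k u -> bounded_at_infinity u ->
  exists A rho, 0 <= A /\ forall x y, 0 < y -> rho < enorm (x, y) ->
    y * Cmod (pd1 u (x, y)) <= A * (1 + y) /\ y * Cmod (pd2 u (x, y)) <= A * (1 + y).
Proof.
  intros Hh [Hw _] [B [rho [HB Hb]]].
  destruct (far_above h Hh) as [R0 [HR0 Hfar]].
  destruct (wave_helmholtz _ _ _ Hw) as [Hp Hq].
  (* The radius is doubled because |x| + |y| and the Euclidean norm differ by at most a factor 2;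
     the added 2 pays for moving inside the square. *)
  exists (2 * (6 * B + k ^ 2 * B + 1)), (2 * Rmax rho R0 + 2). split.
  { pose proof (pow2_ge_0 k). nra. }
  intros x y Hy Hr.
  pose proof (Rmax_l rho R0). pose proof (Rmax_r rho R0).
  set (d := Rmin 1 (y / 2)).
  assert (Hd : 0 < d) by (apply Rmin_glb_lt; lra).
  assert (Hd1 : d <= 1) by apply Rmin_l. assert (Hd2 : d <= y / 2) by apply Rmin_r.
  assert (Hbox : forall X Y, Rabs (X - x) <= d -> Rabs (Y - y) <= d ->
            0 < Y /\ Rmax rho R0 < enorm (X, Y)).
  { intros X Y HX HY. destruct (enorm_bounds x y) as [_ [_ E1]].
    destruct (enorm_bounds X Y) as [E2 [E3 _]].
    pose proof (Rabs_triang_inv x X) as T1. rewrite Rabs_minus_sym in HX.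
    pose proof (Rabs_triang_inv y Y) as T2. rewrite Rabs_minus_sym in HY.
    split; [apply Rabs_le_between in HY; lra|lra]. }
  assert (HD : forall X Y, Rabs (X - x) <= d -> Rabs (Y - y) <= d ->
            uncurried (above h) X Y /\ Cmod (u (X, Y)) <= B).
  { intros X Y HX HY. destruct (Hbox X Y HX HY) as [A1 A2]. split.
    - apply (Hfar X Y); trivial. rewrite <- enorm_sqr. nra.
    - apply Hb; lra. }
  pose proof (open_above h (proj1 Hh)) as HO.
  destruct (helmholtz_gradient_bound k d B x y _ _ _ _ Hd HO Hp) as [P1 P2].
  { intros X Y HX HY. destruct (HD X Y HX HY) as [A1 A2]. split; trivial.
    eapply Rle_trans; [apply Rabs_Re_le|exact A2]. }
  destruct (helmholtz_gradient_bound k d B x y _ _ _ _ Hd HO Hq) as [Q1 Q2].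
  { intros X Y HX HY. destruct (HD X Y HX HY) as [A1 A2]. split; trivial.
    eapply Rle_trans; [apply Rabs_Im_le|exact A2]. }
  unfold re_part in P1, P2. unfold im_part in Q1, Q2.
  set (G := 2 * B / d + (k ^ 2 * B + 1) * d / 2) in *.
  assert (HkB : 0 <= k ^ 2 * B) by (apply Rmult_le_pos; [apply pow2_ge_0|trivial]).
  assert (HG : y * G <= (6 * B + k ^ 2 * B + 1) * (1 + y)).
  { assert (Hyd : y * / d <= y + 2).
    { apply Rmult_le_reg_r with d; trivial. rewrite Rmult_assoc, Rinv_l by lra.
      unfold d, Rmin. destruct (Rle_dec 1 (y / 2)); nra. }
    unfold G. replace (y * (2 * B / d + (k ^ 2 * B + 1) * d / 2))
      with (2 * B * (y * / d) + (k ^ 2 * B + 1) * (y * d) / 2) by (field; lra).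
    assert (2 * B * (y * / d) <= 2 * B * (y + 2)) by (apply Rmult_le_compat_l; lra).
    assert ((k ^ 2 * B + 1) * (y * d) <= (k ^ 2 * B + 1) * (y * 1)).
    { apply Rmult_le_compat_l; [lra|]. apply Rmult_le_compat_l; lra. }
    assert (0 <= B * y) by (apply Rmult_le_pos; lra).
    assert (0 <= k ^ 2 * B * y) by (apply Rmult_le_pos; lra). nra. }
  split.
  - apply Rle_trans with (y * (2 * G)); [|lra]. apply Rmult_le_compat_l; [lra|].
    eapply Rle_trans; [apply Cmod_le_abs|]. lra.
  - apply Rle_trans with (y * (2 * G)); [|lra]. apply Rmult_le_compat_l; [lra|].
    eapply Rle_trans; [apply Cmod_le_abs|]. lra.
Qed.

Lemma shift_translate (l : R) (h : R -> R) (x : R) : shift l h (l + x) = h x.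
Proof. unfold shift. f_equal. ring. Qed.

Lemma sqrt_gt (K r : R) : 0 <= K -> K ^ 2 < r -> K < sqrt r.
Proof.
  intros HK Hr. rewrite <- (sqrt_pow2 K HK). apply sqrt_lt_1; [apply pow2_ge_0|nra|trivial].
Qed.

(** Only the radiation condition depends on the origin. The radial direction changes by O(y / r^2)
    and the gradient is O((1 + y) / y), so the error is O(1 / r), which beats the factor sqrt r. *)
Lemma csol_translate (h : R -> R) (k l : R) (u : R * R -> C) :
  admissible h -> csol (shift l h) k u -> bounded_at_infinity u ->
  csol h k (translate l u).
Proof.
  intros Hh Hu Hb. pose proof (shift_admissible l h Hh) as Hh'.
  destruct (csol_gradient_bound _ k u Hh' Hu Hb) as [A [rho [HA Hgrad]]].
  destruct Hu as [Hw [Hc Hs]].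
  destruct (far_above h Hh) as [R0 [HR0 Hfar]].
  destruct (wave_helmholtz _ _ _ Hw) as [Hp Hq].
  pose proof (open_above h (proj1 Hh)) as HO.
  assert (HD : forall x y, uncurried (above h) x y ->
            uncurried (above (shift l h)) (l + x) (0 + y)).
  { unfold uncurried, above; simpl. intros x y H. rewrite shift_translate. lra. }
  apply (helmholtz_shift k l 0) in Hp. apply (helmholtz_shift k l 0) in Hq.
  apply (helmholtz_sub k _ (uncurried (above h))) in Hp; [|exact HD].
  apply (helmholtz_sub k _ (uncurried (above h))) in Hq; [|exact HD].
  apply (helmholtz_ext k _ _ (re_part (translate l u))) in Hp; trivial.
  2: { intros x y _. unfold re_part, translate; simpl. now rewrite Rplus_0_l. }
  apply (helmholtz_ext k _ _ (im_part (translate l u))) in Hq; trivial.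
  2: { intros x y _. unfold im_part, translate; simpl. now rewrite Rplus_0_l. }
  destruct (helmholtz_wave k _ _ _ _ _ _ HO Hp Hq) as [W1 Wpd].
  split; [exact W1|split].
  - apply continuous_on_set_eps. intros [x y] Hx eps Heps.
    destruct (proj1 (continuous_on_set_eps _ _) Hc (l + x, y)) with (eps := eps)
      as [d [Hd H]]; trivial.
    { unfold above_or_on in *; simpl in *. now rewrite shift_translate. }
    exists d. split; trivial. intros [x' y'] Hx' A1 A2. apply H; simpl in *.
    + unfold above_or_on in *; simpl in *. now rewrite shift_translate.
    + replace (l + x' - (l + x)) with (x' - x) by ring. exact A1.
    + exact A2.
  - intros eps Heps. destruct (Hs (eps / 4) ltac:(lra)) as [r1 H1].
    pose proof (Rabs_pos l) as Hl.
    (* The direction error will be at most 32 |l| A / sqrt r, so every radius above [Ke ^ 2] brings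
       it below eps / 4. *)
    set (K := 64 * Rabs l * A). assert (HK : 0 <= K).
    { unfold K. apply Rmult_le_pos; lra. }
    set (Ke := K / (eps / 4)).
    assert (HKe : 0 <= Ke) by (apply Rdiv_le_0_compat; lra).
    assert (HKe' : Ke * (eps / 4) = K) by (unfold Ke; field; lra).
    exists (Rmax (Rmax r1 rho + Rabs l) R0 + 8 * Rabs l + 1 + Ke ^ 2).
    intros [x y] Hxy Hr.
    pose proof (Rmax_l (Rmax r1 rho + Rabs l) R0).
    pose proof (Rmax_r (Rmax r1 rho + Rabs l) R0).
    pose proof (Rmax_l r1 rho). pose proof (Rmax_r r1 rho).
    pose proof (pow2_ge_0 Ke) as HKe2.
    assert (HrR : R0 < enorm (x, y)) by lra.
    assert (Hy : 0 < y).
    { apply (Hfar x y); [|exact Hxy]. rewrite <- enorm_sqr. nra. }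
    pose proof (enorm_triangle_fst x y l) as Ht. apply Rabs_le_between in Ht.
    destruct (direction_shift x y l Hy ltac:(lra)) as [D1 D2].
    assert (Hxy' : above (shift l h) (l + x, y)).
    { unfold above in *; simpl in *. now rewrite shift_translate. }
    specialize (H1 (l + x, y) Hxy' ltac:(lra)).
    destruct (Hgrad (l + x) y Hy ltac:(lra)) as [G1 G2].
    destruct (Wpd x y Hxy) as [E1 E2].
    assert (E1' : pd1 (translate l u) (x, y) = pd1 u (l + x, y)).
    { rewrite E1. unfold re_part, im_part. rewrite Rplus_0_l.
      symmetry. apply surjective_pairing. }
    assert (E2' : pd2 (translate l u) (x, y) = pd2 u (l + x, y)).
    { rewrite E2. unfold re_part, im_part. rewrite Rplus_0_l.
      symmetry. apply surjective_pairing. }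
    unfold radial_derivative in *. rewrite E1', E2'.
    change (translate l u (x, y)) with (u (l + x, y)).
    set (g1 := pd1 u (l + x, y)) in *. set (g2 := pd2 u (l + x, y)) in *.
    set (v := u (l + x, y)) in *.
    pose proof (enorm_bounds x y) as [_ [Hyr _]]. rewrite Rabs_pos_eq in Hyr by lra.
    set (r := enorm (x, y)) in *. set (s := enorm (l + x, y)) in *.
    set (a1 := fst (direction (x, y))) in *. set (a2 := snd (direction (x, y))) in *.
    set (b1 := fst (direction (l + x, y))) in *.
    set (b2 := snd (direction (l + x, y))) in *.
    assert (Hr1 : 1 < r) by lra.
    assert (Hsr : sqrt r <= 2 * sqrt s).
    { replace 2 with (sqrt (2 ^ 2)) by (apply sqrt_pow2; lra).
      rewrite <- sqrt_mult by lra. apply sqrt_le_1; lra. }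
    set (W := (RtoC b1 * g1 + RtoC b2 * g2 - Ci * RtoC k * v)%C) in *.
    replace (RtoC (sqrt r) * (RtoC a1 * g1 + RtoC a2 * g2 - Ci * RtoC k * v))%C with
      (RtoC (sqrt r) * (RtoC (a1 - b1) * g1 + RtoC (a2 - b2) * g2) + RtoC (sqrt r) * W)%C.
    2: { unfold W. rewrite !RtoC_minus. ring. }
    eapply Rle_lt_trans; [apply Cmod_triangle|].
    assert (HW : Cmod (RtoC (sqrt r) * W) <= eps / 2).
    { rewrite Cmod_mult, Cmod_R, Rabs_pos_eq in H1 by apply sqrt_pos.
      rewrite Cmod_mult, Cmod_R, Rabs_pos_eq by apply sqrt_pos.
      pose proof (Cmod_ge_0 W). nra. }
    assert (Hsr0 : 0 < sqrt r) by (apply sqrt_lt_R0; lra).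
    assert (Hss : sqrt r * sqrt r = r) by (apply sqrt_sqrt; lra).
    assert (HKs : Ke < sqrt r) by (apply sqrt_gt; lra).
    assert (Hterm : forall c g, Rabs c <= 8 * Rabs l * y / r ^ 2 ->
              y * Cmod g <= A * (1 + y) ->
              Cmod (RtoC c * g) <= 16 * Rabs l * A / r).
    { intros c g Hcc Hg. rewrite Cmod_mult, Cmod_R.
      apply Rle_trans with (8 * Rabs l * y / r ^ 2 * Cmod g).
      - apply Rmult_le_compat_r; [apply Cmod_ge_0|exact Hcc].
      - replace (8 * Rabs l * y / r ^ 2 * Cmod g) with
          (8 * Rabs l / r ^ 2 * (y * Cmod g)) by (field; lra).
        replace (16 * Rabs l * A / r) with (8 * Rabs l / r ^ 2 * (A * (2 * r)))
          by (field; lra).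
        apply Rmult_le_compat_l.
        + apply Rdiv_le_0_compat; [lra|apply pow_lt; lra].
        + eapply Rle_trans; [exact Hg|]. apply Rmult_le_compat_l; lra. }
    pose proof (Hterm (a1 - b1) g1 D1 G1) as T1.
    pose proof (Hterm (a2 - b2) g2 D2 G2) as T2.
    assert (HZ : Cmod (RtoC (sqrt r) * (RtoC (a1 - b1) * g1 + RtoC (a2 - b2) * g2))
                 <= eps / 4).
    { rewrite Cmod_mult, Cmod_R, Rabs_pos_eq by lra.
      apply Rle_trans with (sqrt r * (32 * Rabs l * A / r)).
      - apply Rmult_le_compat_l; [lra|].
        eapply Rle_trans; [apply Cmod_triangle|]. lra.
      - rewrite <- Hss at 2.
        replace (sqrt r * (32 * Rabs l * A / (sqrt r * sqrt r)))
          with (32 * Rabs l * A / sqrt r) by (field; lra).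
        apply Rmult_le_reg_r with (sqrt r); trivial.
        unfold Rdiv at 1. rewrite Rmult_assoc, Rinv_l, Rmult_1_r by lra.
        unfold K in HKe'. nra. }
    lra.
Qed.

(** * Far fields *)

(** Produces the extension by zero on which [dirichlet_half] is stated. *)
Definition upper (f : R -> R -> R) (x y : R) : R := if Rlt_dec 0 y then f x y else 0.

Lemma upper_pos (f : R -> R -> R) (x y : R) : 0 < y -> upper f x y = f x y.
Proof. intros Hy. unfold upper. destruct (Rlt_dec 0 y); [reflexivity|lra]. Qed.

Lemma upper_nonpos (f : R -> R -> R) (x y : R) : y <= 0 -> upper f x y = 0.
Proof. intros Hy. unfold upper. destruct (Rlt_dec 0 y); [lra|reflexivity]. Qed.

Lemma upper_continuity (f : R -> R -> R) (x y : R) :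
  (0 < y -> continuity_2d_pt f x y) ->
  (y = 0 -> forall eps, 0 < eps -> exists d, 0 < d /\ forall a b,
     0 < b -> Rabs (a - x) < d -> Rabs (b - y) < d -> Rabs (f a b) < eps) ->
  continuity_2d_pt (upper f) x y.
Proof.
  intros Hpos Hzero. destruct (Rtotal_order y 0) as [Hy|[Hy|Hy]].
  - apply (continuity_2d_pt_ext_loc (fun _ _ => 0)); [|apply continuity_2d_pt_const].
    exists (mkposreal (- y) ltac:(lra)). simpl. intros u v _ Hv.
    apply Rabs_def2 in Hv. rewrite upper_nonpos; lra.
  - intros eps. destruct (Hzero Hy eps (cond_pos eps)) as [d [Hd H]].
    exists (mkposreal d Hd). simpl. intros u v Hu Hv.
    rewrite (upper_nonpos f x y) by lra. rewrite Rminus_0_r.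
    destruct (Rlt_dec 0 v) as [Hv0|Hv0].
    + rewrite upper_pos by trivial. now apply H.
    + rewrite upper_nonpos, Rabs_R0 by lra. apply cond_pos.
  - apply (continuity_2d_pt_ext_loc f); [|now apply Hpos].
    exists (mkposreal y Hy). simpl. intros u v _ Hv.
    apply Rabs_def2 in Hv. rewrite upper_pos; lra.
Qed.

(** The part of the boundary condition that the analysis at infinity uses. Scattering solutions
    satisfy it because incident and reflected waves cancel on the axis. *)
Definition flat_zero (h : R -> R) (u : R * R -> C) : Prop :=
  forall x, h x = 0 -> u (x, 0) = RtoC 0.

Lemma csol_upper_continuity (h : R -> R) (k : R) (u : R * R -> C) :
  admissible h -> csol h k u -> flat_zero h u ->
  exists R0, 1 < R0 /\
    (forall x y, R0 ^ 2 < x ^ 2 + y ^ 2 -> (0 < y <-> above h (x, y))) /\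
    forall x y, R0 ^ 2 < x ^ 2 + y ^ 2 ->
      continuity_2d_pt (upper (re_part u)) x y /\
      continuity_2d_pt (upper (im_part u)) x y.
Proof.
  intros Hh [Hw [Hc _]] Hz.
  destruct (far_above h Hh) as [R0 [HR0 Hfar]].
  exists R0. split; trivial. split.
  { intros x y Hxy. now apply Hfar. }
  intros x y Hxy.
  pose proof (open_above h (proj1 Hh)) as HO.
  destruct Hw as [[HC1 _] _].
  assert (Hzero : y = 0 -> forall eps, 0 < eps -> exists d, 0 < d /\ forall a b,
            0 < b -> Rabs (a - x) < d -> Rabs (b - y) < d -> Cmod (u (a, b)) < eps).
  { intros Hy eps Heps. destruct (proj2 (Hfar x y Hxy) Hy) as [d1 [Hd1 Hflat]].
    assert (Hx0 : h x = 0) by (apply Hflat; rewrite Rminus_diag, Rabs_R0; lra).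
    destruct (proj1 (continuous_on_set_eps _ _) Hc (x, y)) with (eps := eps)
      as [d2 [Hd2 H2]]; trivial.
    { unfold above_or_on; simpl. lra. }
    exists (Rmin d1 d2). split; [now apply Rmin_glb_lt|]. intros a b Hb A1 A2.
    pose proof (Rmin_l d1 d2). pose proof (Rmin_r d1 d2).
    assert (Hab : above_or_on h (a, b)).
    { unfold above_or_on; simpl. rewrite Hflat; lra. }
    specialize (H2 (a, b) Hab ltac:(simpl; lra) ltac:(simpl; lra)).
    replace (u (x, y)) with (RtoC 0) in H2 by (rewrite Hy; symmetry; now apply Hz).
    replace (u (a, b) - RtoC 0)%C with (u (a, b)) in H2 by ring. exact H2. }
  split; apply upper_continuity.
  - intros Hy. apply (C1_continuity (uncurried (above h)) (re_part u) (re_part (pd1 u))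
      (re_part (pd2 u))); trivial.
    + intros a b Hab. exact (proj1 (C1_on_parts _ u HC1 a b Hab)).
    + now apply Hfar.
  - intros Hy eps Heps. destruct (Hzero Hy eps Heps) as [d [Hd H]].
    exists d. split; trivial. intros a b Hb A1 A2.
    eapply Rle_lt_trans; [apply Rabs_Re_le|now apply H].
  - intros Hy. apply (C1_continuity (uncurried (above h)) (im_part u) (im_part (pd1 u))
      (im_part (pd2 u))); trivial.
    + intros a b Hab. exact (proj2 (C1_on_parts _ u HC1 a b Hab)).
    + now apply Hfar.
  - intros Hy eps Heps. destruct (Hzero Hy eps Heps) as [d [Hd H]].
    exists d. split; trivial. intros a b Hb A1 A2.
    eapply Rle_lt_trans; [apply Rabs_Im_le|now apply H].
Qed.

Definition continuous_C (P : R -> C) : Prop :=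
  forall c, continuous (fun c => Re (P c)) c /\ continuous (fun c => Im (P c)) c.

(* The far field is parametrised by the cosine of the polar angle. *)
Definition far (k : R) (u : R * R -> C) (P : R -> C) : Prop :=
  continuous_C P /\ P 1 = RtoC 0 /\ P (-1) = RtoC 0 /\
  forall eps, 0 < eps -> exists rho, forall x y, 0 < y -> rho < enorm (x, y) ->
    Cmod (RtoC (sqrt (enorm (x, y))) * u (x, y)
          - expi (k * enorm (x, y)) * P (x / enorm (x, y))%R)%C < eps.

Lemma Cmod_expi (t : R) : Cmod (expi t) = 1.
Proof.
  unfold Cmod, expi; simpl. pose proof (sin2_cos2 t) as H. unfold Rsqr in H.
  replace (cos t * (cos t * 1) + sin t * (sin t * 1)) with 1 by lra. apply sqrt_1.
Qed.

Lemma expi_plus (s t : R) : expi (s + t) = (expi s * expi t)%C.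
Proof.
  apply injective_projections; simpl; [rewrite cos_plus|rewrite sin_plus]; ring.
Qed.

Lemma expi_0 : expi 0 = RtoC 1.
Proof. unfold expi. rewrite cos_0, sin_0. reflexivity. Qed.

Lemma expi_opp (t : R) : (expi (- t) * expi t)%C = RtoC 1.
Proof. rewrite <- expi_plus, Rplus_opp_l. apply expi_0. Qed.

Lemma cosine_range (x y : R) : 0 < y -> -1 < x / enorm (x, y) < 1.
Proof.
  intros Hy. pose proof (enorm_pos x y Hy) as Hr. pose proof (enorm_sqr x y) as E.
  set (r := enorm (x, y)) in *. clearbody r.
  assert (E' : x / r * r = x) by (field; lra).
  set (c := x / r) in *. clearbody c.
  assert (c ^ 2 < 1). { apply Rmult_lt_reg_r with (r ^ 2); nra. }
  split; nra.
Qed.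

Lemma sine_of_cosine (x y : R) :
  0 < y -> sqrt (1 - (x / enorm (x, y)) ^ 2) = y / enorm (x, y).
Proof.
  intros Hy. pose proof (enorm_pos x y Hy) as Hr. pose proof (enorm_sqr x y) as E.
  set (r := enorm (x, y)) in *. clearbody r.
  rewrite <- (sqrt_pow2 (y / r)) by (apply Rdiv_le_0_compat; lra).
  f_equal. replace ((y / r) ^ 2) with ((r ^ 2 - x ^ 2) / r ^ 2).
  - field. lra.
  - replace (r ^ 2 - x ^ 2) with (y ^ 2) by lra. field. lra.
Qed.

Lemma enorm_of_cosine (r c : R) :
  0 < r -> -1 < c < 1 -> enorm (r * c, r * sqrt (1 - c ^ 2)) = r.
Proof.
  intros Hr Hc.
  change (sqrt (r * c * (r * c) + r * sqrt (1 - c ^ 2) * (r * sqrt (1 - c ^ 2))) = r).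
  replace (r * c * (r * c) + r * sqrt (1 - c ^ 2) * (r * sqrt (1 - c ^ 2)))
    with (r ^ 2 * (c ^ 2 + sqrt (1 - c ^ 2) * sqrt (1 - c ^ 2))) by ring.
  rewrite sqrt_sqrt by nra.
  replace (r ^ 2 * (c ^ 2 + (1 - c ^ 2))) with (r ^ 2) by ring.
  apply sqrt_pow2; lra.
Qed.

(** The far field is not assumed continuous, nor zero in grazing directions. Both follow because the
    rescaled traces on circles of radius r are continuous, vanish at grazing directions, and
    converge uniformly with error A / r. *)
Lemma far_exists (h : R -> R) (k : R) (u uinf : R * R -> C) :
  admissible h -> csol h k u -> flat_zero h u -> is_far_field k u uinf ->
  exists P, far k u P /\ forall c, -1 < c < 1 -> P c = uinf (c, sqrt (1 - c ^ 2)).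
Proof.
  intros Hh Hu Hz [rho [A [r0 [Hr0 Hff]]]].
  destruct (csol_upper_continuity h k u Hh Hu Hz) as [R0 [HR0 [_ Hcont]]].
  set (P := fun c => if Rlt_dec (-1) c then if Rlt_dec c 1 then
    uinf (c, sqrt (1 - c ^ 2)) else RtoC 0 else RtoC 0).
  assert (HP : forall c, -1 < c < 1 -> P c = uinf (c, sqrt (1 - c ^ 2))).
  { intros c Hc. unfold P. destruct (Rlt_dec (-1) c), (Rlt_dec c 1); trivial; lra. }
  assert (HP0 : forall c, ~ (-1 < c < 1) -> P c = RtoC 0).
  { intros c Hc. unfold P. destruct (Rlt_dec (-1) c), (Rlt_dec c 1); trivial; lra. }
  assert (Hkey : forall x y, 0 < y -> r0 < enorm (x, y) ->
    (RtoC (sqrt (enorm (x, y))) * u (x, y)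
      = expi (k * enorm (x, y)) * (P (x / enorm (x, y))%R + rho (x, y)))%C /\
    Cmod (rho (x, y)) <= Rabs A / enorm (x, y)).
  { intros x y Hy Hr. destruct (Hff (x, y) Hy Hr) as [E B].
    pose proof (enorm_pos x y Hy) as Hrp. split.
    - rewrite E, HP by now apply cosine_range.
      rewrite sine_of_cosine by trivial. unfold direction; simpl fst; simpl snd.
      assert (Hs : RtoC (sqrt (enorm (x, y))) <> RtoC 0).
      { intros H. apply RtoC_inj in H. pose proof (sqrt_lt_R0 _ Hrp). lra. }
      field. exact Hs.
    - eapply Rle_trans; [exact B|]. apply Rmult_le_compat_r.
      + left. now apply Rinv_0_lt_compat.
      + apply Rle_abs. }
  set (Pr := fun r c => (RtoC (sqrt r) * (expi (- (k * r)) *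
    (upper (re_part u) (r * c)%R (r * sqrt (1 - c ^ 2))%R,
     upper (im_part u) (r * c)%R (r * sqrt (1 - c ^ 2))%R)))%C).
  assert (Hclose : forall r c, r0 < r -> Cmod (Pr r c - P c)%C <= Rabs A / r).
  { intros r c Hr.
    assert (Hq : 0 <= Rabs A / r) by (apply Rdiv_le_0_compat; [apply Rabs_pos|lra]).
    destruct (classic (-1 < c < 1)) as [Hc|Hc].
    - assert (Hs : 0 < sqrt (1 - c ^ 2)) by (apply sqrt_lt_R0; nra).
      assert (Hy : 0 < r * sqrt (1 - c ^ 2)) by (apply Rmult_lt_0_compat; lra).
      pose proof (enorm_of_cosine r c ltac:(lra) Hc) as En.
      destruct (Hkey _ _ Hy ltac:(rewrite En; exact Hr)) as [E B]. rewrite En in E, B.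
      replace (r * c / r) with c in E by (field; lra).
      unfold Pr. rewrite !upper_pos by trivial. unfold re_part, im_part.
      replace (Re (u (r * c, r * sqrt (1 - c ^ 2))), Im (u (r * c, r * sqrt (1 - c ^ 2))))
        with (u (r * c, r * sqrt (1 - c ^ 2))) by apply surjective_pairing.
      replace (RtoC (sqrt r) * (expi (- (k * r)) * u (r * c, r * sqrt (1 - c ^ 2))%R) - P c)%C
        with (rho (r * c, r * sqrt (1 - c ^ 2))%R); [exact B|].
      replace (RtoC (sqrt r) * (expi (- (k * r)) * u (r * c, r * sqrt (1 - c ^ 2))%R))%C
        with (expi (- (k * r)) * (RtoC (sqrt r) * u (r * c, r * sqrt (1 - c ^ 2))%R))%C by ring.
      rewrite E, Cmult_assoc, expi_opp. ring.
    (* Outside (-1, 1) the square root takes its default value 0, so the point lies on the axis,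
       where [upper] is zero; the trace and [P] are then both 0 and no error occurs. *)
    - assert (Hs : sqrt (1 - c ^ 2) = 0) by (apply sqrt_neg_0; nra).
      unfold Pr. rewrite Hs, Rmult_0_r, !upper_nonpos by lra.
      rewrite HP0 by trivial.
      match goal with |- Cmod ?z <= _ => replace z with (RtoC 0) end.
      + rewrite Cmod_0. exact Hq.
      + apply injective_projections; simpl; ring. }
  assert (Hprc : forall r c, R0 < r ->
            continuous (fun c => Re (Pr r c)) c /\ continuous (fun c => Im (Pr r c)) c).
  { intros r c Hr.
    assert (Hin : R0 ^ 2 < (r * c) ^ 2 + (r * sqrt (1 - c ^ 2)) ^ 2).
    { destruct (Rle_or_lt 0 (1 - c ^ 2)) as [H|H].
      - replace ((r * sqrt (1 - c ^ 2)) ^ 2) with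
          (r ^ 2 * (sqrt (1 - c ^ 2) * sqrt (1 - c ^ 2))) by ring.
        rewrite sqrt_sqrt by trivial.
        replace ((r * c) ^ 2 + r ^ 2 * (1 - c ^ 2)) with (r ^ 2) by ring. nra.
      - rewrite sqrt_neg_0 by lra. assert (R0 ^ 2 < r ^ 2) by nra.
        assert (0 < r ^ 2) by nra. nra. }
    destruct (Hcont _ _ Hin) as [C1 C2].
    assert (Cx : continuous (fun c => r * c) c).
    { apply continuous_Rmult; [apply continuous_const|apply continuous_id]. }
    assert (Cy : continuous (fun c => r * sqrt (1 - c ^ 2)) c).
    { apply continuous_Rmult; [apply continuous_const|].
      apply (continuous_comp (fun c => 1 - c ^ 2) sqrt); [|apply continuous_sqrt].
      apply @ex_derive_continuous. auto_derive; trivial. }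
    pose proof (continuity_2d_path _ (fun c => r * c)
      (fun c => r * sqrt (1 - c ^ 2)) c C1 Cx Cy) as K1.
    pose proof (continuity_2d_path _ (fun c => r * c)
      (fun c => r * sqrt (1 - c ^ 2)) c C2 Cx Cy) as K2.
    set (f := fun c => upper (re_part u) (r * c) (r * sqrt (1 - c ^ 2))) in *.
    set (g := fun c => upper (im_part u) (r * c) (r * sqrt (1 - c ^ 2))) in *.
    set (s := sqrt r). set (co := cos (- (k * r))). set (si := sin (- (k * r))).
    split.
    - apply (continuous_ext (fun c => s * co * f c - s * si * g c)).
      + intros t. unfold Pr, f, g, s, co, si. unfold Re; simpl. Rring.
      + apply continuous_Rminus; apply continuous_Rmult; trivial; apply continuous_const.
    - apply (continuous_ext (fun c => s * co * g c + s * si * f c)).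
      + intros t. unfold Pr, f, g, s, co, si. unfold Im; simpl. Rring.
      + apply continuous_Rplus; apply continuous_Rmult; trivial; apply continuous_const. }
  assert (Hsmall : forall w, 0 < w -> exists r, R0 < r /\ r0 < r /\
            forall s, r <= s -> Rabs A / s <= w).
  { intros w Hw. pose proof (Rabs_pos A) as HA.
    exists (Rmax R0 r0 + 1 + Rabs A / w).
    pose proof (Rmax_l R0 r0). pose proof (Rmax_r R0 r0).
    assert (0 <= Rabs A / w) by (apply Rdiv_le_0_compat; lra).
    split; [lra|split; [lra|]]. intros s Hs.
    apply Rmult_le_reg_r with s; [lra|].
    replace (Rabs A / s * s) with (Rabs A) by (field; lra).
    replace (Rabs A) with (Rabs A / w * w) by (field; lra). nra. }
  exists P. split; [|exact HP]. split; [|split; [|split]].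
  - intros c. split.
    + apply (continuous_uniform_limit _ (c - 1) (c + 1)); [lra|].
      intros w Hw. destruct (Hsmall w Hw) as [r [H1 [H2 H3]]].
      exists (fun c => Re (Pr r c)). split; [exact (proj1 (Hprc r c H1))|].
      intros t _. apply Rle_trans with (Rabs A / r); [|apply H3; lra].
      eapply Rle_trans; [|apply (Hclose r t H2)].
      apply (Rabs_Re_le (Pr r t - P t)%C).
    + apply (continuous_uniform_limit _ (c - 1) (c + 1)); [lra|].
      intros w Hw. destruct (Hsmall w Hw) as [r [H1 [H2 H3]]].
      exists (fun c => Im (Pr r c)). split; [exact (proj2 (Hprc r c H1))|].
      intros t _. apply Rle_trans with (Rabs A / r); [|apply H3; lra].
      eapply Rle_trans; [|apply (Hclose r t H2)].
      apply (Rabs_Im_le (Pr r t - P t)%C).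
  - apply HP0; lra.
  - apply HP0; lra.
  - intros eps Heps. destruct (Hsmall (eps / 2) ltac:(lra)) as [r [H1 [H2 H3]]].
    exists r. intros x y Hy Hr. destruct (Hkey x y Hy ltac:(lra)) as [E B].
    rewrite E.
    match goal with |- Cmod ?z < _ =>
      replace z with (expi (k * enorm (x, y)) * rho (x, y))%C by ring end.
    rewrite Cmod_mult, Cmod_expi, Rmult_1_l.
    eapply Rle_lt_trans; [exact B|]. specialize (H3 (enorm (x, y)) ltac:(lra)). lra.
Qed.

Lemma far_lin (k : R) (a b : C) (u v : R * R -> C) (P Q : R -> C) :
  far k u P -> far k v Q ->
  far k (fun x => (a * u x + b * v x)%C) (fun c => (a * P c + b * Q c)%C).
Proof.
  intros [P1 [P2 [P3 P4]]] [Q1 [Q2 [Q3 Q4]]]. split; [|split; [|split]].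
  - intros c. destruct (P1 c) as [A1 A2]. destruct (Q1 c) as [B1 B2]. split.
    + apply (continuous_ext (fun c => (Re a * Re (P c) - Im a * Im (P c)) +
        (Re b * Re (Q c) - Im b * Im (Q c)))); [intros t; reflexivity|].
      apply continuous_Rplus; apply continuous_Rminus; apply continuous_Rmult;
        trivial; apply continuous_const.
    + apply (continuous_ext (fun c => (Re a * Im (P c) + Im a * Re (P c)) +
        (Re b * Im (Q c) + Im b * Re (Q c)))); [intros t; reflexivity|].
      apply continuous_Rplus; apply continuous_Rplus; apply continuous_Rmult;
        trivial; apply continuous_const.
  - rewrite P2, Q2. ring.
  - rewrite P3, Q3. ring.
  - intros eps Heps. destruct (lin_eps a b eps Heps) as [e [He Hee]].
    destruct (P4 e He) as [r1 H1]. destruct (Q4 e He) as [r2 H2].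
    exists (Rmax r1 r2). intros x y Hy Hr.
    pose proof (Rmax_l r1 r2). pose proof (Rmax_r r1 r2).
    specialize (H1 x y Hy ltac:(lra)). specialize (H2 x y Hy ltac:(lra)).
    match goal with |- Cmod ?z < _ => replace z with
      (a * (RtoC (sqrt (enorm (x, y))) * u (x, y)
          - expi (k * enorm (x, y)) * P (x / enorm (x, y))%R) +
       b * (RtoC (sqrt (enorm (x, y))) * v (x, y)
          - expi (k * enorm (x, y)) * Q (x / enorm (x, y))%R))%C by ring end.
    now apply (Cmod_lin_lt a b _ _ eps e).
Qed.

Lemma continuous_C_bounded (P : R -> C) (a b : R) :
  a <= b -> continuous_C P -> exists B, 0 <= B /\ forall c, a <= c <= b -> Cmod (P c) <= B.
Proof.
  intros Hab HP.
  destruct (continuous_Rabs_bounded (fun c => Re (P c)) a b Hab) as [B1 [HB1 H1]].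
  { intros x _. exact (proj1 (HP x)). }
  destruct (continuous_Rabs_bounded (fun c => Im (P c)) a b Hab) as [B2 [HB2 H2]].
  { intros x _. exact (proj2 (HP x)). }
  exists (B1 + B2). split; [lra|]. intros c Hc.
  eapply Rle_trans; [apply Cmod_le_abs|].
  specialize (H1 c Hc). specialize (H2 c Hc). lra.
Qed.

Lemma far_bounded (k : R) (u : R * R -> C) (P : R -> C) :
  far k u P -> bounded_at_infinity u.
Proof.
  intros [HP [_ [_ H]]].
  destruct (continuous_C_bounded P (-1) 1 ltac:(lra) HP) as [B [HB HPB]].
  destruct (H 1 Rlt_0_1) as [rho Hrho].
  exists (B + 1), (Rmax rho 1). split; [lra|]. intros x y Hy Hr.
  pose proof (Rmax_l rho 1). pose proof (Rmax_r rho 1).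
  specialize (Hrho x y Hy ltac:(lra)).
  pose proof (cosine_range x y Hy) as Hc. specialize (HPB (x / enorm (x, y)) ltac:(lra)).
  assert (Hs : 1 <= sqrt (enorm (x, y))) by (rewrite <- sqrt_1 at 1; apply sqrt_le_1; lra).
  set (r := enorm (x, y)) in *. set (c := x / r) in *.
  assert (Hb : Cmod (RtoC (sqrt r) * u (x, y)) <= B + 1).
  { replace (RtoC (sqrt r) * u (x, y))%C with
      ((RtoC (sqrt r) * u (x, y) - expi (k * r) * P c) + expi (k * r) * P c)%C by ring.
    eapply Rle_trans; [apply Cmod_triangle|].
    rewrite (Cmod_mult (expi (k * r))), Cmod_expi. lra. }
  rewrite Cmod_mult, Cmod_R, Rabs_pos_eq in Hb by lra.
  pose proof (Cmod_ge_0 (u (x, y))). nra.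
Qed.

Lemma far_unique (k : R) (u v : R * R -> C) (P Q : R -> C) :
  far k u P -> far k v Q -> (forall x y, 0 < y -> exists r0, forall r, r0 < r ->
    u (r * x, r * y) = v (r * x, r * y)) ->
  forall c, -1 < c < 1 -> P c = Q c.
Proof.
  intros [_ [_ [_ HP]]] [_ [_ [_ HQ]]] Huv c Hc.
  assert (Hs : 0 < sqrt (1 - c ^ 2)) by (apply sqrt_lt_R0; nra).
  destruct (Huv c (sqrt (1 - c ^ 2)) Hs) as [r0 Hr0].
  assert (H0 : Cmod (P c - Q c)%C <= 0).
  { apply le_epsilon. intros eps Heps. rewrite Rplus_0_l.
    destruct (HP (eps / 2) ltac:(lra)) as [r1 H1].
    destruct (HQ (eps / 2) ltac:(lra)) as [r2 H2].
    set (r := Rmax r0 (Rmax r1 r2) + 1 + Rabs r0 + Rabs r1 + Rabs r2).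
    pose proof (Rmax_l r0 (Rmax r1 r2)). pose proof (Rmax_r r0 (Rmax r1 r2)).
    pose proof (Rmax_l r1 r2). pose proof (Rmax_r r1 r2).
    pose proof (Rabs_pos r0). pose proof (Rabs_pos r1). pose proof (Rabs_pos r2).
    pose proof (Rle_abs (- r0)) as Ha. rewrite Rabs_Ropp in Ha.
    assert (Hr : 0 < r) by (unfold r; lra).
    assert (Hy : 0 < r * sqrt (1 - c ^ 2)) by now apply Rmult_lt_0_compat.
    pose proof (enorm_of_cosine r c Hr Hc) as En.
    specialize (H1 _ _ Hy ltac:(rewrite En; unfold r; lra)).
    specialize (H2 _ _ Hy ltac:(rewrite En; unfold r; lra)).
    rewrite En in H1, H2. replace (r * c / r) with c in H1, H2 by (field; lra).
    rewrite (Hr0 r) in H1 by (unfold r; lra).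
    set (z := (RtoC (sqrt r) * v (r * c, r * sqrt (1 - c ^ 2))%R)%C) in *.
    replace (Cmod (P c - Q c)%C) with (Cmod (expi (k * r) * (P c - Q c))%C).
    2: { rewrite Cmod_mult, Cmod_expi. ring. }
    replace (expi (k * r) * (P c - Q c))%C with
      ((z - expi (k * r) * Q c) + - (z - expi (k * r) * P c))%C by ring.
    eapply Rle_trans; [apply Cmod_triangle|]. rewrite Cmod_opp. lra. }
  assert (E : (P c - Q c)%C = RtoC 0).
  { apply Cmod_eq_0. pose proof (Cmod_ge_0 (P c - Q c)%C). lra. }
  replace (P c) with ((P c - Q c) + Q c)%C by ring. rewrite E. ring.
Qed.

Lemma expi_lipschitz (a b : R) : Cmod (expi a - expi b)%C <= 2 * Rabs (a - b).
Proof.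
  eapply Rle_trans; [apply Cmod_le_abs|].
  change (Rabs (cos a - cos b) + Rabs (sin a - sin b) <= 2 * Rabs (a - b)).
  pose proof (sin_lipschitz a b). rewrite !cos_sin.
  pose proof (sin_lipschitz (PI / 2 + a) (PI / 2 + b)) as H1.
  replace (PI / 2 + a - (PI / 2 + b)) with (a - b) in H1 by ring. lra.
Qed.

Lemma continuous_C_uniform (P : R -> C) (a b : R) :
  continuous_C P -> forall eps, 0 < eps -> exists d, 0 < d /\
    forall x y, a <= x <= b -> a <= y <= b -> Rabs (x - y) < d ->
      Cmod (P x - P y)%C < eps.
Proof.
  intros HP eps Heps.
  destruct (Heine_cor2 (f := fun c => Re (P c)) (a := a) (b := b)) with
    (eps := mkposreal (eps / 2) ltac:(lra)) as [d1 H1].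
  { intros x _. apply continuity_pt_filterlim. exact (proj1 (HP x)). }
  destruct (Heine_cor2 (f := fun c => Im (P c)) (a := a) (b := b)) with
    (eps := mkposreal (eps / 2) ltac:(lra)) as [d2 H2].
  { intros x _. apply continuity_pt_filterlim. exact (proj2 (HP x)). }
  pose proof (cond_pos d1). pose proof (cond_pos d2).
  exists (Rmin d1 d2). split; [now apply Rmin_glb_lt|]. intros x y Hx Hy Hxy.
  pose proof (Rmin_l d1 d2). pose proof (Rmin_r d1 d2).
  specialize (H1 x y Hx Hy ltac:(lra)). specialize (H2 x y Hx Hy ltac:(lra)).
  simpl in H1, H2. eapply Rle_lt_trans; [apply Cmod_le_abs|].
  change (Rabs (Re (P x) - Re (P y)) + Rabs (Im (P x) - Im (P y)) < eps). lra.
Qed.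

(** From s^2 - r^2 = 2 l x + l^2 comes s = r + l cos + O(1 / r). The phase needs the first-order
    term of this expansion; for direction and amplitude it is enough that the changes are O(1 /
    r). *)
Lemma norm_shift_estimates (x y l : R) :
  0 < y -> 2 * Rabs l + 1 <= enorm (x, y) ->
  let r := enorm (x, y) in let s := enorm (l + x, y) in
  r / 2 <= s /\ 0 < s /\
  Rabs (s - (r + l * (x / r))) <= 2 * l ^ 2 / r /\
  Rabs ((l + x) / s - x / r) <= 4 * Rabs l / r /\
  Rabs (sqrt r / sqrt s - 1) <= 2 * Rabs l / r /\ 0 <= sqrt r / sqrt s <= 2.
Proof.
  intros Hy Hr r s. pose proof (enorm_triangle_fst x y l) as Ht.
  pose proof (enorm_sqr x y) as Er. pose proof (enorm_sqr (l + x) y) as Es.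
  pose proof (enorm_bounds x y) as [Hx _].
  fold r in Hr, Ht, Er, Hx. fold s in Ht, Es. clearbody r s.
  pose proof (Rabs_pos l) as Hl.
  assert (Ht' := Ht). apply Rabs_le_between in Ht'.
  assert (Hr0 : 0 < r) by lra. assert (Hs2 : r / 2 <= s) by lra.
  assert (Hs0 : 0 < s) by lra.
  assert (Hi : 0 < / s <= 2 / r).
  { split; [now apply Rinv_0_lt_compat|].
    apply Rmult_le_reg_r with (s * r); [nra|].
    replace (/ s * (s * r)) with r by (field; lra).
    replace (2 / r * (s * r)) with (2 * s) by (field; lra). lra. }
  assert (Hc : Rabs (x / r) <= 1).
  { unfold Rdiv. rewrite Rabs_mult, (Rabs_pos_eq (/ r)).
    2: { left. now apply Rinv_0_lt_compat. }
    apply Rmult_le_reg_r with r; trivial.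
    rewrite Rmult_assoc, Rinv_l by lra. lra. }
  assert (HA : Rabs (s - (r + l * (x / r))) <= 2 * l ^ 2 / r).
  { assert (E : s - r = (2 * l * x + l ^ 2) / (r + s)).
    { apply Rmult_eq_reg_r with (r + s); [|lra].
      replace ((2 * l * x + l ^ 2) / (r + s) * (r + s)) with (2 * l * x + l ^ 2)
        by (field; lra).
      replace ((s - r) * (r + s)) with (s ^ 2 - r ^ 2) by ring.
      rewrite Er, Es. ring. }
    replace (s - (r + l * (x / r))) with
      ((l * (x / r) * (r - s) + l ^ 2) * / (r + s)).
    2: { replace (s - (r + l * (x / r))) with ((s - r) - l * (x / r)) by ring.
         rewrite E. field. lra. }
    replace (2 * l ^ 2 / r) with ((Rabs l * 1 * Rabs l + l ^ 2) * / r).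
    2: { rewrite Rmult_1_r, <- Rabs_mult, Rabs_pos_eq by nra. field. lra. }
    apply Rabs_mult_le.
    - eapply Rle_trans; [apply Rabs_triang|].
      rewrite (Rabs_pos_eq (l ^ 2)) by apply pow2_ge_0.
      apply Rplus_le_compat_r. apply Rabs_mult_le.
      + apply Rabs_mult_le; [lra|exact Hc].
      + now rewrite Rabs_minus_sym.
    - rewrite Rabs_pos_eq by (left; apply Rinv_0_lt_compat; lra).
      apply Rinv_le_contravar; lra. }
  assert (HB : Rabs ((l + x) / s - x / r) <= 4 * Rabs l / r).
  { replace ((l + x) / s - x / r) with ((l + (x / r) * (r - s)) * / s)
      by (field; lra).
    replace (4 * Rabs l / r) with ((Rabs l + 1 * Rabs l) * (2 / r)) by (field; lra).
    apply Rabs_mult_le.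
    - eapply Rle_trans; [apply Rabs_triang|]. apply Rplus_le_compat_l.
      apply Rabs_mult_le; [exact Hc|]. now rewrite Rabs_minus_sym.
    - rewrite Rabs_pos_eq; lra. }
  assert (Hsr : 0 < sqrt r) by now apply sqrt_lt_R0.
  assert (Hss : 0 < sqrt s) by now apply sqrt_lt_R0.
  assert (Er' : sqrt r * sqrt r = r) by (apply sqrt_sqrt; lra).
  assert (Es' : sqrt s * sqrt s = s) by (apply sqrt_sqrt; lra).
  assert (HC : Rabs (sqrt r / sqrt s - 1) <= 2 * Rabs l / r).
  { replace (sqrt r / sqrt s - 1) with ((r - s) * / (sqrt s * (sqrt r + sqrt s))).
    2: { rewrite <- Er', <- Es' at 1. field. lra. }
    replace (2 * Rabs l / r) with (Rabs l * (2 / r)) by (field; lra).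
    apply Rabs_mult_le; [now rewrite Rabs_minus_sym|].
    rewrite Rabs_pos_eq by (left; apply Rinv_0_lt_compat; nra).
    apply Rle_trans with (/ s); [|lra]. apply Rinv_le_contravar; nra. }
  assert (HD : 0 <= sqrt r / sqrt s <= 2).
  { split; [apply Rdiv_le_0_compat; lra|].
    apply Rabs_le_between in HC.
    assert (2 * Rabs l / r <= 1).
    { apply Rmult_le_reg_r with r; trivial.
      replace (2 * Rabs l / r * r) with (2 * Rabs l) by (field; lra). lra. }
    lra. }
  tauto.
Qed.

(** By the expansion of the shifted norm, exp(i k s) is exp(i k r) exp(i k l c) up to O(1 / r); this
    is where the phase comes from. *)
Lemma far_translate (k l : R) (u : R * R -> C) (P : R -> C) :
  0 < k -> far k u P ->
  far k (translate l u) (fun c => (expi (k * l * c) * P c)%C).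
Proof.
  intros Hk [P1 [P2 [P3 P4]]]. split; [|split; [|split]].
  - intros c. destruct (P1 c) as [A1 A2].
    assert (K1 : continuous (fun c => cos (k * l * c)) c).
    { apply @ex_derive_continuous. auto_derive; trivial. }
    assert (K2 : continuous (fun c => sin (k * l * c)) c).
    { apply @ex_derive_continuous. auto_derive; trivial. }
    split.
    + apply (continuous_ext (fun c => cos (k * l * c) * Re (P c)
        - sin (k * l * c) * Im (P c))); [intros t; reflexivity|].
      apply continuous_Rminus; now apply continuous_Rmult.
    + apply (continuous_ext (fun c => cos (k * l * c) * Im (P c)
        + sin (k * l * c) * Re (P c))); [intros t; reflexivity|].
      apply continuous_Rplus; now apply continuous_Rmult.
  - rewrite P2. ring.
  - rewrite P3. ring.
  - intros eps Heps.
    destruct (continuous_C_bounded P (-1) 1 ltac:(lra) P1) as [B [HB HPB]].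
    destruct (continuous_C_uniform P (-1) 1 P1 (eps / 8) ltac:(lra)) as [d [Hd HPd]].
    destruct (P4 (eps / 8) ltac:(lra)) as [rho Hrho].
    pose proof (Rabs_pos l) as Hl. pose proof (pow2_ge_0 l) as Hl2.
    set (K := B * (2 * Rabs l) + B * (4 * k * l ^ 2)).
    assert (HK1 : 0 <= B * (2 * Rabs l)) by (apply Rmult_le_pos; lra).
    assert (HK2 : 0 <= B * (4 * k * l ^ 2)).
    { apply Rmult_le_pos; [lra|]. apply Rmult_le_pos; lra. }
    assert (Hq1 : 0 <= K / (eps / 8)).
    { apply Rdiv_le_0_compat; unfold K; lra. }
    assert (Hq2 : 0 <= 4 * Rabs l / d) by (apply Rdiv_le_0_compat; lra).
    exists (2 * Rabs l + 1 + Rabs rho * 2 + K / (eps / 8) + 4 * Rabs l / d).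
    intros x y Hy Hr. pose proof (Rabs_pos rho). pose proof (Rle_abs rho).
    destruct (norm_shift_estimates x y l Hy ltac:(lra))
      as [S1 [S2 [S3 [S4 [S5 S6]]]]].
    specialize (Hrho (l + x) y Hy ltac:(lra)).
    pose proof (cosine_range x y Hy) as Hc. pose proof (cosine_range (l + x) y Hy) as Hc'.
    unfold translate; simpl fst; simpl snd.
    set (r := enorm (x, y)) in *. set (s := enorm (l + x, y)) in *.
    set (c := x / r) in *. set (c' := (l + x) / s) in *.
    set (v := u (l + x, y)) in *.
    assert (Hr0 : 0 < r) by lra.
    assert (Hss : 0 < sqrt s) by now apply sqrt_lt_R0.
    set (q := sqrt r / sqrt s) in *.
    assert (Eq : sqrt r = q * sqrt s) by (unfold q; field; lra).
    assert (HKr : K / r <= eps / 8).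
    { apply Rmult_le_reg_r with r; trivial.
      replace (K / r * r) with K by (field; lra).
      replace K with (K / (eps / 8) * (eps / 8)) by (field; lra). nra. }
    assert (Hcd : 4 * Rabs l / r < d).
    { apply Rmult_lt_reg_r with r; trivial.
      replace (4 * Rabs l / r * r) with (4 * Rabs l / d * d) by (field; lra). nra. }
    specialize (HPd c' c ltac:(lra) ltac:(lra) ltac:(lra)).
    specialize (HPB c' ltac:(lra)).
    rewrite Eq, RtoC_mult.
    (* Four errors in turn: the asymptotics at the shifted point, the amplitude ratio, the phase,
       and the change of direction. *)
    match goal with |- Cmod ?z < _ => replace z with
      (RtoC q * (RtoC (sqrt s) * v - expi (k * s) * P c')
       + RtoC (q - 1) * (expi (k * s) * P c')
       + (expi (k * s) - expi (k * (r + l * c))) * P c'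
       + expi (k * (r + l * c)) * (P c' - P c))%C end.
    2: { replace (k * (r + l * c)) with (k * r + k * l * c) by ring.
         rewrite expi_plus, RtoC_minus. ring. }
    assert (T1 : Cmod (RtoC q * (RtoC (sqrt s) * v - expi (k * s) * P c')) <= 2 * (eps / 8)).
    { rewrite Cmod_mult, Cmod_R, Rabs_pos_eq by lra.
      apply Rmult_le_compat; try lra. apply Cmod_ge_0. }
    assert (T2 : Cmod (RtoC (q - 1) * (expi (k * s) * P c')) <= 2 * Rabs l / r * B).
    { rewrite Cmod_mult, Cmod_R, Cmod_mult, Cmod_expi, Rmult_1_l.
      apply Rmult_le_compat; trivial; [apply Rabs_pos|apply Cmod_ge_0]. }
    assert (T3 : Cmod ((expi (k * s) - expi (k * (r + l * c))) * P c')
                 <= 4 * k * l ^ 2 / r * B).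
    { rewrite Cmod_mult. apply Rmult_le_compat; trivial; try apply Cmod_ge_0.
      eapply Rle_trans; [apply expi_lipschitz|].
      rewrite <- Rmult_minus_distr_l, Rabs_mult, (Rabs_pos_eq k) by lra.
      replace (4 * k * l ^ 2 / r) with (2 * (k * (2 * l ^ 2 / r))) by (field; lra).
      apply Rmult_le_compat_l; [lra|]. apply Rmult_le_compat_l; lra. }
    assert (T4 : Cmod (expi (k * (r + l * c)) * (P c' - P c)) <= eps / 8).
    { rewrite Cmod_mult, Cmod_expi. lra. }
    assert (T23 : 2 * Rabs l / r * B + 4 * k * l ^ 2 / r * B = K / r).
    { unfold K. field. lra. }
    eapply Rle_lt_trans; [apply Cmod_triangle|].
    eapply Rle_lt_trans; [apply Rplus_le_compat_r, Cmod_triangle|].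
    eapply Rle_lt_trans; [apply Rplus_le_compat_r, Rplus_le_compat_r, Cmod_triangle|].
    lra.
Qed.

Lemma enorm_polar (r t : R) : 0 <= r -> enorm (r * cos t, r * sin t) = r.
Proof.
  intros Hr. change (sqrt (r * cos t * (r * cos t) + r * sin t * (r * sin t)) = r).
  replace (r * cos t * (r * cos t) + r * sin t * (r * sin t)) with
    ((r * cos t) ^ 2 + (r * sin t) ^ 2) by ring.
  rewrite polar_norm. now apply sqrt_pow2.
Qed.

Lemma csol_radiating (h : R -> R) (k : R) (u : R * R -> C) (P : R -> C) :
  admissible h -> csol h k u -> flat_zero h u -> far k u P ->
  exists R0, 0 <= R0 /\ (forall x y, exterior R0 x y -> above h (x, y)) /\
    radiating k R0 (upper (re_part u)) (re_part (pd1 u)) (re_part (pd2 u))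
      (upper (im_part u)) (im_part (pd1 u)) (im_part (pd2 u))
      (fun t => Re (P (cos t))) (fun t => Im (P (cos t))).
Proof.
  intros Hh Hu Hz [HP [HP1 [HPm1 Hfar]]].
  destruct (csol_upper_continuity h k u Hh Hu Hz) as [R0 [HR0 [Habove Hcont]]].
  destruct Hu as [Hw [_ Hs]].
  assert (Hext : forall x y, exterior R0 x y -> above h (x, y)).
  { intros x y [Hy Hxy]. now apply Habove. }
  assert (HOe : open_2d (exterior R0)).
  { apply open_2d_and.
    - apply (open_2d_continuous _ (fun x y => y)); [|tauto].
      intros; apply continuity_2d_pt_id2.
    - apply (open_2d_continuous _ (fun x y => x ^ 2 + y ^ 2 - R0 ^ 2)).
      + intros x y. apply continuity_2d_pt_minus; [|apply continuity_2d_pt_const].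
        apply continuity_2d_pt_plus.
        * apply (continuity_2d_fst (fun x => x ^ 2)).
          apply @ex_derive_continuous; auto_derive; trivial.
        * apply (continuity_2d_snd (fun x => x ^ 2)).
          apply @ex_derive_continuous; auto_derive; trivial.
      + intros; lra. }
  destruct (wave_helmholtz _ _ _ Hw) as [Hp Hq].
  exists R0. split; [lra|split; [exact Hext|]].
  split; [split|split; [|split; [|split]]].
  - apply (helmholtz_ext k _ (re_part u)); trivial.
    + intros x y [Hy _]. now rewrite upper_pos.
    + apply (helmholtz_sub k (uncurried (above h))); trivial.
  - apply (helmholtz_ext k _ (im_part u)); trivial.
    + intros x y [Hy _]. now rewrite upper_pos.
    + apply (helmholtz_sub k (uncurried (above h))); trivial.
  - intros r. split; intros x y [Hxy _]; destruct (Hcont x y Hxy) as [C1 C2];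
      (split; [assumption|intros; now apply upper_nonpos]).
  - intros t _. destruct (HP (cos t)) as [C1 C2]. split.
    + exact (continuous_comp cos (fun c => Re (P c)) t (continuous_cos t) C1).
    + exact (continuous_comp cos (fun c => Im (P c)) t (continuous_cos t) C2).
  - intros w Hw0. destruct (Hs w Hw0) as [rho Hrho].
    exists (Rmax rho R0). intros r t Hr Ht.
    pose proof (Rmax_l rho R0). pose proof (Rmax_r rho R0).
    assert (Hy : 0 < r * sin t).
    { apply Rmult_lt_0_compat; [lra|apply sin_gt_0; lra]. }
    pose proof (enorm_polar r t ltac:(lra)) as En.
    assert (HD : above h (r * cos t, r * sin t)).
    { apply Hext. split; trivial. rewrite polar_norm. nra. }
    specialize (Hrho _ HD ltac:(rewrite En; lra)).
    unfold radial_derivative, direction in Hrho.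
    cbv [fst snd] in Hrho. rewrite En in Hrho.
    replace (r * cos t / r) with (cos t) in Hrho by (field; lra).
    replace (r * sin t / r) with (sin t) in Hrho by (field; lra).
    unfold radial, polar. rewrite !upper_pos by trivial.
    unfold re_part, im_part.
    set (Y := (r * cos t, r * sin t)) in *.
    match type of Hrho with Cmod ?z < _ => set (Z := z) in * end.
    pose proof (Rabs_Re_le Z) as B1. pose proof (Rabs_Im_le Z) as B2.
    split.
    + replace (sqrt r * (cos t * Re (pd1 u Y) + sin t * Re (pd2 u Y) + k * Im (u Y)))
        with (Re Z); [lra|]. unfold Z, Re, Im; simpl. ring.
    + replace (sqrt r * (cos t * Im (pd1 u Y) + sin t * Im (pd2 u Y) - k * Re (u Y)))
        with (Im Z); [lra|]. unfold Z, Re, Im; simpl. ring.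
  - intros w Hw0. destruct (Hfar w Hw0) as [rho Hrho].
    exists (Rmax rho R0). intros r t Hr Ht.
    pose proof (Rmax_l rho R0). pose proof (Rmax_r rho R0).
    destruct (classic (0 < t < PI)) as [Hti|Hti].
    + assert (Hy : 0 < r * sin t).
      { apply Rmult_lt_0_compat; [lra|apply sin_gt_0; lra]. }
      pose proof (enorm_polar r t ltac:(lra)) as En.
      specialize (Hrho _ _ Hy ltac:(rewrite En; lra)). rewrite En in Hrho.
      replace (r * cos t / r) with (cos t) in Hrho by (field; lra).
      unfold polar. rewrite !upper_pos by trivial. unfold re_part, im_part.
      set (Y := (r * cos t, r * sin t)) in *.
      match type of Hrho with Cmod ?z < _ => set (Z := z) in * end.
      pose proof (Rabs_Re_le Z) as B1. pose proof (Rabs_Im_le Z) as B2.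
      split.
      * match goal with |- Rabs ?z <= _ => replace z with (Re Z) end; [lra|].
        unfold Z, Re, Im, expi; simpl. ring.
      * match goal with |- Rabs ?z <= _ => replace z with (Im Z) end; [lra|].
        unfold Z, Re, Im, expi; simpl. ring.
    (* At the two ends the field vanishes by extension and the far field because P(1) = P(-1) =
       0. *)
    + assert (Hend : t = 0 \/ t = PI) by lra.
      assert (HPt : P (cos t) = RtoC 0).
      { destruct Hend as [-> | ->]; [now rewrite cos_0|now rewrite cos_PI]. }
      assert (Hst : sin t = 0).
      { destruct Hend as [-> | ->]; [apply sin_0|apply sin_PI]. }
      unfold polar. rewrite HPt, Hst, Rmult_0_r, !upper_nonpos by lra.
      unfold Re, Im; simpl.
      split; match goal with |- Rabs ?z <= _ => replace z with 0 by ring end;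
        rewrite Rabs_R0; lra.
Qed.

(** * Unique continuation from infinity down to the surface *)

(** Odd reflection in a horizontal line inside the zero region turns the problem into one with
    Dirichlet data on a half disk, to which [half_disk_unique_continuation] applies. The zero region
    gains w / 4 in depth and may lose width. *)
Lemma unique_continuation_step (k w x0 c d : R) (D : R -> R -> Prop)
  (f f1 f2 : R -> R -> R) :
  0 < w -> 0 < d -> open_2d D -> helmholtz k D f f1 f2 ->
  (forall x y, Rabs (x - x0) < w -> c - w / 2 < y -> D x y) ->
  (forall x y, Rabs (x - x0) < d -> c < y -> f x y = 0) ->
  exists d', 0 < d' /\ forall x y, Rabs (x - x0) < d' -> c - w / 4 < y -> f x y = 0.
Proof.
  intros HR Hd HO Hf HD Hz.
  set (d' := Rmin (d / 2) (w / 2)). exists d'.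
  pose proof (Rmin_l (d / 2) (w / 2)). pose proof (Rmin_r (d / 2) (w / 2)).
  split; [apply Rmin_glb_lt; lra|]. intros x y Hx Hy. fold d' in H, H0.
  (* The centre sits w / 8 inside the zero region, so that [f] vanishes in a full neighbourhood of
     it; a half disk of radius w / 2 about it still reaches below c - w / 4. *)
  set (c1 := c + w / 8).
  destruct (Rle_or_lt c1 y) as [Hyc|Hyc]; [apply Hz; unfold c1 in *; lra|].
  assert (HDd : forall a b, a ^ 2 + b ^ 2 < (w / 2) ^ 2 -> D (x + a) (c1 + b)).
  { intros a b Hab. apply HD.
    - assert (Rabs a < w / 2).
      { 
        rewrite <- (Rabs_pos_eq (w / 2)) by lra. apply Rsqr_lt_abs_0.
        unfold Rsqr. nra. }
      pose proof (Rabs_triang a (x - x0)) as Ht.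
      replace (a + (x - x0)) with (x + a - x0) in Ht by ring. lra.
    - unfold c1. assert (- (w / 2) < b) by nra. lra. }
  assert (Kf : forall a b, D a b -> continuity_2d_pt f a b).
  { destruct Hf as [f11 [f12 [f21 [f22 Hf]]]].
    intros a b Hab. apply (C1_continuity D f f1 f2); trivial.
    intros u v Huv. exact (proj1 (Hf u v Huv)). }
  pose proof (helmholtz_shift k x c1 D f f1 f2 Hf) as Hs.
  pose proof (helmholtz_reflect k _ _ _ _ Hs) as Hr.
  apply (helmholtz_sub k _ (half_annulus 0 (w / 2))) in Hs.
  2: { intros a b [_ Hab]. apply HDd. lra. }
  apply (helmholtz_sub k _ (half_annulus 0 (w / 2))) in Hr.
  2: { intros a b [_ Hab]. apply HDd. nra. }
  (* The field minus its reflection solves the equation and vanishes on the line. As [f] is zero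
     above the line, the vanishing of this difference gives [f = 0] below it. *)
  pose proof (helmholtz_lin k 1 (-1) _ _ _ _ _ _ _ Hs Hr) as Hv.
  set (v := fun a b => 1 * f (x + a) (c1 + b) + -1 * f (x + a) (c1 + - b)) in Hv.
  apply (helmholtz_ext k _ _ (upper v)) in Hv.
  2: { apply open_half_annulus. }
  2: { intros a b [Hb _]. now rewrite upper_pos. }
  assert (Kv : forall a b, a ^ 2 + b ^ 2 < (w / 2) ^ 2 -> continuity_2d_pt v a b).
  { intros a b Hab. unfold v. apply continuity_2d_pt_plus.
    - apply continuity_2d_pt_mult; [apply continuity_2d_pt_const|].
      apply (continuity_2d_shift f), Kf. now apply HDd.
    - apply continuity_2d_pt_mult; [apply continuity_2d_pt_const|].
      apply (continuity_2d_comp f (fun a _ => x + a) (fun _ b => c1 + - b)).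
      + apply Kf, HDd. nra.
      + apply continuity_2d_pt_plus; [apply continuity_2d_pt_const|].
        apply continuity_2d_pt_id1.
      + apply continuity_2d_pt_plus; [apply continuity_2d_pt_const|].
        apply continuity_2d_pt_opp, continuity_2d_pt_id2. }
  assert (Hsym : upper v 0 (c1 - y) = 0).
  { eapply (half_disk_unique_continuation k (w / 2) (Rmin (d / 2) (w / 8)) (upper v));
      [| exact Hv | | | | |].
    - apply Rmin_glb_lt; lra.
    - intros a b [_ Hab]. split; [|intros; now apply upper_nonpos].
      apply upper_continuity; [intros _; now apply Kv|].
      intros Hb0 eps Heps. destruct (Kv a b Hab (mkposreal eps Heps)) as [e He].
      exists e. split; [apply cond_pos|]. intros a' b' _ A1 A2.
      specialize (He a' b' A1 A2). simpl in He.
      replace (v a b) with 0 in He.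
      2: { unfold v. rewrite Hb0, Ropp_0. ring. }
      now rewrite Rminus_0_r in He.
    - intros a b [_ Hab].
      pose proof (Rmin_l (d / 2) (w / 8)). pose proof (Rmin_r (d / 2) (w / 8)).
      assert (Hm : 0 < Rmin (d / 2) (w / 8)) by (apply Rmin_glb_lt; lra).
      set (m := Rmin (d / 2) (w / 8)) in *. clearbody m.
      destruct (Rle_or_lt b 0); [now apply upper_nonpos|].
      rewrite upper_pos by trivial. unfold v.
      assert (Ha : Rabs a < m).
      { rewrite <- (Rabs_pos_eq m) by lra. apply Rsqr_lt_abs_0. unfold Rsqr. nra. }
      assert (Hb : b < m) by nra.
      pose proof (Rabs_triang a (x - x0)) as Ht.
      replace (a + (x - x0)) with (x + a - x0) in Ht by ring.
      rewrite !Hz by (unfold c1; lra). ring.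
    - lra.
    - unfold c1 in *. assert (0 <= c + w / 8 - y < w / 2) by lra. nra.
    - lra. }
  rewrite upper_pos in Hsym by lra. unfold v in Hsym.
  replace (c1 + - (c1 - y)) with y in Hsym by ring. rewrite Rplus_0_r in Hsym.
  rewrite (Hz x (c1 + (c1 - y))) in Hsym by (unfold c1 in *; lra). lra.
Qed.

(** Descent in steps of w / 4 inside a vertical strip that stays above the surface. The width of the
    zero region depends on the step, which is harmless since finitely many steps reach the given
    point. *)
Lemma unique_continuation_down (k T : R) (h : R -> R) (f f1 f2 : R -> R -> R) :
  (forall t, continuous h t) -> helmholtz k (uncurried (above h)) f f1 f2 ->
  (forall x y, T < y -> f x y = 0) ->
  forall x y, h x < y -> f x y = 0.
Proof.
  intros Hh Hf Hz x0 y0 Hxy.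
  pose proof (open_above h Hh) as HO.
  assert (HR : exists w, 0 < w /\ forall t, Rabs (t - x0) < w -> h t < y0 - w).
  { pose proof (Hh x0) as Hc. apply continuity_pt_filterlim in Hc.
    rewrite continuity_pt_locally in Hc.
    destruct (Hc (mkposreal ((y0 - h x0) / 2) ltac:(lra))) as [e He].
    pose proof (cond_pos e).
    exists (Rmin e ((y0 - h x0) / 2)).
    pose proof (Rmin_l e ((y0 - h x0) / 2)). pose proof (Rmin_r e ((y0 - h x0) / 2)).
    split; [apply Rmin_glb_lt; lra|]. intros t Ht.
    assert (Hb : ball x0 e t) by (change (Rabs (t - x0) < e); lra).
    specialize (He t Hb). simpl in He. apply Rabs_def2 in He. lra. }
  destruct HR as [w [HR Hstrip]].
  (* The floor at y0 - w / 8 keeps the half disks, which reach down by w / 2, above y0 - w and hence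
     above the surface. *)
  assert (Hn : forall n : nat, exists d, 0 < d /\ forall x y, Rabs (x - x0) < d ->
            Rmax (T - INR n * (w / 4)) (y0 - w / 8) < y -> f x y = 0).
  { induction n as [|n [d [Hd IH]]].
    - exists 1. split; [lra|]. intros x y _ Hy. apply Hz.
      pose proof (Rmax_l (T - INR 0 * (w / 4)) (y0 - w / 8)). simpl INR in *. lra.
    - set (c := Rmax (T - INR n * (w / 4)) (y0 - w / 8)) in *.
      assert (Hc : y0 - w / 8 <= c) by apply Rmax_r.
      destruct (unique_continuation_step k w x0 c d (uncurried (above h)) f f1 f2)
        as [d' [Hd' H]]; trivial.
      { intros x y Hx Hy. unfold uncurried, above; simpl.
        specialize (Hstrip x Hx). lra. }
      exists d'. split; trivial. intros x y Hx Hy. apply H; trivial.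
      eapply Rle_lt_trans; [|exact Hy].
      assert (c <= Rmax (T - INR (S n) * (w / 4)) (y0 - w / 8) + w / 4); [|lra].
      rewrite S_INR. apply Rmax_lub.
      + pose proof (Rmax_l (T - (INR n + 1) * (w / 4)) (y0 - w / 8)). lra.
      + pose proof (Rmax_r (T - (INR n + 1) * (w / 4)) (y0 - w / 8)). lra. }
  destruct (INR_unbounded ((T - (y0 - w / 8)) / (w / 4))) as [n Hnn].
  destruct (Hn n) as [d [Hd H]]. apply H.
  - rewrite Rminus_diag, Rabs_R0. exact Hd.
  - apply Rmax_lub_lt; [|lra].
    assert ((T - (y0 - w / 8)) / (w / 4) * (w / 4) = T - (y0 - w / 8)) by (field; lra).
    nra.
Qed.

(** * The scattering problem for two plane waves *)

Definition plane_data (th k : R) (x : R * R) : C :=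
  (expi (k * dot (inc_dir th) x) - expi (k * dot (refl_dir th) x))%C.

Lemma incident_plus_reflected (th1 th2 k : R) (x : R * R) :
  (incident th1 th2 k x + reflected th1 th2 k x =
   plane_data th1 k x + plane_data th2 k x)%C.
Proof. unfold incident, reflected, plane_data. ring. Qed.

(** Incident and reflected directions have the same horizontal component, so a horizontal shift
    multiplies both waves by one and the same phase. *)
Lemma plane_data_translate (th k l x y : R) :
  plane_data th k (l + x, y) = (expi (k * l * sin th) * plane_data th k (x, y))%C.
Proof.
  unfold plane_data, inc_dir, refl_dir, dot; simpl fst; simpl snd.
  replace (k * (sin th * (l + x) + - cos th * y)) with
    (k * l * sin th + k * (sin th * x + - cos th * y)) by ring.
  replace (k * (sin th * (l + x) + cos th * y)) with
    (k * l * sin th + k * (sin th * x + cos th * y)) by ring.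
  rewrite !expi_plus. ring.
Qed.

Lemma plane_data_flat (th k x : R) : plane_data th k (x, 0) = RtoC 0.
Proof.
  unfold plane_data, inc_dir, refl_dir, dot; simpl fst; simpl snd.
  rewrite !Rmult_0_r. ring.
Qed.

(** Up to a common unimodular factor, the sum of incident and reflected wave is exp(-i B) - exp(i B)
    = - 2 i sin B with B = k cos(th) y. *)
Lemma plane_data_zero (th k x y : R) :
  plane_data th k (x, y) = RtoC 0 -> sin (k * cos th * y) = 0.
Proof.
  unfold plane_data, inc_dir, refl_dir, dot; simpl fst; simpl snd. intros H.
  set (A := k * sin th * x). set (B := k * cos th * y).
  replace (k * (sin th * x + - cos th * y)) with (A + - B) in H by (unfold A, B; ring).
  replace (k * (sin th * x + cos th * y)) with (A + B) in H by (unfold A, B; ring).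
  rewrite !expi_plus in H.
  assert (H2 : (expi (- B) - expi B)%C = RtoC 0).
  { replace (expi (- B) - expi B)%C with
      (expi (- A) * expi A * (expi (- B) - expi B))%C by (rewrite expi_opp; ring).
    replace (expi (- A) * expi A * (expi (- B) - expi B))%C with
      (expi (- A) * (expi A * expi (- B) - expi A * expi B))%C by ring.
    rewrite H. ring. }
  apply (f_equal Im) in H2. unfold expi, Im in H2; simpl in H2.
  rewrite sin_neg in H2. lra.
Qed.

(** The values of [h] lie in the discrete set of multiples of pi / B, while [h] is continuous and
    zero far away. *)
Lemma sine_vanishing_profile (h : R -> R) (B : R) :
  admissible h -> 0 < B -> (forall t, sin (B * h t) = 0) -> forall t, h t = 0.
Proof.
  intros [Hc [M HM]] HB Hs t.
  destruct (Req_dec (h t) 0) as [|Hne]; trivial. exfalso.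
  pose proof PI_RGT_0 as HPI.
  assert (Hh0 : h (Rabs M + 1) = 0).
  { apply HM. pose proof (Rle_abs M). pose proof (Rabs_pos M).
    rewrite Rabs_pos_eq; lra. }
  assert (Hp : 0 < Rabs (h t)) by now apply Rabs_pos_lt.
  (* The intermediate value [e * h t] makes the argument of the sine nonzero and at most pi / 2 in
     absolute value. *)
  set (e := Rmin 1 (PI / 2 / (B * Rabs (h t)))).
  assert (He : 0 < e).
  { apply Rmin_glb_lt; [lra|]. apply Rdiv_lt_0_compat; [lra|].
    now apply Rmult_lt_0_compat. }
  assert (He1 : e <= 1) by apply Rmin_l.
  assert (HeB : e * (B * Rabs (h t)) <= PI / 2).
  { apply Rle_trans with (PI / 2 / (B * Rabs (h t)) * (B * Rabs (h t))).
    - apply Rmult_le_compat_r; [apply Rmult_le_pos; lra|apply Rmin_r].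
    - right. field. lra. }
  clearbody e.
  destruct (IVT_gen h (Rabs M + 1) t (e * h t)) as [s [_ Es]].
  { intros x. apply continuity_pt_filterlim, Hc. }
  { rewrite Hh0. unfold Rmin, Rmax.
    destruct (Rle_dec 0 (h t)); split; nra. }
  specialize (Hs s). rewrite Es in Hs.
  destruct (Rle_or_lt 0 (h t)) as [Hpos|Hneg].
  - rewrite Rabs_pos_eq in * by lra.
    assert (0 < sin (B * (e * h t))); [|lra].
    apply sin_gt_0; [|nra]. apply Rmult_lt_0_compat; [lra|nra].
  - rewrite Rabs_left in * by lra.
    assert (0 < sin (- (B * (e * h t)))); [|rewrite sin_neg in *; lra].
    replace (- (B * (e * h t))) with (e * (B * - h t)) by ring.
    apply sin_gt_0; [|lra].
    apply Rmult_lt_0_compat; [|apply Rmult_lt_0_compat]; lra.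
Qed.

Lemma csol_boundary_zero (h : R -> R) (k : R) (u : R * R -> C) :
  csol h k u -> (forall x, above h x -> u x = RtoC 0) ->
  forall x, graph h x -> u x = RtoC 0.
Proof.
  intros [_ [Hc _]] Hz [x y] Hx. apply Cmod_eq_0.
  apply Rle_antisym; [|apply Cmod_ge_0]. apply le_epsilon. intros eps Heps.
  rewrite Rplus_0_l. unfold graph in Hx; simpl in Hx.
  destruct (proj1 (continuous_on_set_eps _ _) Hc (x, y)) with (eps := eps)
    as [d [Hd H]]; trivial.
  { unfold above_or_on; simpl. lra. }
  specialize (H (x, y + d / 2)). simpl fst in H; simpl snd in H.
  rewrite Hz in H by (unfold above; simpl; lra).
  left. rewrite <- Cmod_opp. replace (- u (x, y))%C with (RtoC 0 - u (x, y))%C by ring.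
  apply H.
  - unfold above_or_on; simpl. lra.
  - rewrite Rminus_diag, Rabs_R0. exact Hd.
  - replace (y + d / 2 - y) with (d / 2) by ring. rewrite Rabs_pos_eq; lra.
Qed.

Lemma csol_far_arc_zero (h : R -> R) (k t0 d : R) (u : R * R -> C) (P : R -> C) :
  0 < k -> admissible h -> csol h k u -> flat_zero h u -> far k u P ->
  0 < t0 < PI -> 0 < d -> (forall t, Rabs (t - t0) < d -> P (cos t) = RtoC 0) ->
  forall x, above h x -> u x = RtoC 0.
Proof.
  intros Hk Hh Hu Hz HP Ht0 Hd Harc.
  destruct (csol_radiating h k u P Hh Hu Hz HP) as [R0 [HR0 [Hext HU]]].
  set (e := Rmin d (Rmin t0 (PI - t0))).
  assert (He : 0 < e) by (repeat apply Rmin_glb_lt; lra).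
  assert (e <= d) by apply Rmin_l.
  assert (Hm : e <= Rmin t0 (PI - t0)) by apply Rmin_r.
  pose proof (Rmin_l t0 (PI - t0)). pose proof (Rmin_r t0 (PI - t0)).
  assert (Hout : forall x y, exterior R0 x y ->
            upper (re_part u) x y = 0 /\ upper (im_part u) x y = 0).
  { eapply (radiating_arc_zero k R0 (t0 - e) (t0 + e)); try exact HU; trivial; try lra.
    intros t Ht. cbv beta. rewrite Harc by (apply Rabs_def1; lra). split; reflexivity. }
  assert (Hup : forall x y, R0 < y -> re_part u x y = 0 /\ im_part u x y = 0).
  { intros x y Hy. destruct (Hout x y) as [A B].
    { split; [lra|]. nra. }
    rewrite upper_pos in A, B by lra. now split. }
  destruct Hu as [Hw _]. destruct (wave_helmholtz _ _ _ Hw) as [Hp Hq].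
  intros [x y] Hx. unfold above in Hx; simpl in Hx.
  apply injective_projections.
  - exact (unique_continuation_down k R0 h _ _ _ (proj1 Hh) Hp
      (fun x y H => proj1 (Hup x y H)) x y Hx).
  - exact (unique_continuation_down k R0 h _ _ _ (proj1 Hh) Hq
      (fun x y H => proj2 (Hup x y H)) x y Hx).
Qed.

Lemma single_wave_far_nonzero (h : R -> R) (k th t0 d : R) (u : R * R -> C) (P : R -> C) :
  0 < k -> - (PI / 2) < th < PI / 2 -> admissible h -> (exists t, h t <> 0) ->
  csol h k u -> (forall x, graph h x -> u x = (- plane_data th k x)%C) -> far k u P ->
  0 < t0 < PI -> 0 < d -> (forall t, Rabs (t - t0) < d -> P (cos t) = RtoC 0) -> False.
Proof.
  intros Hk Hth Hh [t Ht] Hu Hbc HP Ht0 Hd Harc. apply Ht.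
  assert (Hz : flat_zero h u).
  { intros x Hx. rewrite Hbc by (unfold graph; simpl; lra).
    rewrite plane_data_flat. ring. }
  pose proof (csol_far_arc_zero h k t0 d u P Hk Hh Hu Hz HP Ht0 Hd Harc) as Hab.
  pose proof (csol_boundary_zero h k u Hu Hab) as Hg.
  apply (sine_vanishing_profile h (k * cos th) Hh).
  - apply Rmult_lt_0_compat; [lra|]. apply cos_gt_0; lra.
  - intros s. apply (plane_data_zero th k s (h s)).
    assert (Hgs : graph h (s, h s)) by reflexivity.
    specialize (Hbc _ Hgs). rewrite (Hg _ Hgs) in Hbc.
    replace (plane_data th k (s, h s)) with (- - plane_data th k (s, h s))%C by ring.
    rewrite <- Hbc. ring.
Qed.

Lemma sin_injective (a b : R) :
  - (PI / 2) < a < PI / 2 -> - (PI / 2) < b < PI / 2 -> sin a = sin b -> a = b.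
Proof.
  intros Ha Hb E. destruct (Rtotal_order a b) as [H|[H|H]]; trivial.
  - assert (sin a < sin b) by (apply sin_increasing_1; lra). lra.
  - assert (sin b < sin a) by (apply sin_increasing_1; lra). lra.
Qed.

Lemma Cmod_sum_rotated (a b : C) (tau : R) :
  Cmod (a + expi (- tau) * b)%C ^ 2 = Cmod a ^ 2 + Cmod b ^ 2 +
    2 * ((Re a * Re b + Im a * Im b) * cos tau -
         (Im a * Re b - Re a * Im b) * sin tau).
Proof.
  rewrite !Cmod2_alt. destruct a as [a1 a2]. destruct b as [b1 b2].
  unfold expi, Re, Im; simpl. rewrite cos_neg, sin_neg.
  pose proof (sin2_cos2 tau) as H. unfold Rsqr in H.
  set (c := cos tau) in *. set (s := sin tau) in *.
  apply Rminus_diag_uniq.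
  match goal with |- ?z = 0 =>
    replace z with ((b1 * b1 + b2 * b2) * (s * s + c * c - 1)) by ring end.
  rewrite H. ring.
Qed.

(** With a conj(b) = x + i y, equality of moduli at angle s becomes x sin(s / 2) + y cos(s / 2) = 0
    after division by sin(s / 2) > 0. Two angles give a linear system of determinant sin((tau -
    tau') / 2), which is nonzero for distinct angles in (0, 2 pi). *)
Lemma rotated_modulus_unique (a b : C) (tau tau' : R) :
  0 < tau < 2 * PI -> 0 < tau' < 2 * PI ->
  Cmod (a + b)%C = Cmod (a + expi (- tau) * b)%C ->
  Cmod (a + b)%C = Cmod (a + expi (- tau') * b)%C ->
  tau = tau' \/ a = RtoC 0 \/ b = RtoC 0.
Proof.
  intros Ht Ht' E E'.
  set (x := Re a * Re b + Im a * Im b). set (y := Im a * Re b - Re a * Im b).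
  assert (E0 : Cmod (a + b)%C ^ 2 = Cmod a ^ 2 + Cmod b ^ 2 + 2 * x).
  { pose proof (Cmod_sum_rotated a b 0) as H.
    rewrite Ropp_0, expi_0, cos_0, sin_0, Cmult_1_l in H.
    rewrite H. unfold x. ring. }
  assert (Hhalf : forall s, 0 < s < 2 * PI ->
            Cmod (a + b)%C = Cmod (a + expi (- s) * b)%C ->
            x * sin (s / 2) + y * cos (s / 2) = 0).
  { intros s Hs Es. apply (f_equal (fun z => z ^ 2)) in Es.
    rewrite E0, Cmod_sum_rotated in Es. fold x y in Es.
    replace s with (2 * (s / 2)) in Es by field.
    rewrite cos_2a_sin, sin_2a in Es.
    assert (Hp : 0 < sin (s / 2)) by (apply sin_gt_0; lra).
    assert (H0 : sin (s / 2) * (x * sin (s / 2) + y * cos (s / 2)) = 0) by lra.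
    apply Rmult_integral in H0. destruct H0; lra. }
  pose proof (Hhalf tau Ht E) as H1. pose proof (Hhalf tau' Ht' E') as H2.
  destruct (Req_dec (sin (tau / 2 - tau' / 2)) 0) as [Hs|Hs].
  - left. apply sin_eq_0_0 in Hs. destruct Hs as [n Hn].
    pose proof PI_RGT_0.
    assert (Hn1 : (-1 < n)%Z) by (apply lt_IZR; nra).
    assert (Hn2 : (n < 1)%Z) by (apply lt_IZR; nra).
    assert (n = 0)%Z by lia. subst n. lra.
  - right. rewrite sin_minus in Hs.
    assert (Hx : x = 0).
    { assert (H : x * (sin (tau / 2) * cos (tau' / 2) - cos (tau / 2) * sin (tau' / 2)) = 0).
      { replace (x * (sin (tau / 2) * cos (tau' / 2) - cos (tau / 2) * sin (tau' / 2)))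
          with ((x * sin (tau / 2)) * cos (tau' / 2) - cos (tau / 2) * (x * sin (tau' / 2)))
          by ring.
        replace (x * sin (tau / 2)) with (- (y * cos (tau / 2))) by lra.
        replace (x * sin (tau' / 2)) with (- (y * cos (tau' / 2))) by lra. ring. }
      apply Rmult_integral in H. tauto. }
    assert (Hy : y = 0).
    { assert (H : y * (sin (tau / 2) * cos (tau' / 2) - cos (tau / 2) * sin (tau' / 2)) = 0).
      { replace (y * (sin (tau / 2) * cos (tau' / 2) - cos (tau / 2) * sin (tau' / 2)))
          with (sin (tau / 2) * (y * cos (tau' / 2)) - (y * cos (tau / 2)) * sin (tau' / 2))
          by ring.
        replace (y * cos (tau / 2)) with (- (x * sin (tau / 2))) by lra.
        replace (y * cos (tau' / 2)) with (- (x * sin (tau' / 2))) by lra. ring. }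
      apply Rmult_integral in H. tauto. }
    assert (Hprod : Cmod a ^ 2 * Cmod b ^ 2 = 0).
    { rewrite !Cmod2_alt.
      replace ((Re a ^ 2 + Im a ^ 2) * (Re b ^ 2 + Im b ^ 2)) with (x ^ 2 + y ^ 2)
        by (unfold x, y; ring). rewrite Hx, Hy. ring. }
    apply Rmult_integral in Hprod.
    destruct Hprod as [H|H]; [left|right]; apply Cmod_eq_0; nra.
Qed.

Lemma expi_2PI (n : Z) (t : R) : expi (2 * PI * IZR n + t) = expi t.
Proof.
  rewrite expi_plus.
  assert (H : expi (2 * PI * IZR n) = RtoC 1).
  { replace (2 * PI * IZR n) with (2 * (IZR n * PI)) by ring.
    unfold expi. rewrite cos_2a_sin, sin_2a.
    rewrite (sin_eq_0_1 (IZR n * PI)) by (now exists n).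
    apply injective_projections; simpl; ring. }
  rewrite H. ring.
Qed.

(* The solutions for the two plane waves separately are recovered from the
   solutions for [h] and for the shift that turns the relative phase into -1. *)
Lemma single_wave_decomposition (h : R -> R) (k th1 th2 : R)
  (us uinf : R * R -> C) (usl uinfl : R -> R * R -> C) :
  admissible h -> 0 < k -> sin th1 <> sin th2 ->
  is_scattering_solution h th1 th2 k us -> is_far_field k us uinf ->
  (forall l, is_scattering_solution (shift l h) th1 th2 k (usl l)) ->
  (forall l, is_far_field k (usl l) (uinfl l)) ->
  exists u1 u2 Q1 Q2,
    (csol h k u1 /\ csol h k u2) /\
    (forall x, graph h x -> u1 x = (- plane_data th1 k x)%C) /\
    (forall x, graph h x -> u2 x = (- plane_data th2 k x)%C) /\
    (far k u1 Q1 /\ far k u2 Q2) /\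
    (forall l c, -1 < c < 1 ->
       Cmod (uinf (c, sqrt (1 - c ^ 2))) = Cmod (Q1 c + Q2 c)%C /\
       Cmod (uinfl l (c, sqrt (1 - c ^ 2))) =
         Cmod (Q1 c + expi (- (k * l * (sin th1 - sin th2))) * Q2 c)%C).
Proof.
  intros Hh Hk Hsin [Hus Huniq] Hff Husl Hffl.
  set (s1 := sin th1) in *. set (s2 := sin th2) in *.
  assert (Hflat : forall g u, solves_scattering g th1 th2 k u -> flat_zero g u).
  { intros g u Hu x Hx. destruct Hu as [_ [_ [_ [Hbc _]]]].
    rewrite Hbc by (unfold graph; simpl; lra).
    rewrite incident_plus_reflected, !plane_data_flat. ring. }
  assert (Hcsol : forall g u, solves_scattering g th1 th2 k u -> csol g k u).
  { intros g u [A1 [A2 [A3 [_ A5]]]]. exact (conj (conj A1 A3) (conj A2 A5)). }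
  assert (Hbc : forall g u, solves_scattering g th1 th2 k u -> forall x, graph g x ->
            u x = (- (plane_data th1 k x + plane_data th2 k x))%C).
  { intros g u [_ [_ [_ [A4 _]]]] x Hx. now rewrite A4, incident_plus_reflected. }
  pose proof (fun l => shift_admissible l h Hh) as Hhl.
  destruct (far_exists h k us uinf Hh (Hcsol _ _ Hus) (Hflat _ _ Hus) Hff)
    as [P0 [HP0 EP0]].
  assert (HPl : forall l, exists P, far k (usl l) P /\
            forall c, -1 < c < 1 -> P c = uinfl l (c, sqrt (1 - c ^ 2))).
  { intros l. destruct (Husl l) as [A _].
    exact (far_exists _ k _ _ (Hhl l) (Hcsol _ _ A) (Hflat _ _ A) (Hffl l)). }
  set (v := fun l => translate l (usl l)).
  assert (Hv : forall l, csol h k (v l)).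
  { intros l. destruct (Husl l) as [A _]. destruct (HPl l) as [P [HP _]].
    exact (csol_translate h k l (usl l) Hh (Hcsol _ _ A) (far_bounded k _ P HP)). }
  assert (Hvbc : forall l x, graph h x -> v l x =
    (- (expi (k * l * s1) * plane_data th1 k x + expi (k * l * s2) * plane_data th2 k x))%C).
  { intros l [x y] Hx. destruct (Husl l) as [A _]. unfold v, translate; simpl fst; simpl snd.
    rewrite (Hbc _ _ A), !plane_data_translate; [reflexivity|].
    unfold graph in *; simpl in *. now rewrite shift_translate. }
  set (sg := k * (s1 - s2)).
  assert (Hsg : sg <> 0).
  { unfold sg. apply Rmult_integral_contrapositive_currified; lra. }
  (* At this shift the relative phase of the two waves is pi, and [g] normalises the phase of the
     second one. Thus [g] times the translated field has the data of [us] with the first wave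
     reversed in sign, and half the difference and half the sum with [us] isolate the waves. *)
  set (ls := PI / sg). set (g := expi (- (k * ls * s2))).
  assert (Hphase : (g * expi (k * ls * s1))%C = (- RtoC 1)%C).
  { unfold g. rewrite <- expi_plus.
    replace (- (k * ls * s2) + k * ls * s1) with PI by (unfold ls, sg; field; lra).
    unfold expi. rewrite cos_PI, sin_PI. apply injective_projections; simpl; ring. }
  assert (Hphase2 : (g * expi (k * ls * s2))%C = RtoC 1) by apply expi_opp.
  set (u1 := fun x => (RtoC (/ 2) * us x + (- (RtoC (/ 2) * g)) * v ls x)%C).
  set (u2 := fun x => (RtoC (/ 2) * us x + (RtoC (/ 2) * g) * v ls x)%C).
  assert (Hhalf : (RtoC (/ 2) + RtoC (/ 2))%C = RtoC 1).
  { rewrite <- RtoC_plus. f_equal. field. }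
  assert (Hu1 : csol h k u1) by (apply csol_lin; auto).
  assert (Hu2 : csol h k u2) by (apply csol_lin; auto).
  assert (Hu1bc : forall x, graph h x -> u1 x = (- plane_data th1 k x)%C).
  { intros x Hx. unfold u1. rewrite (Hbc h us Hus x Hx), (Hvbc ls x Hx).
    set (w1 := plane_data th1 k x). set (w2 := plane_data th2 k x).
    transitivity (RtoC (/ 2) * ((g * expi (k * ls * s1)) * w1
      + (g * expi (k * ls * s2)) * w2 - (w1 + w2)))%C; [ring|].
    rewrite Hphase, Hphase2.
    transitivity (- ((RtoC (/ 2) + RtoC (/ 2)) * w1))%C; [ring|]. rewrite Hhalf. ring. }
  assert (Hu2bc : forall x, graph h x -> u2 x = (- plane_data th2 k x)%C).
  { intros x Hx. unfold u2. rewrite (Hbc h us Hus x Hx), (Hvbc ls x Hx).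
    set (w1 := plane_data th1 k x). set (w2 := plane_data th2 k x).
    transitivity (RtoC (/ 2) * (- ((g * expi (k * ls * s1)) * w1
      + (g * expi (k * ls * s2)) * w2) - (w1 + w2)))%C; [ring|].
    rewrite Hphase, Hphase2.
    transitivity (- ((RtoC (/ 2) + RtoC (/ 2)) * w2))%C; [ring|]. rewrite Hhalf. ring. }
  destruct (HPl ls) as [Ps [HPs _]].
  pose proof (far_translate k ls _ _ Hk HPs) as HPt. fold (v ls) in HPt.
  pose proof (far_lin k (RtoC (/ 2)) (- (RtoC (/ 2) * g)) _ _ _ _ HP0 HPt) as HQ1.
  pose proof (far_lin k (RtoC (/ 2)) (RtoC (/ 2) * g) _ _ _ _ HP0 HPt) as HQ2.
  fold u1 in HQ1. fold u2 in HQ2.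
  set (Q1 := fun c => (RtoC (/ 2) * P0 c + - (RtoC (/ 2) * g) * (expi (k * ls * c) * Ps c))%C) in *.
  set (Q2 := fun c => (RtoC (/ 2) * P0 c + RtoC (/ 2) * g * (expi (k * ls * c) * Ps c))%C) in *.
  assert (Hv12 : forall l x, above_or_on h x ->
            v l x = (expi (k * l * s1) * u1 x + expi (k * l * s2) * u2 x)%C).
  { intros l x Hx.
    (* Uniqueness is available only for the two-wave problem on [h]. The difference [w] has zero
       boundary data, so [us + w] is another solution of that problem, and uniqueness gives
       [w = 0]. *)
    set (w := fun x => (RtoC 1 * v l x + - RtoC 1 *
      (expi (k * l * s1) * u1 x + expi (k * l * s2) * u2 x))%C).
    assert (Hw : csol h k w).
    { apply csol_lin; auto. apply (csol_lin h k _ _ u1 u2); auto. }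
    assert (Hsum : csol h k (fun x => (RtoC 1 * us x + RtoC 1 * w x)%C)).
    { apply csol_lin; auto. }
    assert (Hsol : solves_scattering h th1 th2 k (fun x => (RtoC 1 * us x + RtoC 1 * w x)%C)).
    { destruct Hsum as [[A1 A3] [A2 A5]]. refine (conj A1 (conj A2 (conj A3 (conj _ A5)))).
      intros y Hy. rewrite incident_plus_reflected. unfold w.
      rewrite (Hbc h us Hus y Hy), (Hvbc l y Hy), (Hu1bc y Hy), (Hu2bc y Hy). ring. }
    pose proof (Huniq _ Hsol x Hx) as E. simpl in E. unfold w in E.
    transitivity ((RtoC 1 * us x + RtoC 1 * (RtoC 1 * v l x + - RtoC 1 *
      (expi (k * l * s1) * u1 x + expi (k * l * s2) * u2 x))) - us x +
      (expi (k * l * s1) * u1 x + expi (k * l * s2) * u2 x))%C; [ring|].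
    rewrite E. ring. }
  assert (Hlarge : forall x y, 0 < y -> exists r0, forall r, r0 < r ->
            above_or_on h (r * x, r * y)).
  { intros x y Hy. destruct (far_above h Hh) as [R0 [HR0 Hfar]].
    exists (R0 / y + 1). intros r Hr.
    assert (Hq : 0 < R0 / y) by (apply Rdiv_lt_0_compat; lra).
    assert (Hry : R0 < r * y).
    { replace R0 with (R0 / y * y) by (field; lra). apply Rmult_lt_compat_r; lra. }
    assert (Hn : R0 ^ 2 < (r * x) ^ 2 + (r * y) ^ 2).
    { pose proof (pow2_ge_0 (r * x)). nra. }
    left. change (h (r * x) < r * y). apply (proj1 (Hfar _ _ Hn)). lra. }
  exists u1, u2, Q1, Q2.
  split; [now split|split; [exact Hu1bc|split; [exact Hu2bc|split; [now split|]]]].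
  intros l c Hc. split.
  - rewrite <- EP0 by exact Hc.
    pose proof (far_lin k (RtoC 1) (RtoC 1) _ _ _ _ HQ1 HQ2) as HS.
    rewrite (far_unique k us _ P0 _ HP0 HS); [|intros x y _; exists 0; intros r _|exact Hc].
    + f_equal. ring.
    + unfold u1, u2.
      transitivity ((RtoC (/ 2) + RtoC (/ 2)) * us (r * x, r * y)%R)%C; [|ring].
      rewrite Hhalf. ring.
  - destruct (HPl l) as [P [HP EP]]. rewrite <- EP by exact Hc.
    pose proof (far_translate k l _ _ Hk HP) as HT. fold (v l) in HT.
    pose proof (far_lin k (expi (k * l * s1)) (expi (k * l * s2)) _ _ _ _ HQ1 HQ2) as HS.
    assert (E : (expi (k * l * c) * P c = expi (k * l * s1) * Q1 c + expi (k * l * s2) * Q2 c)%C).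
    { apply (far_unique k (v l) _ _ _ HT HS); [|exact Hc].
      intros x y Hy. destruct (Hlarge x y Hy) as [r0 Hr0]. exists r0.
      intros r Hr. apply Hv12. now apply Hr0. }
    (* The unimodular factors from the translation and from the first wave drop out of the modulus;
       only the relative phase remains. *)
    rewrite <- (Rmult_1_l (Cmod (P c))), <- (Cmod_expi (k * l * c)), <- Cmod_mult, E.
    rewrite <- (Rmult_1_l (Cmod (Q1 c + _)%C)), <- (Cmod_expi (k * l * s1)), <- Cmod_mult.
    f_equal.
    transitivity (expi (k * l * s1) * Q1 c +
      (expi (k * l * s1) * expi (- (k * l * (s1 - s2)))) * Q2 c)%C; [|ring].
    rewrite <- expi_plus. f_equal. f_equal. f_equal. ring.
Qed.

Lemma upper_circle_cosine (xh : R * R) :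
  upper_circle xh -> -1 < fst xh < 1 /\ xh = (fst xh, sqrt (1 - fst xh ^ 2)).
Proof.
  destruct xh as [c s]. intros [H1 H2]. simpl in H2 |- *.
  pose proof (cosine_range c s H2) as Hc. pose proof (sine_of_cosine c s H2) as Hs.
  rewrite H1 in Hc, Hs. rewrite !Rdiv_1_r in *. split; [lra|].
  f_equal. symmetry. exact Hs.
Qed.

Lemma cosine_upper_circle (c : R) : -1 < c < 1 -> upper_circle (c, sqrt (1 - c ^ 2)).
Proof.
  intros Hc. split.
  - pose proof (enorm_of_cosine 1 c ltac:(lra) Hc) as H. now rewrite !Rmult_1_l in H.
  - apply sqrt_lt_R0. nra.
Qed.

(** The solutions are supplied for every real shift, because the single-wave fields are extracted at
    the shift of relative phase pi. *)
Theorem theorem3p2 :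
  forall (h : R -> R) (k th1 th2 : R)
    (us uinf : R * R -> C) (usl uinfl : R -> R * R -> C),
  C2_profile h ->
  compactly_supported h ->
  (exists t, h t <> 0) ->
  0 < k ->
  - (PI / 2) < th1 < PI / 2 ->
  - (PI / 2) < th2 < PI / 2 ->
  th1 <> th2 ->
  is_scattering_solution h th1 th2 k us ->
  is_far_field k us uinf ->
  (forall l : R, is_scattering_solution (shift l h) th1 th2 k (usl l)) ->
  (forall l : R, is_far_field k (usl l) (uinfl l)) ->
  (forall n : Z, same_modulus uinf (uinfl (shift_value th1 th2 k n 0))) /\
  (forall tau tau' : R,
     0 < tau < 2 * PI ->
     0 < tau' < 2 * PI ->
     (forall n : Z, same_modulus uinf (uinfl (shift_value th1 th2 k n tau))) ->
     (forall n : Z, same_modulus uinf (uinfl (shift_value th1 th2 k n tau'))) ->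
     tau = tau').
Proof.
  intros h k th1 th2 us uinf usl uinfl HC2 Hcs Hne Hk Hth1 Hth2 Hth Hus Hff Husl Hffl.
  pose proof (C2_profile_admissible h HC2 Hcs) as Hh.
  assert (Hsin : sin th1 <> sin th2).
  { intros E. apply Hth. now apply sin_injective. }
  destruct (single_wave_decomposition h k th1 th2 us uinf usl uinfl Hh Hk Hsin Hus Hff
    Husl Hffl) as [u1 [u2 [Q1 [Q2 [[Hu1 Hu2] [Hb1 [Hb2 [[HQ1 HQ2] Hmod]]]]]]]].
  assert (Hshift : forall n tau, expi (- (k * shift_value th1 th2 k n tau * (sin th1 - sin th2)))
            = expi (- tau)).
  { intros n tau. unfold shift_value.
    replace (- (k * ((2 * PI * IZR n + tau) / (k * (sin th1 - sin th2))) *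
      (sin th1 - sin th2))) with (2 * PI * IZR (- n) + - tau).
    - apply expi_2PI.
    - rewrite opp_IZR. field. split; lra. }
  split.
  - intros n xh Hxh. destruct (upper_circle_cosine xh Hxh) as [Hc ->].
    destruct (Hmod (shift_value th1 th2 k n 0) _ Hc) as [-> ->].
    rewrite Hshift, Ropp_0, expi_0, Cmult_1_l. reflexivity.
  - intros tau tau' Ht Ht' H H'.
    destruct (Req_dec tau tau') as [|Hneq]; trivial. exfalso.
    assert (Hprod : forall c, -1 < c < 1 -> Q1 c = RtoC 0 \/ Q2 c = RtoC 0).
    { intros c Hc. pose proof (cosine_upper_circle c Hc) as Hxh.
      specialize (H 0%Z _ Hxh). specialize (H' 0%Z _ Hxh).
      destruct (Hmod (shift_value th1 th2 k 0 tau) c Hc) as [A B].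
      destruct (Hmod (shift_value th1 th2 k 0 tau') c Hc) as [_ B'].
      rewrite A, B, Hshift in H. rewrite A, B', Hshift in H'.
      destruct (rotated_modulus_unique _ _ tau tau' Ht Ht' H H'); tauto. }
    pose proof PI2_1 as HPI.
    assert (Hcos : forall t, 0 < t < PI -> -1 < cos t < 1).
    { intros t Hti. rewrite <- cos_0, <- cos_PI.
      split; apply cos_decreasing_1; lra. }
    (* If [Q2] is nonzero in some direction, it is so nearby by continuity, and [Q1] vanishes on an
       arc; otherwise [Q2] vanishes on every arc. *)
    destruct (classic (exists t0, 0 < t0 < PI /\ Q2 (cos t0) <> RtoC 0))
      as [[t0 [Ht0 Hq]]|Hno].
    + destruct HQ2 as [HcQ2 HQ2'].
      destruct (continuous_C_uniform Q2 (-1) 1 HcQ2 (Cmod (Q2 (cos t0))))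
        as [d [Hd Hunif]]; [now apply Cmod_gt_0|].
      set (e := Rmin d (Rmin t0 (PI - t0))).
      assert (He : 0 < e) by (repeat apply Rmin_glb_lt; lra).
      assert (He1 : e <= d) by apply Rmin_l.
      assert (He2 : e <= Rmin t0 (PI - t0)) by apply Rmin_r.
      pose proof (Rmin_l t0 (PI - t0)). pose proof (Rmin_r t0 (PI - t0)).
      apply (single_wave_far_nonzero h k th1 t0 e u1 Q1); trivial.
      intros t Hte. apply Rabs_def2 in Hte as Hte'.
      destruct (Hprod (cos t)) as [|Hz]; trivial; [apply Hcos; lra|exfalso].
      pose proof (Hcos t ltac:(lra)). pose proof (Hcos t0 Ht0).
      assert (Hlip : Rabs (cos t0 - cos t) < d).
      { rewrite !cos_sin. eapply Rle_lt_trans; [apply sin_lipschitz|].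
        replace (PI / 2 + t0 - (PI / 2 + t)) with (- (t - t0)) by ring.
        rewrite Rabs_Ropp. lra. }
      specialize (Hunif (cos t0) (cos t) ltac:(lra) ltac:(lra) Hlip).
      rewrite Hz in Hunif.
      replace (Q2 (cos t0) - RtoC 0)%C with (Q2 (cos t0)) in Hunif by ring. lra.
    (* Any arc inside (0, pi) would do; the one from 1 / 2 to 3 / 2 lies inside because pi > 2. *)
    + apply (single_wave_far_nonzero h k th2 1 (1 / 2) u2 Q2); trivial; try lra.
      intros t Hte. apply Rabs_def2 in Hte. apply NNPP. intros Hz. apply Hno.
      exists t. split; [lra|exact Hz].
Qed.
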